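(* Let $H$ be a graph on $k$ vertices. If $H$ or its complement $\overline{H}$ is (1) a complete graph, (2) a star, or (3) a disjoint union of two adjacent edges and an isolated vertex (i.e. $P_3+K_1$), then $f(H)=\infty$. Otherwise, $f(H)\leq k+2$ if $k$ is even, and $f(H)\leq k+1$ if $k$ is odd.
   Context: All graphs are finite and simple. For a graph $H$ on $k$ vertices and a graph $G$ on at least $k$ vertices, $G\longrightarrow H$ (''$G$ arrows $H$'') means: for every coloring of the vertices of $G$ using exactly $k$ colors (all $k$ color classes nonempty; the coloring need not be proper), $G$ has an induced subgraph isomorphic to $H$ whose vertices have pairwise distinct colors. Define $f(H)=\max\{|V(G)| : G\longrightarrow H\}$ if this maximum exists, and $f(H)=\infty$ otherwise. $P_3$ is the path on 3 vertices; $+$ denotes vertex-disjoint union. *)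

(* Defs.v *)
From HB Require Import structures.
From mathcomp Require Import all_boot.
From mathcomp Require Import boolp.

Set Implicit Arguments.
Unset Strict Implicit.
Unset Printing Implicit Defensive.

Record sgraph := SGraph {
  vertex :> finType;
  adj : rel vertex;
  adj_sym : symmetric adj;
  adj_irr : irreflexive adj }.

Definition sg_iso (G H : sgraph) : Prop :=
  exists2 g : G -> H, bijective g & forall x y, adj (g x) (g y) = adj x y.

Section Induced.
Variables (G : sgraph) (S : {set G}).

Definition induced_rel : rel {x : G | x \in S} :=
  fun x y => adj (val x) (val y).

Lemma induced_sym : symmetric induced_rel.
Proof. by move=> x y; apply: adj_sym. Qed.

Lemma induced_irr : irreflexive induced_rel.
Proof. by move=> x; apply: adj_irr. Qed.

Definition induced : sgraph := SGraph induced_sym induced_irr.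
End Induced.

Section Complement.
Variable G : sgraph.

Definition compl_rel : rel G := fun x y => (x != y) && ~~ adj x y.

Lemma compl_sym : symmetric compl_rel.
Proof. by move=> x y; rewrite /compl_rel eq_sym adj_sym. Qed.

Lemma compl_irr : irreflexive compl_rel.
Proof. by move=> x; rewrite /compl_rel eqxx. Qed.

Definition compl : sgraph := SGraph compl_sym compl_irr.
End Complement.

Section DisjointUnion.
Variables G H : sgraph.

Definition union_rel : rel (G + H)%type := fun u v =>
  match u, v with
  | inl x, inl y => adj x y
  | inr x, inr y => adj x y
  | _, _ => false
  end.

Lemma union_sym : symmetric union_rel.
Proof. by move=> [x|x] [y|y] //=; apply: adj_sym. Qed.

Lemma union_irr : irreflexive union_rel.
Proof. by move=> [x|x] /=; apply: adj_irr. Qed.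

Definition disjoint_union : sgraph := SGraph union_sym union_irr.
End DisjointUnion.

Section Families.
Variable n : nat.

Definition complete_rel : rel 'I_n := fun i j => i != j.

Lemma complete_sym : symmetric complete_rel.
Proof. by move=> i j; rewrite /complete_rel eq_sym. Qed.

Lemma complete_irr : irreflexive complete_rel.
Proof. by move=> i; rewrite /complete_rel eqxx. Qed.

Definition complete_graph : sgraph := SGraph complete_sym complete_irr.

Definition path_rel : rel 'I_n := fun i j => (i.+1 == j) || (j.+1 == i).

Lemma path_sym : symmetric path_rel.
Proof. by move=> i j; rewrite /path_rel orbC. Qed.

Lemma path_irr : irreflexive path_rel.
Proof. by move=> i; rewrite /path_rel orbb gtn_eqF. Qed.

Definition path_graph : sgraph := SGraph path_sym path_irr.

(* K_{1,n}: the centre is None and the leaves are the Some i *)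
Definition star_rel : rel (option 'I_n) := fun u v => isSome u != isSome v.

Lemma star_sym : symmetric star_rel.
Proof. by move=> u v; rewrite /star_rel eq_sym. Qed.

Lemma star_irr : irreflexive star_rel.
Proof. by move=> u; rewrite /star_rel eqxx. Qed.

Definition star_graph : sgraph := SGraph star_sym star_irr.
End Families.

Definition is_complete (H : sgraph) : Prop :=
  exists n, sg_iso H (complete_graph n).

Definition is_star (H : sgraph) : Prop :=
  exists n, sg_iso H (star_graph n).

Definition is_P3_plus_K1 (H : sgraph) : Prop :=
  sg_iso H (disjoint_union (path_graph 3) (complete_graph 1)).

Definition exceptional (H : sgraph) : Prop :=
  [\/ is_complete H, is_star H | is_P3_plus_K1 H].

(* A coloring with exactly k colors is a surjection onto 'I_k. *)
Definition arrows (G H : sgraph) : Prop :=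
  #|H| <= #|G| /\
  forall c : G -> 'I_#|H|, (forall i, exists v, c v = i) ->
    exists S : {set G}, sg_iso (induced S) H /\ {in S &, injective c}.

Definition is_max_arrow (H : sgraph) (n : nat) : Prop :=
  (exists2 G : sgraph, #|G| = n & arrows G H) /\
  (forall G : sgraph, arrows G H -> #|G| <= n).

(* Extended natural numbers are encoded as option nat, with None as infinity. *)
Definition f (H : sgraph) : option nat :=
  if pselect (exists n, is_max_arrow H n) is left e
  then Some (sval (cid e)) else None.

Definition le_enat (x : option nat) (m : nat) : Prop :=
  if x is Some n then n <= m else False.

(* Main.v *)
Require Import Defs.
From mathcomp Require Import all_boot perm zify.
From mathcomp Require boolp all_order all_algebra all_field ring.

(** Write [k] for the order of [H] and suppose that [G] arrows [H], where [G] has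
    [n] vertices. Call a set of vertices good if it induces a copy of [H].

    Infinite cases. The class of graphs with arbitrarily large arrowing graphs is
    closed under complement. A large complete graph arrows a complete graph, and
    a large star arrows a star, because the centre may represent its own colour.
    For [P3 + K1] the vertices of the arrowing graph are grouped in linearly
    ordered blocks of three. Adjacency depends on the blocks only through their
    order, so four vertices of different colours lie in at most four blocks and
    the claim reduces to the 4-colourings of one graph on 12 vertices, which are
    searched ([P3K1_large]).

    Finite cases. The tools come from colourings with few nontrivial colour
    classes. One class of [n - k + 1] vertices shows that this class contains the
    complement of a good set ([good_in]), hence that any [k - 1] vertices extend
    to a good set ([extend]). Two classes give [two_class], and merging at most
    [n - k] pairs of vertices gives a good set that contains none of the pairs
    ([avoid_pairs]). All good sets span equally many edges, so comparing two of
    them that differ by an exchange gives equations between degrees ([swap_dg],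
    [replace_dg]).

    The bound [n <= k + 2] ([order_bound]). Suppose [n >= k + 3] and [k >= 7]. By
    [no_wide_degrees] one may pass to the complement and assume that all degrees
    of [H] are at most [k - 3]. Then [G] and [H] have the same maximum degree [D]
    ([top_exact]): a vertex of degree [D] inside a good set has no neighbour
    outside. This yields [k <= 2 * D + 2], more than [n - k] vertices of degree [D]
    in [G], and vertices in [H] of every positive degree from [D - (n - k)] to [D].
    If [D >= 5], then [G] turns out to be regular, and vertices of degrees [D - 3] to
    [D] in a copy of [H] have too many common neighbours, or common non-neighbours,
    among the three vertices left out ([max_degree_le4]). The cases [D = 3] and
    [D = 4] come down to [n = k + 3], where the number of edges of a triple plus its
    degree deficits is the same for all complements of good sets, while any four
    vertices contain such a complement ([weight_const]). The orders [k = 5] and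
    [k = 6] are settled by a search based on the degree sequences that [k - 1]
    vertices of [G] may have, and [k = 4] by the Ramsey number [R(3, 3) = 6].

    The bound [n <= k + 1] for odd [k] ([order_odd]). Suppose [n = k + 2], and join
    two vertices when no good set is the complement of the pair. This auxiliary
    graph has no triangle and no 4-cycle, while the degree sum of every other
    pair is a constant [c], plus 1 if the pair is adjacent ([left_out_dg]). After
    passing to the complement if needed, [c = 2 * a]. Counting edges shows that [G]
    is [a]-regular; then its edges belong to the auxiliary graph, and [G] is a
    Moore graph of diameter two with [n = a ^ 2 + 1] vertices ([moore]). As [n] is
    odd, [a] is even, so [4 * a - 3] is 5 modulo 8 and not a square, which the
    multiplicities of the eigenvalues of [G] allow only for [a = 2], that is
    [k = 3] ([moore_degree_odd]). *)

Set Implicit Arguments.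
Unset Strict Implicit.
Unset Printing Implicit Defensive.

(** * Degrees, induced copies and colourings *)

(** Degree counts need only the order facts of the context and the bounds of
    the 0-1 terms. Everything else is discarded, since each remaining boolean
    would double the number of cases. *)
Ltac slia :=
  repeat match goal with H : is_true ?b |- _ =>
    lazymatch b with leq _ _ => fail | _ => clear H end end;
  repeat match goal with H : @eq bool _ _ |- _ => clear H end;
  repeat match goal with x := _ : nat |- _ => subst x end;
  repeat match goal with
    | H : is_true (leq _ _) |- _ => revert H | H : @eq nat _ _ |- _ => revert H
    | H : @eq (Equality.sort Datatypes_nat__canonical__eqtype_Equality) _ _ |- _ => revert H end;
  change (Equality.sort Datatypes_nat__canonical__eqtype_Equality) with nat;
  repeat match goal with |- context [Equality.sort (fintype_Finite__to__eqtype_Equality ?T)] =>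
    change (Equality.sort (fintype_Finite__to__eqtype_Equality T)) with (Finite.sort T) end;
  change (nat_of_bool true) with 1 in *; change (nat_of_bool false) with 0 in *;
  repeat (let gen b := (let h := fresh in let x := fresh in
      have h := leq_b1 b; set (x := nat_of_bool b) in *; clearbody x) in
    match goal with
    | |- context [nat_of_bool ?b] => gen b
    | H : context [nat_of_bool ?b] |- _ => gen b
    end); lia.

Section Degree.
Variable G : sgraph.
Implicit Types (A B K W : {set G}) (x y z b : G).

Definition dg A x : nat := \sum_(y in A) adj x y.
(** Twice the number of edges inside [A]; keeping the factor 2 spares all
    counts a division. *)
Definition ee A : nat := \sum_(x in A) dg A x.

Lemma adjC x y : adj x y = adj y x. Proof. exact: adj_sym. Qed.
Lemma adjxx x : adj x x = false. Proof. exact: adj_irr. Qed.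

Lemma adj_neq x y : adj x y -> x != y.
Proof. by apply: contraTneq => ->; rewrite adjxx. Qed.

Lemma dgE A x : dg A x = #|[set y in A | adj x y]|.
Proof.
rewrite /dg -sum1_card big_mkcond /= [RHS]big_mkcond /=.
by apply: eq_bigr => y _; rewrite inE; case: (y \in A); case: (adj x y).
Qed.

Lemma dg_U1 A x z : z \notin A -> dg (z |: A) x = adj x z + dg A x.
Proof. by move=> zA; rewrite /dg big_setU1. Qed.

Lemma dg_D1 A x z : z \in A -> dg A x = adj x z + dg (A :\ z) x.
Proof. by move=> zA; rewrite /dg (big_setD1 z). Qed.

Lemma dg_D1x A x : dg (A :\ x) x = dg A x.
Proof.
case: (boolP (x \in A)) => [xA|xA]; first by rewrite [RHS](dg_D1 _ xA) adjxx.
by congr (dg _ x); apply/setP=> y; rewrite !inE; case: eqP => // ->; rewrite (negbTE xA).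
Qed.

Lemma dg_set0 x : dg set0 x = 0. Proof. by rewrite /dg big_set0. Qed.

Lemma dg_U A B x : [disjoint A & B] -> dg (A :|: B) x = dg A x + dg B x.
Proof. by move=> dAB; rewrite /dg -bigU //; apply: eq_bigl => y; rewrite !inE. Qed.

Lemma dg_sub A B x : A \subset B -> dg A x <= dg B x.
Proof. by move=> sAB; rewrite !dgE subset_leq_card //; apply/subsetP=> y; rewrite !inE => /andP[/(subsetP sAB)-> ->]. Qed.

Lemma dg_card A x : dg A x <= #|A|.
Proof. by rewrite dgE subset_leq_card //; apply/subsetP=> y; rewrite inE => /andP[]. Qed.

Lemma dg_compl A x : dg A x + dg (~: A) x = dg setT x.
Proof. by rewrite -dg_U ?setUCr // -setI_eq0 setICr. Qed.

Lemma ee_U1 A z : z \notin A -> ee (z |: A) = ee A + 2 * dg A z.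
Proof.
move=> zA; rewrite /ee big_setU1 //= dg_U1 // adjxx add0n.
under eq_bigr => x _ do rewrite dg_U1 //.
rewrite big_split /=.
have -> : \sum_(x in A) (adj x z : nat) = dg A z by apply: eq_bigr => x _; rewrite adjC.
by lia.
Qed.

Lemma ee_D1 A z : z \in A -> ee A = ee (A :\ z) + 2 * dg A z.
Proof.
move=> zA; rewrite -{1}(setD1K zA) ee_U1; last by rewrite !inE eqxx.
by rewrite dg_D1x.
Qed.
End Degree.

Section Good.
Variables (G H : sgraph).
Implicit Types (A B K W : {set G}) (x y z b : G).

Definition good K : Prop := sg_iso (induced K) H.

Lemma goodP K : good K <->
  exists g : H -> G, [/\ injective g, K = [set g i | i in [set: H]]
                       & forall i j, adj (g i) (g j) = adj i j].
Proof.
split=> [[h [h' hK h'K] hadj]|[g [gI -> gadj]]].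
  exists (fun i => val (h' i)); split.
  - by move=> i j /val_inj /(can_inj h'K).
  - apply/setP=> x; apply/idP/imsetP=> [xK|[i _ ->]]; last exact: valP (h' i).
    by exists (h (exist _ x xK)); rewrite ?inE // hK.
  - by move=> i j; have := hadj (h' i) (h' j); rewrite !h'K => ->.
have gin i : g i \in [set g i | i in [set: H]] by apply/imset_f; rewrite inE.
pose u i : induced [set g i | i in [set: H]] := exist _ (g i) (gin i).
have uI : injective u by move=> i j [] /gI.
have uS v : exists i, u i = v.
  case: v => x xK; case/imsetP: (xK) => i _ xe; exists i; apply: val_inj => /=.
  by rewrite xe.
have uc : #|H| >= #|{: induced [set g i | i in [set: H]]}|.
  rewrite card_sig /=; have -> : #|[pred x | x \in [set g i | i in [set: H]]]| = #|[set g i | i in [set: H]]| by apply: eq_card.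
  by rewrite (leq_trans (leq_imset_card _ _)) // cardsT.
have [v uv vu] := inj_card_bij uI uc.
exists v; first by exists u.
by move=> x y; rewrite -{2}(vu x) -{2}(vu y) /u /= /induced_rel /= gadj.
Qed.

Lemma good_card K : good K -> #|K| = #|H|.
Proof. by case/goodP=> g [gI -> _]; rewrite card_imset // cardsT. Qed.

Lemma good_dg K : good K -> forall x, x \in K -> exists i : H, dg K x = dg [set: H] i.
Proof.
case/goodP=> g [gI -> ga] x /imsetP[i _ ->]; exists i.
by rewrite /dg big_imset /=; [apply: eq_bigr=> j _; rewrite ga | move=> ? ? _ _; apply: gI].
Qed.

Lemma good_dg' K : good K -> forall i : H, exists2 x, x \in K & dg K x = dg [set: H] i.
Proof.
case/goodP=> g [gI -> ga] i; exists (g i); first by rewrite imset_f ?inE.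
by rewrite /dg big_imset /=; [apply: eq_bigr=> j _; rewrite ga | move=> ? ? _ _; apply: gI].
Qed.

Lemma good_ee K : good K -> ee K = ee [set: H].
Proof.
case/goodP=> g [gI -> ga].
rewrite /ee big_imset /=; last by move=> ? ? _ _; apply: gI.
apply: eq_bigr => i _; rewrite /dg big_imset /=; last by move=> ? ? _ _; apply: gI.
by apply: eq_bigr=> j _; rewrite ga.
Qed.

Hypothesis arr : arrows G H.
Let k := #|H|.
Let n := #|G|.

Lemma arr_le : k <= n. Proof. by case: arr. Qed.

(** Surplus colours are identified with the last one, which leaves exactly
    [k] colours; a set that is injectively coloured afterwards was so before. *)
Lemma rainbow (T : finType) (c : G -> T) : 0 < k -> k <= #|[set c v | v in [set: G]]| ->
  exists K, good K /\ {in K &, injective c}.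
Proof.
move=> k0 kc; set I := [set c v | v in [set: G]] in kc.
have kpos : k.-1 < k by lia.
have cI v : c v \in I by apply: imset_f; rewrite inE.
pose r v := index (c v) (enum I).
have rlt v : r v < #|I| by rewrite /r cardE index_mem mem_enum.
have dlt v : minn (r v) k.-1 < k by rewrite (leq_ltn_trans (geq_minr _ _)).
pose d v : 'I_#|H| := Ordinal (dlt v).
have dS i : exists v, d v = i.
  have iI : i < size (enum I) by rewrite -cardE (leq_trans (ltn_ord i)).
  have /imsetP[v _ ve] : nth (c (enum_val (Ordinal (leq_trans k0 arr_le)))) (enum I) i \in I.
    by rewrite -mem_enum mem_nth.
  exists v; apply: val_inj; rewrite /= /r -ve index_uniq ?enum_uniq //.
  by apply/minn_idPl; move: (ltn_ord i); rewrite -/k; lia.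
have [_ /(_ d dS)[K [gK dI]]] := arr.
exists K; split=> // x y xK yK cxy; apply: dI => //.
by apply: val_inj; rewrite /= /r cxy.
Qed.

(** Give [W1] one colour, [W2] another, and every other vertex a colour of its
    own. These are exactly [k] colours, so a rainbow copy of [H] uses all of them
    and contains every vertex outside [W1] and [W2]. *)
Lemma two_class W1 W2 : 1 < k -> [disjoint W1 & W2] -> W1 != set0 -> W2 != set0 ->
  #|W1| + #|W2| = n - k + 2 ->
  exists w1 w2, [/\ w1 \in W1, w2 \in W2 & good (w2 |: (w1 |: ~: (W1 :|: W2)))].
Proof.
move=> k1 dW /set0Pn[p1 p1W] /set0Pn[p2 p2W] cW.
have kn := arr_le.
have dP x : x \in W1 -> x \in W2 -> False by move=> x1 x2; move/pred0P/(_ x): dW; rewrite /= x1 x2.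
pose c v := if v \in W1 then p1 else if v \in W2 then p2 else v.
have cU : #|W1 :|: W2| = n - k + 2.
  by move: dW; rewrite -setI_eq0 => /eqP dW0; rewrite cardsU dW0 cards0 subn0 cW.
have cC : #|~: (W1 :|: W2)| = k - 2.
  by have := cardsC (W1 :|: W2); rewrite cU -/n; lia.
have p1C : p1 \notin ~: (W1 :|: W2) by rewrite !inE p1W.
have p12 : p1 != p2 by apply/eqP=> e; apply: (dP p1); rewrite // e.
have p2C : p2 \notin p1 |: ~: (W1 :|: W2) by rewrite !inE p2W orbT /= orbF eq_sym.
have cim : k <= #|[set c v | v in [set: G]]|.
  have -> : k = #|p2 |: (p1 |: ~: (W1 :|: W2))|.
    by rewrite cardsU1 p2C cardsU1 p1C cC; lia.
  apply: subset_leq_card; apply/subsetP=> x; rewrite !inE => /or3P[/eqP->|/eqP->|].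
  - apply/imsetP; exists p2; rewrite ?inE // /c p2W.
    by case: ifP => // p21; case: (dP p2).
  - by apply/imsetP; exists p1; rewrite ?inE // /c p1W.
  - case/norP=> x1 x2; apply/imsetP; exists x; rewrite ?inE //.
    by rewrite /c (negbTE x1) (negbTE x2).
have [K [gK cI]] := rainbow (ltnW k1) cim.
have cK := good_card gK.
have K1 : #|K :&: W1| <= 1.
  apply/card_le1_eqP=> x y; rewrite !inE => /andP[xK x1] /andP[yK y1].
  by apply: cI; rewrite // /c x1 y1.
have K2 : #|K :&: W2| <= 1.
  apply/card_le1_eqP=> x y; rewrite !inE => /andP[xK x2] /andP[yK y2].
  apply: cI => //; rewrite /c x2 y2.
  have /negbTE-> : x \notin W1 by apply/negP=> x1; exact: (dP x).
  have /negbTE-> : y \notin W1 by apply/negP=> y1; exact: (dP y).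
  by [].
have Ks : #|K| = #|K :&: W1| + #|K :&: W2| + #|K :\: (W1 :|: W2)|.
  rewrite -(cardsID W1 K) -addnA; congr (_ + _).
  rewrite -(cardsID W2 (K :\: W1)); congr (_ + _); apply: eq_card => x; rewrite !inE.
    by case x1: (x \in W1); case x2: (x \in W2); rewrite ?andbF ?andbT //=; case: (dP x).
  by rewrite negb_or; case: (x \in W1); case: (x \in W2).
have KC : K :\: (W1 :|: W2) \subset ~: (W1 :|: W2) by apply/subsetP=> x; rewrite !inE => /andP[].
have KC' := subset_leq_card KC; rewrite cC in KC'.
have /eqP e1 : #|K :&: W1| == 1 by move: Ks; rewrite cK -/k; lia.
have /eqP e2 : #|K :&: W2| == 1 by move: Ks; rewrite cK -/k; lia.
have eC : K :\: (W1 :|: W2) = ~: (W1 :|: W2).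
  by apply/eqP; rewrite eqEcard KC cC; move: Ks; rewrite cK -/k; lia.
move/eqP/cards1P: e1 => [w1 ew1]; move/eqP/cards1P: e2 => [w2 ew2].
have w1K : w1 \in K :&: W1 by rewrite ew1 inE.
have w2K : w2 \in K :&: W2 by rewrite ew2 inE.
exists w1, w2; split; [by move: w1K; rewrite inE => /andP[]|by move: w2K; rewrite inE => /andP[]|].
suff -> : w2 |: (w1 |: ~: (W1 :|: W2)) = K by [].
rewrite -eC; apply/setP=> x; rewrite !inE.
have m1 := congr1 (fun A : {set G} => x \in A) ew1; have m2 := congr1 (fun A : {set G} => x \in A) ew2.
rewrite /= !inE in m1 m2; rewrite -m1 -m2.
by case: (x \in K); case: (x \in W1); case: (x \in W2).
Qed.

Lemma one_class W : 1 < k -> #|W| = n - k + 1 -> exists2 w, w \in W & good (w |: ~: W).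
Proof.
move=> k1 cW; have kn := arr_le.
have /set0Pn[z] : ~: W != set0.
  by rewrite -card_gt0; have := cardsC W; rewrite cW -/n; lia.
rewrite inE => zW.
have [||||w1 [w2 [w1W]]] := @two_class W [set z] k1.
- by rewrite disjoint_sym disjoints1 (negbTE zW).
- by rewrite -card_gt0 cW; lia.
- by rewrite -card_gt0 cards1.
- by rewrite cards1 cW; lia.
rewrite inE => /eqP-> g; exists w1 => //.
suff <- : z |: (w1 |: ~: (W :|: [set z])) = w1 |: ~: W by [].
apply/setP=> x; rewrite !inE negb_or; case: (x =P z) => [->|_] /=; last by rewrite andbT.
by rewrite zW orbT.
Qed.

(** The vertices of [T] get private colours and all others share one. *)
Lemma extend (T : {set G}) : 1 < k -> #|T| = k.-1 -> exists2 z, z \notin T & good (z |: T).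
Proof.
move=> k1 cT; have kn := arr_le.
have [|w] := @one_class (~: T) k1; first by have := cardsC T; rewrite cT -/n; lia.
by rewrite inE setCK => wT g; exists w.
Qed.

(** Colour [x] and [y] alike, and the vertices outside [K] alike. *)
Lemma exchange_one K x y : 1 < k -> k < n -> good K -> x \in K -> y \in K -> x != y ->
  exists2 b, b \notin K & good (b |: K :\ x) \/ good (b |: K :\ y).
Proof.
move=> k1 kn gK xK yK xy; have cK := good_card gK.
have [||||w1 [w2 [w1W w2W g]]] := @two_class [set x; y] (~: K) k1.
- rewrite -setI_eq0; apply/eqP/setP=> z; rewrite !inE.
  by case: eqP => [->|_]; rewrite ?xK //=; case: eqP => // ->; rewrite yK.
- by apply/set0Pn; exists x; rewrite !inE eqxx.
- by rewrite -card_gt0; have := cardsC K; rewrite cK -/n -/k; lia.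
- by have := cardsC K; rewrite cards2 xy cK -/n -/k; lia.
exists w2; first by rewrite inE in w2W.
case/set2P: w1W g => -> g; [right|left].
- suff <- : w2 |: (x |: ~: ([set x; y] :|: ~: K)) = w2 |: K :\ y by [].
  apply/setP=> z; rewrite !inE; case: (z =P x) => [->|_].
    by rewrite xK xy /= !orbT.
  by case: (z == w2); case: (z == y); case: (z \in K).
suff <- : w2 |: (y |: ~: ([set x; y] :|: ~: K)) = w2 |: K :\ x by [].
apply/setP=> z; rewrite !inE; case: (z =P y) => [->|_].
  by rewrite yK (eq_sym y x) (negbTE xy) /= !orbT.
by case: (z == w2); case: (z == x); case: (z \in K).
Qed.

(** The [k - 1] vertices [K - x - y + b] extend to a good set by some [z]. It spans
    as many edges as [K], so the degree of [z] in it, which is a degree of [H], is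
    determined by the three vertices exchanged. *)
Lemma swap_dg K b x y : 1 < k -> good K -> b \notin K -> x \in K -> y \in K -> x != y ->
  exists i : H, dg [set: H] i + dg K b + adj x y = dg K x + dg K y + adj b x + adj b y.
Proof.
move=> k1 gK bK xK yK xy; have cK := good_card gK.
set S := K :\ x :\ y.
have yKx : y \in K :\ x by rewrite !inE eq_sym xy.
have bS : b \notin S by rewrite !inE (negbTE bK) !andbF.
have cS : #|b |: S| = k.-1.
  have := cardsD1 x K; have := cardsD1 y (K :\ x).
  by rewrite yKx xK cK cardsU1 bS -/S -/k; lia.
have [z zT gz] := extend k1 cS.
have [i di] := good_dg gz (setU11 z (b |: S)).
exists i; rewrite -di (dg_U1 _ zT) adjxx add0n.
have e1 := good_ee gz; rewrite -(good_ee gK) ee_U1 // ee_U1 // in e1.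
have e2 := ee_D1 xK; have e3 := ee_D1 yKx; rewrite -/S in e3.
have d1 := dg_D1 y xK; have d2 := dg_D1 b xK; have d3 := dg_D1 b yKx.
rewrite -/S in d3; rewrite (adjC y x) in d1.
by lia.
Qed.
End Good.

(** * Isomorphism, complement and the exceptional graphs *)

Lemma sg_iso_trans G1 G2 G3 : sg_iso G1 G2 -> sg_iso G2 G3 -> sg_iso G1 G3.
Proof.
case=> f bf fadj [g bg gadj]; exists (g \o f); first exact: bij_comp.
by move=> x y; rewrite /= gadj fadj.
Qed.

Lemma sg_iso_sym G1 G2 : sg_iso G1 G2 -> sg_iso G2 G1.
Proof.
case=> f [g fK gK] fadj; exists g; first by exists f.
by move=> x y; rewrite -fadj !gK.
Qed.

Lemma compl_complK G : sg_iso (compl (compl G)) G.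
Proof.
exists id; first by exists id.
move=> x y; rewrite /= /compl_rel /= negb_and !negbK.
by case: eqP => //= ->; rewrite adjxx.
Qed.

Lemma sg_iso_card G1 G2 : sg_iso G1 G2 -> #|G1| = #|G2|.
Proof. by case=> f bf _; apply: (bij_eq_card bf). Qed.

Definition exc H := exceptional H \/ exceptional (compl H).

Lemma exceptional_iso G H : sg_iso G H -> exceptional H -> exceptional G.
Proof.
move=> GH [[n Hn]|[n Hn]|HL]; [apply: Or31; exists n|apply: Or32; exists n|apply: Or33];
  exact: sg_iso_trans GH _.
Qed.

Lemma exc_compl H : exc (compl H) -> exc H.
Proof.
case=> [e|e]; first by right.
by left; apply: exceptional_iso e; apply/sg_iso_sym/compl_complK.
Qed.

Lemma complete_exc (H : sgraph) : (forall x y : H, x != y -> adj x y) -> exc H.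
Proof.
move=> cH; left; apply: Or31; exists #|H|; exists enum_rank.
  exact: enum_rank_bij.
move=> x y; rewrite /= /complete_rel (inj_eq enum_rank_inj).
by case: eqP => [->|/eqP/cH//]; rewrite adjxx.
Qed.

Lemma edgeless_exc (H : sgraph) : (forall x y : H, adj x y = false) -> exc H.
Proof.
move=> eH; apply: exc_compl; apply: complete_exc => x y xy.
by rewrite /= /compl_rel xy eH.
Qed.

Lemma star_exc (H : sgraph) (p : H) :
  (forall x, x != p -> adj p x) ->
  (forall x y, x != p -> y != p -> adj x y = false) -> exc H.
Proof.
move=> pa xa; left; apply: Or32.
pose S := {x : H | x != p}; exists #|{: S}|.
pose g (x : H) : option 'I_#|{: S}| := omap enum_rank (insub x : option S).
have gp : g p = None by rewrite /g insubF ?eqxx.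
have gx x (xp : x != p) : g x = Some (enum_rank (Sub x xp : S)) by rewrite /g insubT.
have gI : injective g.
  move=> x y; case: (x =P p) => [->|/eqP xp]; case: (y =P p) => [->|/eqP yp] //.
  - by rewrite gp gx.
  - by rewrite gp gx.
  - by rewrite !gx => -[/enum_rank_inj /(congr1 val)].
exists g.
  apply: inj_card_bij => //.
  rewrite card_option card_ord card_sig [X in _ <= X](cardD1 p) inE add1n ltnS.
  by apply: eq_leq; apply: eq_card => x; rewrite !inE andbT.
move=> x y; rewrite /= /star_rel.
case: (x =P p) => [->|/eqP xp]; case: (y =P p) => [->|/eqP yp].
- by rewrite gp adjxx.
- by rewrite gp gx pa.
- by rewrite gp gx adjC pa.
- by rewrite !gx xa.
Qed.

(** The four values of the two booleans give the complete graph, the star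
    and their complements. *)
Lemma homog_exc (H : sgraph) (p : H) (al ga : bool) :
  (forall x, x != p -> adj p x = ga) ->
  (forall x y, x != p -> y != p -> x != y -> adj x y = al) -> exc H.
Proof.
move=> pa xa.
have star (Q : sgraph) (q : Q) : (forall x, x != q -> adj q x) ->
    (forall x y, x != q -> y != q -> x != y -> adj x y = false) -> exc Q.
  move=> qa xq; apply: (@star_exc _ q) => // x y xp yp.
  by case: (x =P y) => [->|/eqP xy]; [rewrite adjxx|rewrite xq].
case: al xa => xa; case: ga pa => pa.
- apply: complete_exc => x y xy; case: (x =P p) => [e|/eqP xp].
    by rewrite e pa // eq_sym -e.
  by case: (y =P p) => [e|/eqP yp]; [rewrite e adjC pa// -e|rewrite xa].
- apply: exc_compl; apply: (star (compl H) p) => [x xp|x y xp yp xy].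
    by rewrite /= /compl_rel eq_sym xp pa.
  by rewrite /= /compl_rel xa // andbF.
- exact: (star H p).
- apply: edgeless_exc => x y; case: (x =P y) => [->|/eqP xy]; first exact: adjxx.
  case: (x =P p) => [e|/eqP xp]; first by rewrite e pa // eq_sym -e.
  by case: (y =P p) => [e|/eqP yp]; [rewrite e adjC pa// -e|rewrite xa].
Qed.

Lemma good_compl G H K : @good G H K -> @good (compl G) (compl H) K.
Proof.
case/goodP=> g [gI -> ga]; apply/goodP; exists g; split=> // i j.
by rewrite /= /compl_rel ga (inj_eq gI).
Qed.

Lemma compl_good G H K : @good (compl G) (compl H) K -> @good G H K.
Proof.
case/goodP=> g [gI -> ga]; apply/goodP; exists g; split=> // i j.
case: (i =P j) => [->|/eqP ij]; first by rewrite !adjxx.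
by have := ga i j; rewrite /= /compl_rel (inj_eq gI) ij /= => /negb_inj.
Qed.

Lemma arrows_compl G H : arrows G H -> arrows (compl G) (compl H).
Proof.
case=> kn arr; split=> // c cS; have [S [gS cI]] := arr c cS.
by exists S; split=> //; apply: good_compl.
Qed.

Lemma dg_co (G : sgraph) (A : {set G}) x :
  dg (G := compl G) A x + dg A x + (x \in A) = #|A|.
Proof.
rewrite -(dg_D1x (G := compl G)) -(dg_D1x (G := G)).
have -> : #|A| = \sum_(y in A :\ x) 1 + (x \in A) by rewrite (cardsD1 x A) sum1_card addnC.
congr (_ + _); rewrite /dg -big_split /=; apply: eq_bigr => y.
by rewrite !inE /compl_rel => /andP[yx _]; rewrite eq_sym yx; case: adj.
Qed.

Lemma card_compl (G : sgraph) (K : {set G}) : #|K| + #|~: K| = #|G|.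
Proof. exact: cardsC. Qed.

Lemma card_outside (G H : sgraph) (K : {set G}) : good H K -> #|~: K| = #|G| - #|H|.
Proof. by move=> gK; have := card_compl K; rewrite (good_card gK); slia. Qed.

Ltac cosimp := repeat match goal with
  | |- context [vertex (compl ?G)] => change (vertex (compl G)) with (vertex G)
  | H : context [vertex (compl ?G)] |- _ => change (vertex (compl G)) with (vertex G) in H
  end.

Lemma codeg (G : sgraph) (v : G) : dg (G := compl G) [set: G] v + dg [set: G] v + 1 = #|G|.
Proof. by have := dg_co (G := G) setT v; rewrite inE cardsT. Qed.

Lemma ee_co (G : sgraph) (A : {set G}) :
  ee (G := compl G) A + ee A + #|A| = #|A| * #|A|.
Proof.
rewrite -[in RHS]sum_nat_const /ee -[X in _ + X = _]sum1_card -!big_split /=; apply: eq_bigr => x xA.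
by rewrite -(dg_co A x) xA.
Qed.

(** * Colourings that forbid pairs *)

Lemma superset (G : finType) (A : {set G}) m : #|A| <= m -> m <= #|G| -> exists2 B : {set G}, A \subset B & #|B| = m.
Proof.
move=> Am mn; elim: m Am mn => [|m IH] Am mn.
  by exists A => //; apply/eqP; rewrite -leqn0.
move: Am; rewrite leq_eqVlt => /predU1P[<-|Am]; first by exists A.
have [B AB cB] := IH Am (ltnW mn).
have /set0Pn[z] : ~: B != set0 by rewrite -card_gt0; have := cardsC B; rewrite cB; lia.
rewrite inE => zB; exists (z |: B); first by rewrite (subset_trans AB) // subsetUr.
by rewrite cardsU1 zB cB; lia.
Qed.

Lemma subset_of (G : finType) (A : {set G}) m : m <= #|A| -> exists2 B : {set G}, B \subset A & #|B| = m.
Proof.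
elim: m => [|m IH] Am; first by exists set0; rewrite ?sub0set ?cards0.
have [B BA cB] := IH (ltnW Am).
have /set0Pn[z] : A :\: B != set0.
  rewrite -card_gt0; have := cardsID B A; have := subset_leq_card (subsetIr A B); lia.
rewrite inE => /andP[zB zA]; exists (z |: B); last by rewrite cardsU1 zB cB; lia.
by rewrite subUset sub1set zA.
Qed.

Section Tools.
Variables (G H : sgraph).
Hypothesis arr : arrows G H.
Let k := #|H|.
Let n := #|G|.
Implicit Types (A B K W T : {set G}) (x y z b v : G).

(** Identifying the colours of two vertices loses at most one colour. *)
Lemma merge_pairs (ps : seq (G * G)) : exists c : G -> G,
  n <= #|[set c v | v in [set: G]]| + size ps /\ {in ps, forall p, c p.1 = c p.2}.
Proof.
elim: ps => [|[x y] ps [c [cn cp]]].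
  exists id; split=> //; rewrite addn0.
  have -> : [set id v | v in [set: G]] = [set: G] by apply/setP=> v; rewrite inE; apply/imsetP; exists v.
  by rewrite cardsT.
exists (fun v => if c v == c x then c y else c v); split; last first.
  move=> p; rewrite inE => /predU1P[-> /=|/cp e]; last by rewrite e.
  by rewrite eqxx; case: eqP.
set I := (X in n <= #|X| + _); set J := [set c v | v in [set: G]] in cn.
have JI : J :\ c x \subset I.
  apply/subsetP=> u; rewrite !inE => /andP[ux /imsetP[v _ uv]].
  by apply/imsetP; exists v => //; rewrite -uv (negbTE ux).
have := subset_leq_card JI; have := cardsD1 (c x) J; move: cn => /=.
by case: (c x \in J); rewrite /=; lia.
Qed.

(** After [n - k] identifications of colours at least [k] colours are left. *)
Lemma avoid_pairs (ps : seq (G * G)) : 0 < k -> size ps <= n - k ->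
  exists2 K, good H K &
    {in ps, forall p, p.1 != p.2 -> p.1 \in K -> p.2 \in K -> False}.
Proof.
move=> k0 sp; have [c [cn cp]] := merge_pairs ps.
have [|K [gK cI]] := rainbow (c := c) arr k0; first by have := arr_le arr; rewrite -/k -/n; lia.
by exists K => // p /cp e /eqP ne x1 x2; apply: ne; apply: cI.
Qed.

(** When [W] is the only nontrivial colour class, a rainbow copy contains one
    vertex of it and every vertex outside. *)
Lemma good_in W : 1 < k -> #|W| = n - k + 1 ->
  exists2 w, w \in W & good H (~: (W :\ w)).
Proof.
move=> k1 cW; have [w wW g] := one_class arr k1 cW; exists w => //.
suff -> : ~: (W :\ w) = w |: ~: W by [].
by apply/setP=> x; rewrite !inE negb_and negbK.
Qed.

Lemma extend_sub A : 1 < k -> #|A| < k -> exists2 K : {set G}, A \subset K & good H K.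
Proof.
move=> k1 Ak; have [||B AB cB] := @superset _ A k.-1; [lia| by have := arr_le arr; rewrite -/n -/k; lia|].
have [z zB g] := extend arr k1 cB.
by exists (z |: B) => //; rewrite (subset_trans AB) // subsetUr.
Qed.
End Tools.

(** * Graphs without two disjoint edges, and vertices in every copy *)

Lemma good_edgeless (G H : sgraph) (K : {set G}) : good H K ->
  {in K &, forall x y, adj x y = false} -> exc H.
Proof.
case/goodP=> g [gI -> ga] e; apply: edgeless_exc => i j.
by rewrite -ga e // imset_f ?inE.
Qed.

Lemma good_star (G H : sgraph) (K : {set G}) p : good H K -> p \in K ->
  {in K, forall x, x != p -> adj p x} ->
  {in K &, forall x y, x != p -> y != p -> adj x y = false} -> exc H.
Proof.
case/goodP=> g [gI -> ga] /imsetP[i _ ->] e1 e2.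
apply: (@star_exc _ i) => [j ji|j l ji li]; rewrite -ga.
  by rewrite e1 ?imset_f ?inE ?inj_eq.
by rewrite e2 ?imset_f ?inE ?inj_eq.
Qed.

Lemma good_homog (G H : sgraph) (K : {set G}) p al ga : good H K -> p \in K ->
  {in K, forall x, x != p -> adj p x = ga} ->
  {in K &, forall x y, x != p -> y != p -> x != y -> adj x y = al} -> exc H.
Proof.
case/goodP=> g [gI -> gadj] /imsetP[i _ ->] e1 e2.
apply: (@homog_exc _ i al ga) => [j ji|j l ji li jl]; rewrite -gadj.
  by rewrite e1 ?imset_f ?inE ?inj_eq.
by rewrite e2 ?imset_f ?inE ?inj_eq.
Qed.

Definition nb (G : sgraph) (v : G) : {set G} := [set y | adj v y].
Definition mb (G : sgraph) (v : G) : {set G} := [set y | (y != v) && ~~ adj v y].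

Lemma dgT (G : sgraph) (v : G) : dg setT v = #|nb v|.
Proof. by rewrite dgE; apply: eq_card => y; rewrite !inE. Qed.

Lemma card_mb (G : sgraph) (v : G) : #|mb v| + dg setT v + 1 = #|G|.
Proof.
rewrite dgT -(cardsC (v |: nb v)) cardsU1 !inE adjxx /=.
rewrite (_ : ~: (v |: nb v) = mb v); first by slia.
by apply/setP=> y; rewrite !inE negb_or.
Qed.

Lemma dg_all (G : sgraph) (A : {set G}) v : A \subset nb v -> dg A v = #|A|.
Proof.
move=> AN; rewrite dgE; apply: eq_card => y; rewrite !inE.
by case yA: (y \in A) => //=; have := subsetP AN y yA; rewrite inE.
Qed.

Lemma dg_none (G : sgraph) (A : {set G}) v : A \subset mb v -> dg A v = 0.
Proof.
move=> AN; rewrite dgE; apply: eq_card0 => y; rewrite !inE.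
by case yA: (y \in A) => //=; have := subsetP AN y yA; rewrite inE => /andP[_ /negbTE].
Qed.

Section Tools2.
Variables (G H : sgraph).
Hypothesis arr : arrows G H.
Let k := #|H|.
Let n := #|G|.
Implicit Types (A B K W T U S : {set G}) (x y z a b c p u v : G).

Lemma avoid_set W : 1 < k -> #|W| <= n - k + 1 ->
  exists2 K, good H K & forall x y, x \in K -> y \in K -> x \in W -> y \in W -> x = y.
Proof.
move=> k1 cW; have kn := arr_le arr; rewrite -/k -/n in kn.
have [|X WX cX] := superset cW; first by rewrite -/n; slia.
have [w wX gK] := good_in arr k1 cX; exists (~: (X :\ w)) => // x y.
rewrite !inE => /nandP[/negPn/eqP->|/negP xX]; last by move=> _ /(subsetP WX).
by case/nandP=> [/negPn/eqP->|/negP yX] // _ /(subsetP WX).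
Qed.

(** The edges of [G] form a triangle or a star. A good set meeting the
    triangle at most once is independent. For a star with centre [c]: if [c] has
    at most [n - k] neighbours, a good set meeting its closed neighbourhood at most
    once is independent; if [c] has at most [n - k] non-neighbours, a good set that
    cannot contain [c] together with one of them is a star or independent.
    Otherwise one good set leaves out [n - k] neighbours of [c] and another one
    [n - k] non-neighbours, and they span different numbers of edges. *)
Lemma nomatching_exc : 1 < k -> k + 2 <= n ->
  (forall a b c d : G, adj a b -> adj c d -> [|| a == c, a == d, b == c | b == d]) ->
  exc H.
Proof.
move=> k1 kn noM.
case: (pickP (fun p : G * G => adj p.1 p.2)) => [[c l] /= cl|no]; last first.
  have [K _ gK] := @extend_sub _ _ arr set0 k1 ltac:(by rewrite cards0; slia).
  by apply: (good_edgeless gK) => x y _ _; exact: (no (x, y)).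
case: (pickP (fun p : G * G * G => [&& adj p.1.1 p.1.2, adj p.1.2 p.2 & adj p.1.1 p.2]))
    => [[[x y] z] /= /and3P[xy yz xz]|noT].
  have [|K gK Kx] := avoid_set (W := [set x; y; z]) k1.
    by rewrite (leq_trans (leq_card_setU _ _)) // cards2 cards1; slia.
  apply: (good_edgeless gK) => a b aK bK; apply/negP=> ab.
  have : a = b; last by move=> e; rewrite e adjxx in ab.
  have m1 := noM _ _ _ _ ab xy; have m2 := noM _ _ _ _ ab yz; have m3 := noM _ _ _ _ ab xz.
  have xNy : x != y by apply: contraTneq xy => ->; rewrite adjxx.
  have yNz : y != z by apply: contraTneq yz => ->; rewrite adjxx.
  have xNz : x != z by apply: contraTneq xz => ->; rewrite adjxx.
  have aNb : a != b by apply: contraTneq ab => ->; rewrite adjxx.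
  apply: Kx => //; rewrite !inE; apply: contraNT aNb.
    rewrite !negb_or => /andP[/andP[/negbTE ax /negbTE ay] /negbTE az].
    move: m1 m2 m3; rewrite ax ay az /= => /orP[] /eqP->.
      by rewrite (negbTE xNy) (negbTE xNz).
    by rewrite (eq_sym y x) (negbTE xNy) (negbTE yNz).
  rewrite !negb_or => /andP[/andP[/negbTE bx /negbTE by_] /negbTE bz].
  move: m1 m2 m3; rewrite bx by_ bz /= !orbF => /orP[] /eqP->.
    by rewrite (negbTE xNy) (negbTE xNz).
  by rewrite (eq_sym y x) (negbTE xNy) (negbTE yNz).
have noT' x y z : adj x y -> adj y z -> adj x z -> False.
  by move=> xy yz xz; have := noT (x, y, z); rewrite /= xy yz xz.
wlog cc : c l cl / forall a b, adj a b -> (a == c) || (b == c).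
  move=> wl; case: (pickP (fun p : G * G => [&& adj p.1 p.2, p.1 != c & p.2 != c])) => [[a b]|no].
    move=> /= /and3P[ab /negbTE ac /negbTE bc].
    case: (pickP (fun p : G * G => [&& adj p.1 p.2, p.1 != l & p.2 != l])) => [[a' b']|no].
      move=> /= /and3P[ab' /negbTE al /negbTE bl].
      have [b0 lb0 b0c] : exists2 b0, adj l b0 & b0 != c.
        have := noM _ _ _ _ ab cl; rewrite ac bc /= => /orP[] /eqP e.
          by exists b; rewrite -?e ?bc.
        by exists a; rewrite ?ac // -e adjC.
      have [b1 cb1 b1l] : exists2 b1, adj c b1 & b1 != l.
        have := noM _ _ _ _ ab' cl; rewrite al bl /= orbF => /orP[] /eqP e.
          by exists b'; rewrite -?e ?bl.
        by exists a'; rewrite ?al // -e adjC.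
      have cl' : (l == c) = false by apply: contraTF cl => /eqP->; rewrite adjxx.
      have := noM _ _ _ _ lb0 cb1; rewrite cl' (eq_sym l) (negbTE b1l) (negbTE b0c) /= => /eqP e.
      by exfalso; apply: (noT' c l b0) => //; rewrite e.
    apply: (wl l c); first by rewrite adjC.
    move=> x y xy; have := no (x, y); rewrite /= xy /=.
    by case: (x == l); case: (y == l).
  apply: (wl c l) => // x y xy; have := no (x, y); rewrite /= xy /=.
  by case: (x == c); case: (y == c).
have ccN a b : a != c -> b != c -> adj a b = false.
  by move=> ac bc; apply/negP=> /cc; rewrite (negbTE ac) (negbTE bc).
have cN : c \notin nb c by rewrite inE adjxx.
have cM : c \notin mb c by rewrite inE eqxx.
have [sN|sN] := leqP #|nb c| (n - k).
  have [|K gK Kx] := avoid_set (W := c |: nb c) k1; first by rewrite cardsU1 cN; slia.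
  apply: (good_edgeless gK) => x y xK yK; apply/negP=> xy.
  have : x = y; last by move=> e; rewrite e adjxx in xy.
  by apply: Kx => //; rewrite !inE; have := cc _ _ xy; move: xy => /[swap] /orP[] /eqP->; rewrite ?eqxx //; rewrite ?(adjC _ c) => ->; rewrite orbT.
have [sM|sM] := leqP #|mb c| (n - k).
  have [|K gK Kx] := avoid_set (W := c |: mb c) k1; first by rewrite cardsU1 cM; slia.
  case: (boolP (c \in K)) => cK; last first.
    apply: (good_edgeless gK) => x y xK yK; apply: ccN; apply: contraNneq cK => <- //.
  apply: (good_star gK cK) => [x xK xc|x y xK yK xc yc]; last exact: ccN.
  apply: contraT => ncx; have := Kx x c xK cK; rewrite !inE xc eqxx ncx (negbTE xc) /=.
  by move/(_ isT isT)/eqP; rewrite (negbTE xc).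
have [W1 W1N cW1] := subset_of sN; have [W2 W2M cW2] := subset_of sM.
have [w1 w1W g1] := good_in arr k1 (W := W1) ltac:(by rewrite cW1 -/k -/n; slia).
have [w2 w2W g2] := good_in arr k1 (W := W2) ltac:(by rewrite cW2 -/k -/n; slia).
have eeK K : good H K -> c \in K -> ee K = 2 * dg K c.
  move=> _ cK; rewrite (ee_D1 cK) /ee big1 // => x; rewrite !inE => /andP[xc xK].
  by rewrite /dg big1 // => y; rewrite !inE => /andP[yc yK]; rewrite ccN.
have c1 : c \in ~: (W1 :\ w1) by rewrite !inE negb_and (contra (subsetP W1N c)) ?orbT.
have c2 : c \in ~: (W2 :\ w2) by rewrite !inE negb_and (contra (subsetP W2M c)) ?orbT.
have := eeK _ g1 c1; have := eeK _ g2 c2; rewrite (good_ee g1) (good_ee g2).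
have := dg_compl (W1 :\ w1) c; have := dg_compl (W2 :\ w2) c.
rewrite (@dg_all _ (W1 :\ w1)) ?(@dg_none _ (W2 :\ w2)); last 2 first.
- by rewrite (subset_trans (subD1set _ _)).
- by rewrite (subset_trans (subD1set _ _)).
by have := cardsD1 w1 W1; rewrite w1W cW1; slia.
Qed.

(** One colour class consists of [d(v) - j + 1] neighbours of [v], the other one
    of non-neighbours; the copy contains [v] and loses all but one of the first. *)
Lemma prescribe_dg v j : 1 < k -> 0 < j -> dg setT v <= j + (n - k) ->
  j <= dg setT v -> j <= k - 2 -> exists2 K, good H K & v \in K /\ dg K v = j.
Proof.
move=> k1 j0 j1 j2 j3; have kn := arr_le arr; rewrite -/k -/n in kn.
have cM := card_mb v; rewrite -/n in cM.
have [|W1 W1N cW1] := @subset_of _ (nb v) (dg setT v - j).+1; first by rewrite -dgT; slia.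
have [|W2 W2M cW2] := @subset_of _ (mb v) (n - k + 1 - (dg setT v - j)); first by slia.
have vN : v \notin nb v by rewrite inE adjxx.
have vM : v \notin mb v by rewrite inE eqxx.
have v1 : v \notin W1 by apply: contra vN; apply: (subsetP W1N).
have v2 : v \notin W2 by apply: contra vM; apply: (subsetP W2M).
have dW : [disjoint W1 & W2].
  rewrite -setI_eq0; apply/eqP/setP=> y; rewrite !inE; apply/negP=> /andP[/(subsetP W1N)].
  by rewrite inE => vy /(subsetP W2M); rewrite inE vy andbF.
have [|||w1 [w2 [w1W w2W g]]] := two_class arr k1 dW; rewrite -?card_gt0 ?cW1 ?cW2 -/k -/n; try slia.
exists (w2 |: (w1 |: ~: (W1 :|: W2))) => //; split; first by rewrite !inE (negbTE v1) (negbTE v2) !orbT.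
have w2N : w2 \notin w1 |: ~: (W1 :|: W2).
  rewrite !inE w2W orbT /= orbF; apply/eqP=> e.
  by move: dW => /pred0P/(_ w1); rewrite /= w1W -e w2W.
have w1N : w1 \notin ~: (W1 :|: W2) by rewrite !inE w1W.
rewrite (dg_U1 _ w2N) (dg_U1 _ w1N).
have -> : adj v w1 by have := subsetP W1N w1 w1W; rewrite inE.
have -> : adj v w2 = false by have := subsetP W2M w2 w2W; rewrite inE => /andP[_ /negbTE].
by have := dg_compl (W1 :|: W2) v; rewrite dg_U // (dg_all W1N) (dg_none W2M) cW1; slia.
Qed.

(** Colouring [p] like the vertices left out shows that every [k]-set
    containing [p] is good. Comparing two such sets that differ in one vertex,
    and then varying the rest of the set, shows that all other vertices look
    alike from [p] and from each other ([E1], [E2], [E3] below). *)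
Lemma always_exc p : 3 < k -> k + 2 <= n -> (forall K, good H K -> p \in K) -> exc H.
Proof.
move=> k3 kn allp.
have gC U : p \notin U -> #|U| = n - k -> good H (~: U).
  move=> pU cU; have [|w wW g] := one_class arr (W := p |: U) (ltnW (ltnW k3)).
    by rewrite cardsU1 pU cU -/k -/n; slia.
  have := allp _ g; rewrite !inE eqxx /= orbF => /eqP e.
  suff <- : w |: ~: (p |: U) = ~: U by [].
  by rewrite -e; apply/setP=> x; rewrite !inE; case: (x =P p) => [->|].
have dgS S a b : p \notin S -> a \notin p |: S -> b \notin p |: S -> #|S| = k - 2 ->
    adj a p + dg S a = adj b p + dg S b.
  move=> pS aS bS cS.
  have g c : c \notin p |: S -> good H (c |: (p |: S)).
    move=> cpS; rewrite -[c |: _]setCK; apply: gC; first by rewrite !inE eqxx orbT.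
    have := cardsC (c |: (p |: S)); rewrite cardsU1 cpS cardsU1 pS cS -/n; slia.
  have := good_ee (g a aS); rewrite -(good_ee (g b bS)) !ee_U1 // !dg_U1 //; slia.
have Sex (A : {set G}) m : #|A| + m <= n -> exists2 S : {set G}, [disjoint A & S] & #|S| = m.
  move=> Am; have [|S SA cS] := @subset_of _ (~: A) m; first by have := cardsC A; rewrite -/n; slia.
  by exists S => //; rewrite disjoint_sym disjoints_subset.
have E1 a b u v : uniq [:: p; a; b; u; v] -> adj a u + adj b v = adj b u + adj a v.
  move=> /= un.
  have [|S0 dS cS] := Sex [set p; a; b; u; v] (k - 3).
    have : #|[set p; a; b; u; v]| <= 5; last by slia.
    by rewrite !cardsU !cards1; slia.
  have nS x : x \in [set p; a; b; u; v] -> x \notin S0.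
    by move=> x1; apply/negP=> x2; move/pred0P/(_ x): dS; rewrite /= x1 x2.
  have [pS aS bS uS vS] : [/\ p \notin S0, a \notin S0, b \notin S0, u \notin S0 & v \notin S0].
    by split; apply: nS; rewrite !inE eqxx ?orbT.
  move: un; rewrite !inE !negb_or !andbT => /and4P[/and4P[pa pb pu pv] /and3P[ab au av] /andP[bu bv] uv].
  have c1 x : x \notin S0 -> #|x |: S0| = k - 2 by move=> xS; rewrite cardsU1 xS cS; slia.
  have := dgS (u |: S0) a b; have := dgS (v |: S0) a b.
  rewrite !inE !negb_or pu pv pS aS bS au av bu bv (eq_sym a p) (eq_sym b p) pa pb !c1 // !dg_U1 //.
  by move=> /(_ isT isT isT erefl) h1 /(_ isT isT isT erefl) h2; slia.
have E2 a b u : uniq [:: p; a; b; u] -> adj a u = adj b u.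
  rewrite /= !inE !negb_or !andbT => /and3P[/and3P[pa pb pu] /andP[ab au] bu].
  have [|S dS cS] := Sex [set p; a; b] (k - 2).
    have : #|[set p; a; b]| <= 3; last by slia.
    by rewrite !cardsU !cards1; slia.
  have nS x : x \in [set p; a; b] -> x \notin S.
    by move=> x1; apply/negP=> x2; move/pred0P/(_ x): dS; rewrite /= x1 x2.
  have [pS aS bS] : [/\ p \notin S, a \notin S & b \notin S].
    by split; apply: nS; rewrite !inE eqxx ?orbT.
  have := dgS S a b; rewrite !inE !negb_or aS bS (eq_sym a p) (eq_sym b p) pa pb.
  move=> /(_ pS isT isT cS) h.
  have hv v : v \in S -> adj a v + adj b u = adj b v + adj a u.
    move=> vS; case: (v =P u) => [->|/eqP vu]; first by slia.
    have [pv av bv] : [/\ p != v, a != v & b != v].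
      by split; apply: contraTneq vS => <-.
    have := E1 a b v u; rewrite /= !inE !negb_or pa pb pu pv ab au av bu bv vu => /(_ isT); slia.
  have hs : dg S a + (k - 2) * adj b u = dg S b + (k - 2) * adj a u.
    by rewrite /dg -cS -!sum_nat_const -!big_split /=; apply: eq_bigr => v /hv.
  by move: h hs; case: (adj a u); case: (adj b u); case: (adj a p); case: (adj b p); slia.
have E3 a b : p != a -> p != b -> adj a p = adj b p.
  move=> pa pb; have [|S dS cS] := Sex [set p; a; b] (k - 2).
    have : #|[set p; a; b]| <= 3; last by slia.
    by rewrite !cardsU !cards1; slia.
  have nS x : x \in [set p; a; b] -> x \notin S.
    by move=> x1; apply/negP=> x2; move/pred0P/(_ x): dS; rewrite /= x1 x2.
  have [pS aS bS] : [/\ p \notin S, a \notin S & b \notin S].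
    by split; apply: nS; rewrite !inE eqxx ?orbT.
  have := dgS S a b; rewrite !inE !negb_or aS bS (eq_sym a p) (eq_sym b p) pa pb.
  move=> /(_ pS isT isT cS); have -> : dg S a = dg S b; last by case: (adj a p); case: (adj b p); slia.
  case: (a =P b) => [->//|/eqP ab]; apply: eq_bigr => v vS.
  by rewrite (E2 a b) //= !inE !negb_or pa pb ab !andbT /=; apply/and3P; split; apply: contraTneq vS => <-.
have [K _ gK] := @extend_sub _ _ arr set0 (ltnW (ltnW k3)) ltac:(by rewrite cards0; slia).
have pK := allp _ gK; have cK := good_card gK.
have /card_gt1P[a0 [b0 [a0K b0K ab0]]] : 1 < #|K :\ p|.
  by have := cardsD1 p K; rewrite pK cK -/k; slia.
move: a0K b0K; rewrite !inE => /andP[a0p a0K] /andP[b0p b0K].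
apply: (good_homog gK pK (al := adj a0 b0) (ga := adj a0 p)) => [x xK xp|x y xK yK xp yp xy].
  by rewrite adjC; apply: E3; rewrite eq_sym.
have E2' a b u : p != a -> p != b -> p != u -> a != u -> b != u -> adj a u = adj b u.
  move=> pa pb pu au bu; case: (a =P b) => [->//|/eqP ab].
  by apply: E2; rewrite /= !inE !negb_or pa pb pu ab au bu.
rewrite (eq_sym _ p) in xp; rewrite (eq_sym _ p) in yp.
rewrite (eq_sym _ p) in a0p; rewrite (eq_sym _ p) in b0p.
case: (y =P a0) xy => [->|/eqP ya] xy; first by rewrite (adjC a0) (E2' x b0) // eq_sym.
rewrite (E2' x a0) // 1?eq_sym //; case: (y =P b0) => [->//|/eqP yb].
by rewrite adjC (E2' y b0) // 1?eq_sym // adjC.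
Qed.

Lemma movable p : 3 < k -> k + 2 <= n -> ~ exc H -> exists2 K, good H K & p \notin K.
Proof.
move=> k3 kn nexc; apply: boolp.contrapT => no; apply: nexc.
by apply: (always_exc (p := p)) => // K gK; apply/negPn/negP=> pK; apply: no; exists K.
Qed.
End Tools2.

(** * Degrees of H near both extremes *)

Lemma good_fun (G H : sgraph) (K : {set G}) : good H K -> exists g : H -> G,
  [/\ injective g, K = [set g i | i in [set: H]],
      forall i j, adj (g i) (g j) = adj i j & forall i, dg K (g i) = dg setT i].
Proof.
case/goodP=> g [gI Ke ga]; exists g; split=> // i.
rewrite Ke /dg big_imset /=; last by move=> ? ? _ _; apply: gI.
by apply: eq_bigr=> j _; rewrite ga.
Qed.

Lemma max_dg (H : sgraph) : 0 < #|H| -> exists i : H, forall j : H, dg setT j <= dg setT i.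
Proof.
case/card_gt0P=> i0 _; case: (@arg_maxnP _ i0 predT (fun i => dg setT i) isT) => i _ im.
by exists i => j; apply: im.
Qed.

Lemma min_dg (H : sgraph) : 0 < #|H| -> exists i : H, forall j : H, dg setT i <= dg setT j.
Proof.
case/card_gt0P=> i0 _; case: (@arg_minnP _ i0 predT (fun i => dg setT i) isT) => i _ im.
by exists i => j; apply: im.
Qed.

Lemma replace_dg (G H : sgraph) (K : {set G}) b x : good H K -> b \notin K -> x \in K ->
  good H (b |: K :\ x) -> dg K x + adj b x = dg K b.
Proof.
move=> gK bK xK gb.
have := good_ee gb; rewrite -(good_ee gK) ee_U1; last by rewrite !inE (negbTE bK) andbF.
have := ee_D1 xK; have := dg_D1 b xK; slia.
Qed.

Lemma dgT_ge (G : sgraph) (A : {set G}) v : dg A v <= dg setT v.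
Proof. by apply: dg_sub; apply: subsetT. Qed.

(** The degree sum over [U] counts the edges inside [U] twice. *)
Lemma ee_split (G : sgraph) (U : {set G}) :
  ee [set: G] + ee U = ee (~: U) + 2 * \sum_(u in U) dg setT u.
Proof.
have e1 : ee [set: G] = \sum_(u in U) dg setT u + \sum_(u in ~: U) dg setT u.
  by rewrite /ee (big_setID U) /= setTI setTD.
have e2 (A : {set G}) : \sum_(u in A) dg setT u = ee A + \sum_(u in A) dg (~: A) u.
  by rewrite /ee -big_split /=; apply: eq_bigr => u _; rewrite dg_compl.
have e3 : \sum_(u in U) dg (~: U) u = \sum_(u in ~: U) dg U u.
  by rewrite /dg exchange_big /=; apply: eq_bigr => u _; apply: eq_bigr => v _; rewrite adjC.
have := e2 (~: U); rewrite setCK; have := e2 U; slia.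
Qed.

Section Dominating.
Variables (G H : sgraph).
Hypothesis arr : arrows G H.
Hypothesis nexc : ~ exc H.
Let k := #|H|.
Let n := #|G|.
Hypothesis k7 : 6 < k.
Hypothesis kn : k + 2 <= n.

(** A vertex [v] that has degree at least [k - 2] in some good set is adjacent to
    all but at most one of the other vertices of [G]: otherwise some good set gives
    it degree [k - 3], which is too large beside the vertex of degree at least
    [k - 2] of that set. As no vertex lies in every good set, there are two such
    vertices, and a good set containing both has two vertices of large degree. *)
Lemma no_lone_hub : (exists i : H, k - 2 <= dg setT i) ->
  (forall i j : H, i != j -> k - 2 <= dg setT i -> dg setT j <= 3) -> False.
Proof.
move=> [i0 hi0] hub.
have hubK (K : {set G}) : good H K -> exists2 m, m \in K & k - 2 <= dg K m.
  by case/good_fun=> g [gI -> _ gd]; exists (g i0); rewrite ?imset_f ?inE ?gd.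
have hubK' (K : {set G}) x y : good H K -> x \in K -> y \in K -> x != y -> k - 2 <= dg K x -> dg K y <= 3.
  case/good_fun=> g [gI Ke _ gd]; rewrite {1 2}Ke => /imsetP[i _ ->] /imsetP[j _ ->].
  by rewrite !gd inj_eq //; apply: hub.
have big v (K : {set G}) : good H K -> v \in K -> k - 2 <= dg K v -> n <= dg setT v + 2.
  move=> gK vK dv; have dv' := dgT_ge K v.
  rewrite leqNgt; apply/negP=> dn.
  have [||||K' gK' [vK' e]] := prescribe_dg arr (v := v) (j := k - 3) ltac:(slia); rewrite -/k -/n; try slia.
  have [m mK' dm] := hubK _ gK'.
  have mv : m != v by apply: contraTneq dm => ->; rewrite e; slia.
  by have := hubK' _ m v gK' mK' vK' mv dm; slia.
have [K _ gK] := extend_sub arr (A := set0) ltac:(slia) ltac:(rewrite cards0; slia).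
have [m mK dm] := hubK _ gK.
have [K1 gK1 mK1] := movable arr m ltac:(slia) kn nexc.
have [m1 m1K dm1] := hubK _ gK1.
have mm : m != m1 by apply: contraNneq mK1 => ->.
have [K2 sK2 gK2] := extend_sub arr (A := [set m; m1]) ltac:(slia) ltac:(rewrite cards2 mm; slia).
have [mK2 m1K2] : m \in K2 /\ m1 \in K2 by split; apply: (subsetP sK2); rewrite !inE eqxx ?orbT.
have b0 := big _ _ gK mK dm; have b1 := big _ _ gK1 m1K dm1.
have c2 := cardsC K2; have g2 := good_card gK2; rewrite -/n in c2; rewrite -/k in g2.
have dd x : n <= dg setT x + 2 -> k - 2 <= dg K2 x.
  by move=> h; have := dg_compl K2 x; have := dg_card (~: K2) x; slia.
by have := hubK' _ _ _ gK2 mK2 m1K2 mm (dd _ b0); have := dd _ b1; slia.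
Qed.
End Dominating.

(** A vertex [b] outside a good set can replace a vertex of largest or one of
    smallest degree. If it replaces the one of smallest degree, its own degree is
    small, and the exchange equation for a vertex of largest degree and any other
    vertex bounds all other degrees by 3: [no_lone_hub] applies. In the other case
    it applies to the complement. *)
Lemma no_wide_degrees G H : arrows G H -> ~ exc H -> 6 < #|H| -> #|H| + 2 <= #|G| ->
  (exists i : H, #|H| - 2 <= dg setT i) -> (exists i : H, dg setT i <= 1) -> False.
Proof.
move=> arr nexc; set k := #|H| => k7 kn [i0 hi0] [j0 hj0].
have [im Mm] := max_dg (H := H) ltac:(slia); have [iw mw] := min_dg (H := H) ltac:(slia).
have dm : k - 2 <= dg setT im := leq_trans hi0 (Mm i0).
have dw : dg setT iw <= 1 := leq_trans (mw j0) hj0.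
have [K _ gK] := extend_sub arr (A := set0) ltac:(rewrite -/k; slia) ltac:(rewrite cards0 -/k; slia).
have [g [gI Ke ga gd]] := good_fun gK.
have gin i : g i \in K by rewrite Ke imset_f ?inE.
have nmw : g im != g iw by rewrite inj_eq //; apply/eqP=> e; rewrite e in dm; slia.
have [|b bK gb] := exchange_one arr ltac:(rewrite -/k; slia) _ gK (gin im) (gin iw) nmw; first by rewrite -/k; slia.
have sw x y := swap_dg arr (ltac:(rewrite -/k; slia) : 1 < #|H|) gK bK (gin x) (gin y).
case: gb => gb; have := replace_dg gK bK (gin _) gb; rewrite gd => eb; last first.
  apply: (no_lone_hub arr nexc k7 kn); first by exists im.
  move=> i j ij di.
  have small y : y != im -> dg setT y <= 3.
    move=> yim; have [|i1 e] := sw im y; first by rewrite inj_eq // eq_sym.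
    have := Mm i1; move: e eb; rewrite !gd; case: (adj b (g iw)); case: (adj (g im) (g y)); slia.
  case: (i =P im) ij => [->|/eqP/small]; last by slia.
  by rewrite eq_sym; apply: small.
have nexc' : ~ exc (compl H) by move/exc_compl.
apply: (no_lone_hub (arrows_compl arr) nexc' k7 kn).
  by exists iw; have := codeg iw; cosimp; rewrite -/k; slia.
have big y : y != iw -> k - 4 <= dg setT y.
  move=> yiw; have [|i1 e] := sw iw y; first by rewrite inj_eq // eq_sym.
  have := mw i1; move: e eb; rewrite !gd; case: (adj b (g iw)); case: (adj b (g y)); slia.
move=> i j ij di; cosimp; rewrite -/k in di *.
have di' := codeg i; have dj' := codeg j; rewrite -/k in di' dj'.
case: (i =P iw) ij => [->|/eqP/big]; last by slia.
by rewrite eq_sym => /big; slia.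
Qed.

(** Two disjoint edges lie in a set of [n - k + 1] vertices; the complement of a
    good set contained in it lacks a single vertex, hence contains an edge. *)
Lemma independent_exc G H : arrows G H -> 1 < #|H| -> #|H| + 3 <= #|G| ->
  (forall (K : {set G}) x y, good H K -> x \notin K -> y \notin K -> adj x y = false) -> exc H.
Proof.
move=> arr k1 kn ind; apply: (nomatching_exc arr k1); first by slia.
move=> a b c d ab cd; apply: contraT; rewrite !negb_or => /and4P[ac ad bc bd].
have [||W sW cW] := @superset _ [set a; b; c; d] (#|G| - #|H| + 1); [|slia|].
  have : #|[set a; b; c; d]| <= 4; last by slia.
  by rewrite !cardsU !cards1; slia.
have [w wW gw] := good_in arr k1 cW.
have inW x : x \in [set a; b; c; d] -> x != w -> x \notin ~: (W :\ w).
  by move=> /(subsetP sW) xW xw; rewrite !inE xw xW.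
have [aw|aw] := eqVneq a w; last have [bw|bw] := eqVneq b w.
- have := ind _ c d gw (inW c _ _) (inW d _ _); rewrite cd !inE !eqxx ?orbT -aw !(eq_sym _ a) ac ad.
  by move/(_ isT isT isT isT).
- have := ind _ c d gw (inW c _ _) (inW d _ _); rewrite cd !inE !eqxx ?orbT -bw !(eq_sym _ b) bc bd.
  by move/(_ isT isT isT isT).
have := ind _ a b gw (inW a _ _) (inW b _ _); rewrite ab !inE !eqxx ?orbT aw bw.
by move/(_ isT isT isT isT).
Qed.

(** * Vertices of maximum degree *)

Definition cn (G : sgraph) (v : G) : {set G} := v |: nb v.

Lemma card_cn (G : sgraph) (v : G) : #|cn v| = (dg setT v).+1.
Proof. by rewrite /cn cardsU1 inE adjxx dgT. Qed.

Lemma dg_pos (G : sgraph) (A : {set G}) x : 0 < dg A x -> exists2 y, y \in A & adj x y.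
Proof. by rewrite dgE => /card_gt0P[y]; rewrite inE => /andP[yA xy]; exists y. Qed.

Lemma dg0 (G : sgraph) (A : {set G}) x y : dg A x = 0 -> y \in A -> adj x y = false.
Proof. by rewrite dgE => /eqP; rewrite cards_eq0 => /eqP/setP/(_ y); rewrite !inE => h yA; rewrite yA in h. Qed.

Section TopExact.
Variables (G H : sgraph).
Hypothesis arr : arrows G H.
Hypothesis nexc : ~ exc H.
Let k := #|H|.
Let n := #|G|.
Hypothesis k7 : 6 < k.
Hypothesis kn : k + 3 <= n.
Variables (D : nat) (iD : H).
Hypothesis hD : forall i : H, dg setT i <= D.
Hypothesis hiD : dg setT iD = D.
Hypothesis hDk : D + 3 <= k.
Implicit Types (A B K W T U S : {set G}) (x y z a b c p u v : G).

Let k1 : 1 < #|H|. Proof. by rewrite -/k; slia. Qed.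

Lemma dgK_le K x : good H K -> x \in K -> dg K x <= D.
Proof. by move=> gK xK; have [i ->] := good_dg gK xK. Qed.

(** A vertex with [D + 1] of its neighbours forms a set that extends to a good
    set. *)
Lemma top_exact v : dg setT v <= D.
Proof.
rewrite leqNgt; apply/negP=> dv.
have [|B BN cB] := @subset_of _ (nb v) D.+1; first by rewrite -dgT.
have vB : v \notin B by apply/negP=> /(subsetP BN); rewrite inE adjxx.
have [|K sK gK] := extend_sub arr (A := v |: B) k1; first by rewrite cardsU1 vB cB -/k; slia.
have vK : v \in K by apply: (subsetP sK); rewrite setU11.
have := dgK_le gK vK; have : dg B v <= dg K v; last by rewrite (dg_all BN) cB; slia.
by apply: dg_sub; apply: subset_trans sK; apply: subsetUr.
Qed.

Definition full := [set v : G | dg setT v == D].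

Lemma fullP v : reflect (dg setT v = D) (v \in full).
Proof. by rewrite inE; apply: eqP. Qed.

Lemma full_out K x y : dg K x = D -> y \notin K -> adj x y = false.
Proof.
move=> dx yK; apply: (dg0 (A := ~: K)); last by rewrite inE.
by have := dg_compl K x; have := top_exact x; slia.
Qed.

Lemma full_in K x : dg K x = D -> x \in full.
Proof. by move=> dx; apply/fullP; have := top_exact x; have := dgT_ge K x; slia. Qed.

Lemma cn_full K x : cn x \subset K -> x \in full -> dg K x = D.
Proof.
move=> sK /fullP <-; rewrite -(dg_compl K x) (@dg_none _ (~: K)) ?addn0 //.
apply/subsetP=> y; rewrite !inE => yK; apply/andP; split.
  by apply: contraNneq yK => ->; apply: (subsetP sK); rewrite setU11.
by apply: contra yK => xy; apply: (subsetP sK); rewrite !inE xy orbT.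
Qed.

Lemma full_vertex K : good H K -> exists2 m, m \in K & dg K m = D.
Proof. by move=> gK; have [x xK e] := good_dg' gK iD; exists x; rewrite // e. Qed.

Lemma cn_sub K x : x \in K -> dg K x = D -> cn x \subset K.
Proof.
move=> xK dx; apply/subsetP=> y; rewrite !inE => /predU1P[->//|xy].
by apply: contraTT xy => yK; rewrite (full_out dx yK).
Qed.

(** Two nonadjacent vertices of degree [D] in a copy have no neighbours outside,
    so the exchange equation forces every vertex left out to have degree [D] inside
    the copy. Then the vertices left out by any copy are independent. *)
Lemma full_clique (i j : H) : i != j -> dg setT i = D -> dg setT j = D -> adj i j.
Proof.
move=> ij di dj; apply: contraT => nij; exfalso; apply: nexc.
apply: (independent_exc arr) => // K x y gK xK yK.
have [g [gI Ke ga gd]] := good_fun gK.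
have gin l : g l \in K by rewrite Ke imset_f ?inE.
apply: (dg0 (A := ~: K)); last by rewrite inE.
have [|l e] := swap_dg arr k1 gK xK (gin i) (gin j); first by rewrite inj_eq.
move: e; rewrite !gd ga di dj (negbTE nij) (adjC x) (adjC x) !(@full_out K) ?gd //.
by have := hD l; have := top_exact x; have := dg_compl K x; slia.
Qed.

(** If the two closed neighbourhoods had fewer than [k] vertices together, a
    good set would contain both, and the two vertices would keep degree [D] in it;
    they would give two vertices of degree [D] in [H], adjacent by [full_clique]. *)
Lemma wide_pair x y : x \in full -> y \in full -> x != y ->
  ~~ adj x y \/ (forall i j : H, dg setT i = D -> dg setT j = D -> i = j) ->
  k <= #|cn x :|: cn y|.
Proof.
move=> xF yF xy h; rewrite leqNgt; apply/negP=> lt.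
have [K sK gK] := extend_sub arr k1 lt.
rewrite subUset in sK; case/andP: sK => sx sy.
have dx := cn_full sx xF; have dy := cn_full sy yF.
have xK : x \in K by apply: (subsetP sx); rewrite setU11.
have yK : y \in K by apply: (subsetP sy); rewrite setU11.
have [g [gI Ke ga gd]] := good_fun gK.
move: xK yK dx dy xy h; rewrite {1 2}Ke => /imsetP[i _ ->] /imsetP[j _ ->].
rewrite !gd ga inj_eq // => di dj ij [nij|u]; first by rewrite (full_clique ij di dj) in nij.
by rewrite (u i j di dj) eqxx in ij.
Qed.

Lemma deg_pos : 0 < D.
Proof.
rewrite lt0n; apply/eqP=> D0; apply: nexc; apply: edgeless_exc => i j.
by apply: (dg0 (A := setT)); rewrite ?inE //; have := hD i; slia.
Qed.

(** If the vertices of degree [D] formed a clique, two fixed vertices would lie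
    in the closed neighbourhoods of all of them. A good set containing at most one
    of the two then has no vertex of degree [D]. *)
Lemma full_not_clique : exists x y, [/\ x \in full, y \in full, x != y & ~~ adj x y].
Proof.
apply: boolp.contrapT => no.
have cl x y : x \in full -> y \in full -> x != y -> adj x y.
  by move=> xF yF xy; apply/negPn/negP=> nxy; apply: no; exists x, y.
have [K0 _ gK0] := extend_sub arr (A := set0) k1 ltac:(rewrite cards0 -/k; slia).
have [x0 x0K dx0] := full_vertex gK0; have x0F := full_in dx0.
have kill y : y != x0 -> (forall z, z \in full -> x0 \in cn z /\ y \in cn z) -> False.
  move=> yx h; have [|K gK Kx] := avoid_set arr (W := [set x0; y]) k1.
    by rewrite cards2 -/k -/n; case: eqP => _; slia.
  have [z zK dz] := full_vertex gK; have sz := cn_sub zK dz; have [h1 h2] := h z (full_in dz).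
  move/eqP: yx; apply; apply: Kx; try exact: (subsetP sz); by rewrite !inE eqxx ?orbT.
case: (pickP (fun y => (y \in full) && (y != x0))) => [y /andP[yF yx]|none].
  apply: (kill y) => // z zF; rewrite !inE.
  by case: (x0 =P z) => [e|/eqP xz]; case: (y =P z) => [e'|/eqP yz] /=; split; rewrite // cl // eq_sym.
have [|y _ xy] := @dg_pos _ setT x0; first by rewrite (fullP _ x0F) deg_pos.
apply: (kill y) => [|z zF]; first by apply: contraTneq xy => ->; rewrite adjxx.
have -> : z = x0 by have := none z; rewrite zF => /negbFE/eqP.
by rewrite !inE eqxx xy orbT.
Qed.

Lemma order_le : k <= 2 * D + 2.
Proof.
have [x [y [xF yF xy nxy]]] := full_not_clique.
have := wide_pair xF yF xy (or_introl nxy); have := (leq_card_setU (cn x) (cn y)).1.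
by rewrite !card_cn (fullP _ xF) (fullP _ yF); slia.
Qed.

(** Otherwise a good set could avoid, for every vertex of degree [D], the pair
    of this vertex and one of its neighbours. *)
Lemma many_full : n - k < #|full|.
Proof.
rewrite ltnNge; apply/negP=> le.
pose nbr x := odflt x [pick y | adj x y].
have nbrP x : x \in full -> adj x (nbr x).
  move=> xF; rewrite /nbr; case: pickP => //= no.
  have [|y _] := @dg_pos _ setT x; first by rewrite (fullP _ xF) deg_pos.
  by rewrite no.
have [||K gK Kx] := @avoid_pairs _ _ arr [seq (x, nbr x) | x <- enum full].
- by rewrite -/k; slia.
- by rewrite size_map -cardE.
have [m mK dm] := full_vertex gK; have mF := full_in dm; have mn := nbrP _ mF.
apply: (Kx (m, nbr m)) => //=.
- by apply: map_f; rewrite mem_enum.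
- by apply: contraTneq mn => <-; rewrite adjxx.
by apply: (subsetP (cn_sub mK dm)); rewrite !inE mn orbT.
Qed.

Lemma full_dg v j : v \in full -> 0 < j -> D <= j + (n - k) -> j <= D ->
  exists2 K, good H K & v \in K /\ dg K v = j.
Proof.
move=> /fullP dv j0 j1 j2.
by apply: (prescribe_dg arr); rewrite -/k -/n ?dv //; slia.
Qed.

Lemma has_dg j : 0 < j -> D <= j + (n - k) -> j <= D -> exists i : H, dg setT i = j.
Proof.
move=> j0 j1 j2; have [x [y [xF _ _ _]]] := full_not_clique.
have [K gK [xK <-]] := full_dg xF j0 j1 j2.
by have [i ->] := good_dg gK xK; exists i.
Qed.

(** One of a vertex of degree [D] and a vertex of least degree can be replaced by
    a vertex left out. The exchange equation with a third vertex, of degree [D - 1]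
    or [D - 3], is compatible with this only if no degree is below [D - 3]. *)
Lemma lowest : 3 < D -> exists2 w : H, dg setT w + 3 = D & forall i : H, D <= dg setT i + 3.
Proof.
move=> D4; have [w mw] := min_dg (H := H) ltac:(rewrite -/k; slia).
have [i3 d3] := @has_dg (D - 3) ltac:(slia) ltac:(slia) ltac:(slia).
have [i1 d1] := @has_dg (D - 1) ltac:(slia) ltac:(slia) ltac:(slia).
have w3 := mw i3.
suff wD : D <= dg setT w + 3 by exists w => [|i]; [slia|have := mw i; slia].
have [K _ gK] := extend_sub arr (A := set0) k1 ltac:(rewrite cards0 -/k; slia).
have [g [gI Ke ga gd]] := good_fun gK.
have gin i : g i \in K by rewrite Ke imset_f ?inE.
have nmw : g iD != g w by rewrite inj_eq //; apply/eqP=> e; move: w3; rewrite -e hiD; slia.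
have [|b bK gb] := exchange_one arr k1 _ gK (gin iD) (gin w) nmw; first by rewrite -/k -/n; slia.
have sw (i j : H) := swap_dg arr k1 gK bK (gin i) (gin j).
have bm : adj b (g iD) = false by rewrite adjC (@full_out K) ?gd.
case: gb => gb; have := replace_dg gK bK (gin _) gb; rewrite gd => eb; last first.
  have [|l e] := sw iD i1.
    by rewrite inj_eq //; apply/eqP=> e; move: d1; rewrite -e hiD; slia.
  by have := hD l; move: e eb; rewrite !gd bm d1 hiD; slia.
case: (w =P i3) => [->|/eqP wi]; first by slia.
have [|l e] := sw w i3; first by rewrite inj_eq.
by have := mw l; move: e eb; rewrite !gd bm d3 hiD; slia.
Qed.
End TopExact.

Lemma cards3 (T : finType) (A : {set T}) : #|A| = 3 ->
  exists a b c, [/\ a != b, a != c, b != c & A = [set a; b; c]].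
Proof.
move=> cA; have /card_gt0P[a aA] : 0 < #|A| by rewrite cA.
have := cardsD1 a A; rewrite aA cA => -[/esym/eqP/cards2P[b [c [bc e]]]].
have : b \in A :\ a by rewrite e !inE eqxx.
have : c \in A :\ a by rewrite e !inE eqxx orbT.
rewrite !inE => /andP[ca cA'] /andP[ba bA].
exists a, b, c; split; rewrite // 1?eq_sym //.
by rewrite -(setD1K aA) e setUA.
Qed.

Lemma dg3 (G : sgraph) (a b c v : G) : a != b -> a != c -> b != c ->
  dg [set a; b; c] v = adj v a + adj v b + adj v c.
Proof.
move=> ab ac bc; rewrite -setUA !dg_U1 ?inE ?negb_or ?ab //.
rewrite addnA; congr (_ + _).
by have := dg_U1 v (negbT (in_set0 c)); rewrite dg_set0 addn0 setU0.
Qed.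

Lemma ee3 (G : sgraph) (a b c : G) : a != b -> a != c -> b != c ->
  ee [set a; b; c] = 2 * (adj a b + adj a c + adj b c).
Proof.
move=> ab ac bc; rewrite /ee.
have -> : \sum_(x in [set a; b; c]) dg [set a; b; c] x =
   dg [set a; b; c] a + dg [set a; b; c] b + dg [set a; b; c] c.
  rewrite -setUA big_setU1 ?inE ?negb_or ?ab //= big_setU1 ?inE //= big_set1 addnA.
  by [].
rewrite !dg3 // !adjxx (adjC b a) (adjC c a) (adjC c b); slia.
Qed.

(** * Triples left out, and maximum degree at least 5 *)

Lemma cards4 (T : finType) (a b c d : T) : uniq [:: a; b; c; d] -> #|[set a; b; c; d]| = 4.
Proof.
move=> un; have /= <- := card_uniqP un; rewrite -cardsE; apply: eq_card => x.
by rewrite !inE -!orbA.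
Qed.

Section Triples.
Variables (G H : sgraph).
Hypothesis arr : arrows G H.
Hypothesis k1 : 1 < #|H|.
Hypothesis n3 : #|G| = #|H| + 3.
Variable D : nat.
Hypothesis top : forall v : G, dg setT v <= D.
Implicit Types (K : {set G}) (a b c d v : G).

(** The quantity by which a triple decides how many edges remain when it is
    deleted from [G]: deleting vertices of degree [D] that are pairwise nonadjacent
    removes most edges, and each inner edge or missing degree removes one less. *)
Definition weight a b c := adj a b + adj a c + adj b c +
  ((D - dg setT a) + (D - dg setT b) + (D - dg setT c)).

Lemma outside3 K : good H K -> exists a b c, [/\ a != b, a != c, b != c & ~: K = [set a; b; c]].
Proof. by move=> gK; apply: cards3; have := cardsC K; rewrite (good_card gK) n3; slia. Qed.

Lemma weight_ee K a b c : good H K -> a != b -> a != c -> b != c -> ~: K = [set a; b; c] ->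
  ee [set: G] + 2 * weight a b c = ee [set: H] + 6 * D.
Proof.
move=> gK ab ac bc e; have := ee_split (~: K); rewrite setCK (good_ee gK) e ee3 //.
have -> : \sum_(u in [set a; b; c]) dg setT u = dg setT a + dg setT b + dg setT c.
  by rewrite -setUA big_setU1 ?inE ?negb_or ?ab //= big_setU1 ?inE //= big_set1 addnA.
by rewrite /weight; have := top a; have := top b; have := top c; slia.
Qed.

(** Copies of [H] have equally many edges, so the triples they leave out have
    equal weight. Since one of the triples among any four vertices is left out by
    a copy, this becomes a condition on [G] alone. *)
Lemma weight_const : exists eps, (forall K, good H K -> exists a b c,
     [/\ a != b, a != c, b != c, ~: K = [set a; b; c] & weight a b c = eps]) /\
  (forall a b c d, uniq [:: a; b; c; d] ->
     [\/ weight a b c = eps, weight a b d = eps, weight a c d = eps | weight b c d = eps]).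
Proof.
have [K0 _ gK0] := extend_sub arr (A := set0) k1 ltac:(rewrite cards0; slia).
have [a0 [b0 [c0 [ab0 ac0 bc0 e0]]]] := outside3 gK0.
exists (weight a0 b0 c0).
have E K a b c : good H K -> a != b -> a != c -> b != c -> ~: K = [set a; b; c] ->
    weight a b c = weight a0 b0 c0.
  move=> gK ab ac bc e; have := weight_ee gK ab ac bc e; have := weight_ee gK0 ab0 ac0 bc0 e0; slia.
split=> [K gK|a b c d].
  have [a [b [c [ab ac bc e]]]] := outside3 gK; exists a, b, c; split=> //; exact: E gK _ _ _ e.
rewrite /= !inE !negb_or !andbT => /and3P[/and3P[ab ac ad] /andP[bc bd] cd].
have [|w wW] := good_in arr (W := [set a; b; c; d]) k1.
  by rewrite cards4 ?n3 //=; [slia|rewrite !inE !negb_or ab ac ad bc bd cd].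
move=> gw; move: wW gw; rewrite !inE.
have R x y z : x != y -> x != z -> y != z -> [set a; b; c; d] :\ w = [set x; y; z] ->
   good H (~: ([set a; b; c; d] :\ w)) -> weight x y z = weight a0 b0 c0.
  by move=> xy xz yz e g; apply: E g _ _ _ _; rewrite ?setCK.
case/orP=> [/orP[/orP[]|]|] /eqP ew gw.
- apply: Or44; apply: R gw => //; apply/setP=> x; rewrite !inE ew.
  by case: (x =P a) => [->|] //=; rewrite (negbTE ab) (negbTE ac) (negbTE ad).
- apply: Or43; apply: R gw => //; apply/setP=> x; rewrite !inE ew.
  by case: (x =P b) => [->|_] /=; rewrite ?orbF // (eq_sym b a) (negbTE ab) (negbTE bc) (negbTE bd).
- apply: Or42; apply: R gw => //; apply/setP=> x; rewrite !inE ew.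
  by case: (x =P c) => [->|_] /=; rewrite ?orbF // !(eq_sym c) (negbTE ac) (negbTE bc) eq_sym (negbTE cd).
apply: Or41; apply: R gw => //; apply/setP=> x; rewrite !inE ew.
by case: (x =P d) => [->|_] /=; rewrite ?orbF // !(eq_sym d) (negbTE ad) (negbTE bd) (negbTE cd).
Qed.
End Triples.

(** In a regular graph the weight of a triple is its number of edges. If the
    common weight is 0, there are no two disjoint edges. If it is 1, there is no
    4-cycle, but [w] and [t] have two common neighbours outside [K]. *)
Lemma regular_sparse G H r : arrows G H -> 1 < #|H| -> #|G| = #|H| + 3 ->
  (forall v : G, dg setT v = r) ->
  (forall K : {set G}, good H K -> ee (~: K) <= 2) ->
  (exists K : {set G}, exists w t, [/\ good H K, dg (~: K) w = 3 & dg (~: K) t = 2 /\ w != t]) ->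
  exc H.
Proof.
move=> arr k1 n3 reg small [K [w [t [gK dw [dt wt]]]]].
have top v : dg [set: G] v <= r by rewrite reg.
have qE (a b c : G) : weight r a b c = adj a b + adj a c + adj b c.
  by rewrite /weight !reg subnn !addn0.
have [eps [qU q4]] := weight_const arr k1 n3 top.
have [a [b [c [ab ac bc e]]]] := qU K gK; rewrite qE => q.
have e1 : eps <= 1 by have := small K gK; rewrite e ee3 // q; slia.
case: (posnP eps) => [e0|e1'].
  apply: (nomatching_exc arr k1); first by slia.
  move=> x y z u xy zu; apply: contraT; rewrite !negb_or => /and4P[xz xu yz yu].
  have xNy : x != y by apply: contraTneq xy => ->; rewrite adjxx.
  have zNu : z != u by apply: contraTneq zu => ->; rewrite adjxx.
  have := q4 x y z u; rewrite /= !inE !negb_or xNy xz xu yz yu zNu => /(_ isT).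
  by rewrite !qE xy zu e0; case; slia.
have common x y : x != y -> adj w x -> adj w y -> adj t x -> adj t y -> False.
  move=> xy wx wy tx ty.
  have [wNx wNy] : w != x /\ w != y by split; [apply: contraTneq wx|apply: contraTneq wy] => ->; rewrite adjxx.
  have [tNx tNy] : t != x /\ t != y by split; [apply: contraTneq tx|apply: contraTneq ty] => ->; rewrite adjxx.
  have := q4 w t x y; rewrite /= !inE !negb_or wt wNx wNy tNx tNy xy => /(_ isT).
  by rewrite !qE wx wy tx ty; case; slia.
exfalso; move: dw dt; rewrite e !dg3 //.
case wa: (adj w a); case wb: (adj w b); case wc: (adj w c) => //= _.
case ta: (adj t a); case tb: (adj t b); case tc: (adj t c) => //= _.
- exact: (common a b).
- exact: (common a c).
- exact: (common b c).
Qed.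

(** For [D >= 5] the argument of [top_exact] also applies to the complement and
    bounds the degrees of [G] from below by [D]. So [G] is regular, and vertices of
    degrees [D - 3], [D - 2], [D - 1] and [D] in a copy have 3, 2, 1 and 0
    neighbours among the three vertices left out. These three span at most one
    edge in [G] or in its complement, and [regular_sparse] applies there. *)
Lemma max_degree_le4 G (H : sgraph) D (iD : H) : arrows G H -> ~ exc H -> 6 < #|H| -> #|H| + 3 <= #|G| ->
  (forall i : H, dg setT i <= D) -> dg setT iD = D -> D + 3 <= #|H| -> D <= 4.
Proof.
move=> arr nexc k7 kn hD hiD hDk; rewrite leqNgt; apply/negP=> D5.
have k1 : 1 < #|H| by slia.
have [w dw low] := lowest arr nexc k7 kn hD hiD hDk ltac:(slia).
have n3 : #|G| = #|H| + 3.
  apply/eqP; rewrite eqn_leq kn andbT leqNgt; apply/negP=> n4.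
  have [|||i di] := has_dg arr nexc k7 kn hD hiD hDk (j := D - 4); try slia.
  by have := low i; slia.
have nexc' : ~ exc (compl H) by move/exc_compl.
have reg v : dg [set: G] v = D.
  have := top_exact arr k7 kn hD hiD hDk v.
  have := @top_exact _ _ (arrows_compl arr) k7 kn (dg (G := compl H) setT w) w _ erefl _ v.
  have := codeg v; have := codeg w => c1 c2 h h'.
  have lw i : dg (G := compl H) setT i <= dg (G := compl H) setT w.
    have := @codeg H i; have := low i; cosimp; slia.
  have {}h := h lw ltac:(cosimp; slia).
  by cosimp; slia.
have dgs j : D - 3 <= j -> j <= D -> exists i : H, dg setT i = j.
  by move=> j1 j2; apply: (has_dg arr nexc k7 kn hD hiD hDk) => //; slia.
have [i0 d0] := dgs (D - 3) ltac:(slia) ltac:(slia).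
have [i1 d1] := dgs (D - 2) ltac:(slia) ltac:(slia).
have [i2 d2] := dgs (D - 1) ltac:(slia) ltac:(slia).
have top v : dg [set: G] v <= D by rewrite reg.
have [eps [qU _]] := weight_const arr k1 n3 top.
have eU (K : {set G}) : good H K -> ee (~: K) = 2 * eps.
  move=> gK; have [a [b [c [ab ac bc -> <-]]]] := qU K gK.
  by rewrite ee3 // /weight !reg subnn !addn0.
have [K _ gK] := extend_sub arr (A := set0) k1 ltac:(rewrite cards0; slia).
have [g [gI Ke ga gd]] := good_fun gK.
have gin i : g i \in K by rewrite Ke imset_f ?inE.
have dU i : dg (~: K) (g i) + dg setT i = D by rewrite -gd addnC dg_compl reg.
have cU : #|~: K| = 3 by have := cardsC K; rewrite (good_card gK); slia.
have [e1|e2] := leqP eps 1.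
  apply: nexc; apply: (regular_sparse arr k1 n3 reg) => [K' gK'|]; first by rewrite eU //; slia.
  exists K, (g i0), (g i1); split; rewrite // ?inj_eq //.
  - by have := dU i0; slia.
  - split; first by have := dU i1; slia.
    by apply/eqP=> e; move: d0; rewrite e d1; slia.
apply: nexc'; apply: (@regular_sparse _ _ (#|G| - 1 - D) (arrows_compl arr)) => //.
- by move=> v; have := @codeg G v; rewrite reg; cosimp; slia.
- move=> K' gK'; have g' : @good G H K' by exact: compl_good.
  have := ee_co (G := G) (~: (K' : {set G})); rewrite eU //.
  have -> : #|~: (K' : {set G})| = 3 by have := cardsC (K' : {set G}); rewrite (good_card g'); slia.
  by cosimp; slia.
have coU i : dg (G := compl G) (~: K) (g i) + dg (~: K) (g i) = 3.
  by have := dg_co (G := G) (~: K) (g i); rewrite inE gin cU addn0.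
exists K, (g iD), (g i2); split.
- exact: good_compl.
- by have := coU iD; have := dU iD; cosimp; slia.
split; first by have := coU i2; have := dU i2; cosimp; slia.
by rewrite (inj_eq gI); apply/eqP=> e; move: hiD; rewrite e d2; slia.
Qed.

(** * Maximum degree 3 *)

Lemma ee_even (G : sgraph) (A : {set G}) : ~~ odd (ee A).
Proof.
have [m] := ubnP #|A|; elim: m A => // m IH A lt.
have [->|/set0Pn[z zA]] := eqVneq A set0; first by rewrite /ee big_set0.
rewrite (ee_D1 zA) oddD oddM addbF; apply: IH.
by have := cardsD1 z A; rewrite zA; slia.
Qed.

Lemma cnI (G : sgraph) (x y : G) : adj x y -> 2 <= #|cn x :&: cn y|.
Proof.
move=> xy; have <- : #|[set x; y]| = 2 by rewrite cards2 adj_neq.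
apply: subset_leq_card; apply/subsetP=> z; rewrite !inE.
by case/orP=> /eqP->; rewrite eqxx ?xy 1?adjC ?xy ?orbT.
Qed.

Lemma card3_le (T : finType) (x a b : T) : #|[set x; a; b]| <= 3.
Proof. by rewrite !cardsU !cards1; slia. Qed.

Section Const.
Variables (G H : sgraph).
Hypothesis arr : arrows G H.
Hypothesis nexc : ~ exc H.
Hypothesis k1 : 1 < #|H|.
Hypothesis kn : #|H| + 3 <= #|G|.
Variable D : nat.
Hypothesis top : forall v : G, dg setT v <= D.
Implicit Types (K U W B : {set G}) (x y z a b c d v : G).

Lemma ee_bound K : good H K -> ee [set: G] + ee (~: K) <= ee [set: H] + 2 * (D * (#|G| - #|H|)).
Proof.
move=> gK; have := ee_split (~: K); rewrite setCK (good_ee gK) => ->.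
rewrite leq_add2l leq_mul2l /= (@leq_trans (\sum_(u in ~: K) D)) //.
  by apply: leq_sum => u _.
by rewrite sum_nat_const mulnC leq_mul2l (card_outside gK) leqnn orbT.
Qed.

(** Such a copy has the least number of edges that a copy can have. All copies
    have this number, so all leave out independent vertices. *)
Lemma no_independent_outside K : good H K -> {in ~: K &, forall x y, adj x y = false} ->
  {in ~: K, forall x, dg setT x = D} -> False.
Proof.
move=> gK ind dD; apply: nexc; apply: (independent_exc arr) => // K' x y gK' xK yK.
have e0 : ee (~: K) = 0.
  by rewrite /ee big1 // => u uK; rewrite /dg big1 // => v vK; rewrite ind.
have es : \sum_(u in ~: K) dg setT u = D * (#|G| - #|H|).
  by rewrite (eq_bigr (fun _ => D)) // sum_nat_const (card_outside gK) mulnC.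
have := ee_split (~: K); rewrite setCK (good_ee gK) e0 es => e.
have := ee_bound gK'.
have [xe|] := posnP (ee (~: K')); last by slia.
move=> _; move/eqP: xe; rewrite /ee sum_nat_eq0 => /forallP/(_ x); rewrite inE xK /=.
by move/eqP=> dx; apply: (dg0 dx); rewrite inE.
Qed.

Definition hitting B := forall K, good H K -> B \subset ~: K -> False.

(** A set of [n - k + 1] vertices around both would contain the complement of a
    good set, which lacks a single vertex and so contains one of the two sets. *)
Lemma two_hitting B1 B2 : [disjoint B1 & B2] -> #|B1| + #|B2| <= #|G| - #|H| + 1 ->
  hitting B1 -> hitting B2 -> False.
Proof.
move=> dB cB b1 b2.
have [||W sW cW] := @superset _ (B1 :|: B2) (#|G| - #|H| + 1); [|slia|].
  by rewrite (leq_trans (leq_card_setU _ _).1).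
rewrite subUset in sW; case/andP: sW => s1 s2.
have [r rW gr] := good_in arr k1 cW.
case: (boolP (r \in B1)) => rB.
  apply: (b2 _ gr); rewrite setCK subsetD1 s2.
  by apply/negP=> rB2; move/pred0P/(_ r): dB; rewrite /= rB rB2.
by apply: (b1 _ gr); rewrite setCK subsetD1 s1.
Qed.
End Const.

Section Subcubic.
Variables (G H : sgraph).
Hypothesis arr : arrows G H.
Hypothesis nexc : ~ exc H.
Hypothesis k7 : 6 < #|H|.
Hypothesis kn : #|H| + 3 <= #|G|.
Variable iD : H.
Hypothesis hD : forall i : H, dg setT i <= 3.
Hypothesis hiD : dg setT iD = 3.
Let hDk : 3 + 3 <= #|H|. Proof. by slia. Qed.
Let k1 : 1 < #|H|. Proof. by slia. Qed.
Let k3 : 3 < #|H|. Proof. by slia. Qed.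
Let kn2 : #|H| + 2 <= #|G|. Proof. by slia. Qed.
Let top : forall v : G, dg setT v <= 3. Proof. exact: (top_exact arr k7 kn hD hiD hDk). Qed.
Implicit Types (K U W B : {set G}) (x y z a b c d v : G).
Let k8 : #|H| <= 8. Proof. exact: (order_le arr nexc k7 kn hD hiD hDk). Qed.

(** If [H] has a single vertex of degree 3, then [wide_pair] makes the vertices
    of degree 3 of [G] independent: adjacent ones have closed neighbourhoods with
    two common vertices. More than [n - k] such vertices exist, so some good set
    leaves out only such vertices. *)
Lemma subcubic_lone : (forall i j : H, dg setT i = 3 -> dg setT j = 3 -> i = j) -> False.
Proof.
move=> lone.
have ind x y : x \in full G 3 -> y \in full G 3 -> adj x y = false.
  move=> xF yF; apply/negP=> xy.
  have := wide_pair arr nexc k7 kn hD hiD hDk xF yF (adj_neq xy) (or_intror lone).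
  have := cardsUI (cn x) (cn y); have := cnI xy.
  by rewrite !card_cn (fullP _ _ xF) (fullP _ _ yF); slia.
have [|W WF cW] := @subset_of _ (full G 3) (#|G| - #|H| + 1).
  by have := many_full arr nexc k7 kn hD hiD hDk; slia.
have [w wW gw] := good_in arr k1 cW.
have sF x : x \in ~: ~: (W :\ w) -> x \in full G 3.
  by rewrite setCK !inE => /andP[_ /(subsetP WF)]; rewrite inE.
apply: (no_independent_outside arr nexc k1 kn top gw) => [x y xU yU|x xU].
  by apply: ind; apply: sF.
by apply/fullP; apply: sF.
Qed.

Variables (i j : H).
Hypothesis ij : i != j.
Hypothesis di : dg setT i = 3.
Hypothesis dj : dg setT j = 3.

(** Two adjacent vertices of degree 3 in the copy, without neighbours outside,
    are exchanged for [b]. *)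
Lemma outside_dg K b : good H K -> b \notin K -> dg (~: K) b + 2 <= dg setT b.
Proof.
move=> gK bK; have [g [gI Ke ga gd]] := good_fun gK.
have gin l : g l \in K by rewrite Ke imset_f ?inE.
have [|l e] := swap_dg arr k1 gK bK (gin i) (gin j); first by rewrite inj_eq.
move: e; rewrite !gd ga di dj (full_clique arr nexc k7 kn hD hiD hDk ij di dj).
rewrite !(adjC b) !(full_out arr k7 kn hD hiD hDk (K := K)) ?gd //.
by have := hD l; rewrite -(dg_compl K b); slia.
Qed.

Lemma dg_ge2 v : 2 <= dg setT v.
Proof.
have [K gK vK] := movable arr v k3 kn2 nexc.
by have := outside_dg gK vK; slia.
Qed.

Lemma hitting_path x a b : a != b -> adj x a -> adj x b -> hitting H [set x; a; b].
Proof.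
move=> ab xa xb K gK sK.
have [xK aK bK] : [/\ x \in ~: K, a \in ~: K & b \in ~: K].
  by split; apply: (subsetP sK); rewrite !inE eqxx ?orbT.
have := outside_dg gK (b := x); rewrite inE in xK; move/(_ xK).
have : 2 <= dg (~: K) x; last by have := top x; slia.
have <- : #|[set a; b]| = 2 by rewrite cards2 ab.
by rewrite dgE; apply: subset_leq_card; apply/subsetP=> y; rewrite in_set2 [in X in _ -> X]inE; case/orP=> /eqP->; rewrite ?aK ?bK.
Qed.

Lemma hitting_edge x y : dg setT x = 2 -> adj x y -> hitting H [set x; y].
Proof.
move=> dx xy K gK sK.
have [xK yK] : x \in ~: K /\ y \in ~: K by split; apply: (subsetP sK); rewrite !inE eqxx ?orbT.
have := outside_dg gK (b := x); rewrite inE in xK; move/(_ xK); rewrite dx => d0.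
by have := @dg0 _ (~: K) x y ltac:(slia) yK; rewrite xy.
Qed.

(** Of a 4-cycle some good set leaves out three vertices, which form a path with
    two edges. *)
Lemma no_C4 t w a b : t != w -> a != b -> adj t a -> adj t b -> adj w a -> adj w b -> False.
Proof.
move=> tw ab ta tb wa wb.
have [||W sW cW] := @superset _ [set t; w; a; b] (#|G| - #|H| + 1); [|slia|].
  rewrite cards4; first by slia.
  by rewrite /= !inE !negb_or tw ab (adj_neq ta) (adj_neq tb) (adj_neq wa) (adj_neq wb).
have [r rW gr] := good_in arr k1 cW.
have inW v : v \in [set t; w; a; b] -> v != r -> v \in ~: ~: (W :\ r).
  by move=> /(subsetP sW) vW vr; rewrite setCK in_setD1 vr vW.
have bd x y z : y != z -> adj x y -> adj x z -> x \in ~: ~: (W :\ r) -> y \in ~: ~: (W :\ r) ->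
    z \in ~: ~: (W :\ r) -> False.
  move=> yz xy xz x1 y1 z1; apply: (hitting_path yz xy xz gr); apply/subsetP=> v.
  by rewrite !in_setU !in_set1 => /orP[/orP[]|] /eqP->.
have tS : t \in [set t; w; a; b] by rewrite !inE eqxx.
have wS : w \in [set t; w; a; b] by rewrite !inE eqxx orbT.
have aS : a \in [set t; w; a; b] by rewrite !inE eqxx !orbT.
have bS : b \in [set t; w; a; b] by rewrite !inE eqxx !orbT.
have [nta ntb nwa nwb] : [/\ t != a, t != b, w != a & w != b] by split; apply: adj_neq.
have [rt|rt] := eqVneq r t.
  by apply: (bd w a b) => //; apply: inW; rewrite // rt // eq_sym.
have [ra|ra] := eqVneq r a.
  by apply: (bd b t w); rewrite // 1?adjC //; apply: inW; rewrite // ra // eq_sym.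
have [rb|rb] := eqVneq r b.
  by apply: (bd a t w); rewrite // 1?adjC //; apply: inW; rewrite // rb.
by apply: (bd t a b) => //; apply: inW; rewrite // eq_sym.
Qed.

Lemma path_off x A : dg setT x = 3 -> #|nb x :&: A| <= 1 ->
  exists a b, [/\ a != b, adj x a, adj x b, a \notin A & b \notin A].
Proof.
move=> dx cA; have /card_gt1P[a [b [aS bS ab]]] : 1 < #|nb x :\: A|.
  by have := cardsID A (nb x); rewrite -dgT dx; slia.
move: aS bS; rewrite !inE => /andP[aA xa] /andP[bA xb].
by exists a, b.
Qed.

Lemma far_pair : exists x y, [/\ x != y, ~~ adj x y, dg setT x = 3, dg setT y = 3
   & #|cn x :&: cn y| <= 1].
Proof.
have [x [y [xF yF xy nxy]]] := full_not_clique arr nexc k7 kn hD hiD hDk.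
have := wide_pair arr nexc k7 kn hD hiD hDk xF yF xy (or_introl nxy).
have := cardsUI (cn x) (cn y); move/fullP: xF => dx; move/fullP: yF => dy.
by rewrite !card_cn dx dy => e1 e2; exists x, y; split=> //; slia.
Qed.

Lemma nb_cnI x y : #|nb x :&: cn y| <= #|cn x :&: cn y|.
Proof. by apply: subset_leq_card; apply: setSI; apply: subsetUr. Qed.

(** Around two vertices of degree 3 whose closed neighbourhoods are almost
    disjoint there are two disjoint paths with two edges, six vertices in all. *)
Lemma subcubic_excess_le4 : #|G| <= #|H| + 4.
Proof.
rewrite leqNgt; apply/negP=> s5.
have [x [y [xy nxy dx dy cI]]] := far_pair.
have [a [b [ab xa xb ay by_]]] := path_off dx (leq_trans (nb_cnI x y) cI).
have cI' : #|nb y :&: cn x| <= 1 by rewrite (leq_trans (nb_cnI y x)) // setIC.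
have [c [d [cd yc yd cx dx']]] := path_off dy cI'.
apply: (two_hitting arr k1 kn _ _ (hitting_path ab xa xb) (hitting_path cd yc yd)).
  have inx v : v \in [set x; a; b] -> v \in cn x.
    by rewrite !inE => /orP[/orP[]|] /eqP->; rewrite ?eqxx ?xa ?xb ?orbT.
  rewrite -setI_eq0; apply/eqP/setP=> v; rewrite !in_setI in_set0; apply/negP=> /andP[v1 v2].
  have vx := inx _ v1; move: v2; rewrite !in_setU !in_set1 => /orP[/orP[]|] /eqP e.
  - move: v1; rewrite e !in_setU !in_set1 => /orP[/orP[]|] /eqP e'.
    + by rewrite e' eqxx in xy.
    + by move: ay; rewrite -e' !inE eqxx.
    + by move: by_; rewrite -e' !inE eqxx.
  - by rewrite e (negbTE cx) in vx.
  - by rewrite e (negbTE dx') in vx.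
by have := card3_le x a b; have := card3_le y c d; slia.
Qed.

(** A vertex of degree 2 and a neighbour, together with a disjoint path with
    two edges, are five vertices. If no such path exists, both vertices of the
    far pair are joined to both ends of the edge and lie on a 4-cycle. *)
Lemma cubic_of_excess4 : #|G| = #|H| + 4 -> forall z, dg setT z = 3.
Proof.
move=> n4 z; have := dg_ge2 z; have := top z; rewrite leq_eqVlt => /predU1P[//|z3 z2].
have dz : dg setT z = 2 by slia.
have [z' _ zz'] := @dg_pos _ setT z ltac:(by rewrite dz).
have [x [y [xy nxy dx dy cI]]] := far_pair.
have zne v : dg setT v = 3 -> v != z by apply: contra_eq_neq => ->; rewrite dz.
have done u : dg setT u = 3 -> u != z' -> #|nb u :&: [set z; z']| <= 1 -> False.
  move=> du uz' cu; have [a [b [ab ua ub aZ bZ]]] := path_off du cu.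
  apply: (two_hitting arr k1 kn _ _ (hitting_path ab ua ub) (hitting_edge dz zz')).
    rewrite -setI_eq0; apply/eqP/setP=> v; rewrite !in_setI in_set0; apply/negP=> /andP[v1 v2].
    move: v1; rewrite !in_setU !in_set1 => /orP[/orP[]|] /eqP e; subst v.
    - by move: v2; rewrite !inE (negbTE uz') (negbTE (zne _ du)).
    - by rewrite v2 in aZ.
    - by rewrite v2 in bZ.
  by have := card3_le u a b; rewrite cards2; case: eqP; slia.
have le1 u v : v \in [set z; z'] -> ~~ adj u v -> #|nb u :&: [set z; z']| <= 1.
  move=> vZ nuv; have : #|[set z; z'] :\ v| <= 1.
    by have := cardsD1 v [set z; z']; rewrite vZ cards2; case: eqP; slia.
  apply: leq_trans; apply: subset_leq_card; apply/subsetP=> w.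
  rewrite !inE => /andP[uw ->]; rewrite andbT.
  by apply: contraNneq nuv => <-.
have [zx|zx] := eqVneq x z'.
  by exfalso; apply: (done y dy); [rewrite -zx eq_sym|apply: (le1 _ z'); rewrite ?inE ?eqxx ?orbT // -zx adjC].
have [axz|nxz] := boolP (adj x z); last by exfalso; apply: (done x dx zx); apply: (le1 _ z); rewrite ?inE ?eqxx.
have [axz'|nxz] := boolP (adj x z'); last by exfalso; apply: (done x dx zx); apply: (le1 _ z'); rewrite ?inE ?eqxx ?orbT.
have yz' : y != z' by apply: contraNneq nxy => ->.
exfalso; have [ayz|nyz] := boolP (adj y z); last by apply: (done y dy yz'); apply: (le1 _ z); rewrite ?inE ?eqxx.
have [ayz'|nyz] := boolP (adj y z'); last by apply: (done y dy yz'); apply: (le1 _ z'); rewrite ?inE ?eqxx ?orbT.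
exact: (no_C4 xy (adj_neq zz')).
Qed.

Lemma closed_nbr x a : dg setT x = 3 -> dg setT a = 3 -> adj x a -> nb a \subset cn x -> False.
Proof.
move=> dx da xa sa.
have /card_gt1P[b [c [bS cS bc]]] : 1 < #|nb x :\ a|.
  by have := cardsD1 a (nb x); rewrite inE xa -dgT dx; slia.
move: bS cS; rewrite !inE => /andP[ba xb] /andP[ca xc].
have e : nb a = cn x :\ a.
  apply/eqP; rewrite eqEcard subsetD1 sa inE adjxx /=.
  by have := cardsD1 a (cn x); rewrite !inE xa orbT card_cn dx -dgT da; slia.
have bN : b \in nb a by rewrite e !inE ba xb orbT.
have cN : c \in nb a by rewrite e !inE ca xc orbT.
rewrite inE in bN; rewrite inE in cN.
exact: (no_C4 (adj_neq xa) bc).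
Qed.

Lemma no_shared8 x v a : #|H| = 8 -> dg setT x = 3 -> dg setT v = 3 -> x != v -> ~~ adj x v ->
  adj x a -> adj v a -> False.
Proof.
move=> h8 dx dv xv nxv xa va.
have := @wide_pair _ _ arr nexc k7 kn _ _ hD hiD hDk x v.
rewrite !inE dx dv => /(_ isT isT xv (or_introl nxv)).
have := cardsUI (cn x) (cn v); rewrite !card_cn dx dv h8.
have : 0 < #|cn x :&: cn v| by apply/card_gt0P; exists a; rewrite !inE xa va !orbT.
slia.
Qed.

(** If [n = k + 4], then [G] is cubic and [n] is even, so [k = 8]. Now vertices of
    degree 3 at distance two contradict [wide_pair], hence every component is
    complete on four vertices and contains a 4-cycle. *)
Lemma subcubic_excess3 : #|G| = #|H| + 3.
Proof.
have := kn; rewrite leq_eqVlt => /predU1P[//|n4]; exfalso.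
have n4' : #|G| = #|H| + 4 by have := subcubic_excess_le4; slia.
have reg := cubic_of_excess4 n4'.
have e : ee [set: G] = 3 * #|G|.
  by rewrite /ee (eq_bigr (fun _ => 3)) ?sum_nat_const ?cardsT 1?mulnC.
have := ee_even [set: G]; rewrite e oddM /= => odd_n.
have h8 : #|H| = 8.
  by apply/eqP; rewrite eqn_leq k8 ltnNge; apply: contra odd_n => h; rewrite n4' (_ : #|H| = 7) //; slia.
have /card_gt0P[x _] : 0 < #|G| by slia.
have [a _ xa] := @dg_pos _ setT x ltac:(by rewrite reg).
apply: (closed_nbr (reg x) (reg a) xa); apply/subsetP=> v; rewrite !inE => av.
apply: contraT; rewrite negb_or => /andP[vx nxv]; exfalso.
by apply: (no_shared8 h8 (reg x) (reg v) _ nxv xa); rewrite 1?eq_sym // adjC.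
Qed.

(** Take a triple of vertices of degree 3 that is left out. By [outside_dg] each
    of them has at most one neighbour in the triple, so the triple has at most one
    edge; it has one by [no_independent_outside]. *)
Lemma subcubic_weight1 a b c d : uniq [:: a; b; c; d] ->
  [\/ weight 3 a b c = 1, weight 3 a b d = 1, weight 3 a c d = 1 | weight 3 b c d = 1].
Proof.
have n3 := subcubic_excess3.
have [eps [qU q4]] := weight_const arr k1 n3 top; move=> /q4.
suff -> : eps = 1 by [].
have [|W WF cW] := @subset_of _ (full G 3) (#|G| - #|H| + 1).
  by have := many_full arr nexc k7 kn hD hiD hDk; slia.
have [w wW gw] := good_in arr k1 cW.
have [x [y [z [xy xz yz e q]]]] := qU _ gw.
have inU v : v \in [set x; y; z] -> v \notin ~: (W :\ w).
  by rewrite -e in_setC.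
have d3 v : v \in [set x; y; z] -> dg setT v = 3.
  rewrite -e setCK inE => /andP[_ /(subsetP WF)] vF; exact/fullP.
have [xU yU zU] : [/\ x \in [set x; y; z], y \in [set x; y; z] & z \in [set x; y; z]].
  by rewrite !inE !eqxx !orbT.
have := outside_dg gw (inU x xU); have := outside_dg gw (inU y yU); have := outside_dg gw (inU z zU).
move: (q); rewrite /weight e !dg3 // !d3 // !adjxx (adjC y x) (adjC z x) (adjC z y) => q' h1 h2 h3.
have le1 : eps <= 1 by slia.
have [e0|] := posnP eps; last by slia.
exfalso; have [xy0 xz0 yz0] : [/\ adj x y = false, adj x z = false & adj y z = false].
  by move: q'; rewrite e0; case: (adj x y); case: (adj x z); case: (adj y z).
apply: (no_independent_outside arr nexc k1 kn top gw); rewrite e.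
  move=> u v; rewrite !in_setU !in_set1 => /orP[/orP[]|] /eqP-> /orP[/orP[]|] /eqP->;
  by rewrite ?adjxx // ?xy0 ?xz0 ?yz0 // adjC ?xy0 ?xz0 ?yz0.
by move=> u /d3.
Qed.

(** Among two vertices of degree 2 and the ends of an edge that avoids them,
    every triple has weight at least 2. *)
Lemma unique_dg2 z z' : dg setT z = 2 -> dg setT z' = 2 -> z = z'.
Proof.
move=> dz dz'; apply: contraTeq isT => zz'.
have [x [_ [_ _ dx _ _]]] := far_pair.
have [a xa az] : exists2 a, adj x a & a \notin [set z; z'].
  have /card_gt0P[a] : 0 < #|nb x :\: [set z; z']|.
    have := cardsID [set z; z'] (nb x); have := subset_leq_card (subsetIr (nb x) [set z; z']).
    by rewrite -dgT dx cards2 zz'; slia.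
  by rewrite in_setD => /andP[az]; rewrite [in X in X -> _]inE => xa; exists a.
move: az; rewrite !inE negb_or => /andP[az az'].
have xz : x != z by apply: contra_eq_neq dx => ->; rewrite dz.
have xz' : x != z' by apply: contra_eq_neq dx => ->; rewrite dz'.
have := @subcubic_weight1 z z' x a.
rewrite /= !inE !negb_or zz' !(eq_sym z) !(eq_sym z') xz xz' az az' (adj_neq xa) => /(_ isT).
by rewrite /weight dz dz' xa dx; case; slia.
Qed.

(** If [k = 8], then vertices of degree 3 have no common neighbour unless they
    are adjacent, which forces every vertex of degree 3 to be a neighbour of the
    only vertex of degree 2. *)
Lemma subcubic_order7 : #|H| = 7.
Proof.
apply/eqP; rewrite eqn_leq k7 andbT leqNgt; apply/negP=> h.
have h8 : #|H| = 8 by have := k8; slia.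
have dv2 v : dg setT v = 3 \/ dg setT v = 2 by have := top v; have := dg_ge2 v; slia.
have near x : dg setT x = 3 -> exists2 z, adj x z & dg setT z = 2.
  move=> dx; apply: boolp.contrapT => no.
  have d3 a : adj x a -> dg setT a = 3.
    by move=> xa; case: (dv2 a) => // da; case: no; exists a.
  have leave a : adj x a -> exists v, [/\ adj a v, v != x & dg setT v = 2].
    move=> xa; have := boolp.contrapT; move/(_ _); apply => noa.
    apply: (closed_nbr dx (d3 a xa) xa); apply/subsetP=> v; rewrite !inE => av.
    apply: contraT; rewrite negb_or => /andP[vx nxv]; exfalso.
    case: (dv2 v) => dv; last by apply: noa; exists v.
    by apply: (no_shared8 h8 dx dv _ nxv xa); rewrite 1?eq_sym // adjC.
  have [a [b [ab xa xb _ _]]] := path_off (A := set0) dx ltac:(by rewrite setI0 cards0).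
  have [v [av vx dv]] := leave a xa; have [u [bu ux du]] := leave b xb.
  have e := unique_dg2 dv du; subst u; rewrite eq_sym in vx.
  by apply: (no_C4 vx ab); rewrite // adjC.
have [x [_ [_ _ dx _ _]]] := far_pair.
have [z _ dz] := near x dx.
have sub : full G 3 \subset nb z.
  apply/subsetP=> u /fullP du; rewrite inE adjC.
  by have [z' uz' dz'] := near u du; rewrite (unique_dg2 dz dz').
have := subset_leq_card sub; rewrite -dgT dz.
by have := many_full arr nexc k7 kn hD hiD hDk; slia.
Qed.

Lemma subcubic_regular v : dg setT v = 3.
Proof.
have := top v; have := dg_ge2 v; rewrite leq_eqVlt => /predU1P[dv _|]; last by slia.
have := ee_even [set: G]; rewrite /ee (bigD1 v) //= -dv.
rewrite (eq_bigr (fun _ => 3)); last first.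
  move=> u /andP[_ uv]; have := top u; have := dg_ge2 u; rewrite leq_eqVlt => /predU1P[du|].
    by rewrite (unique_dg2 (esym dv) (esym du)) eqxx in uv.
  by slia.
rewrite sum_nat_const.
have -> : #|[pred i : G | (i \in [set: G]) && (i != v)]| = 9.
  have := cardsC1 v; rewrite -[#|[set~ v]|]/(#|_|).
  have -> : #|[set~ v]| = #|[pred i : G | (i \in [set: G]) && (i != v)]|.
    by apply: eq_card => u; rewrite !inE.
  by move=> ->; have := subcubic_excess3; rewrite subcubic_order7; slia.
by [].
Qed.

(** A triple that contains [x] and two of its neighbours has weight at least 2,
    so the three neighbours of [x] span exactly one edge. *)
Lemma subcubic_triangle x : exists a b, [/\ a != b, adj x a, adj x b, adj a b &
  forall y z, adj x y -> adj x z -> adj y z -> y \in [set a; b]].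
Proof.
have reg := subcubic_regular.
have [a [b [c [ab ac bc e]]]] : exists a b c, [/\ a != b, a != c, b != c & nb x = [set a; b; c]].
  by apply: cards3; rewrite -dgT reg.
have in3 v : adj x v = (v \in [set a; b; c]) by rewrite -e inE.
have [xa xb xc] : [/\ adj x a, adj x b & adj x c].
  by rewrite !in3 !inE !eqxx !orbT.
have noboth u v w : u != w -> adj x u -> adj x v -> adj x w -> adj u v -> adj v w -> False.
  move=> uw xu xv xw uv vw.
  by apply: (no_C4 (adj_neq xv) uw); rewrite // adjC.
have uniq2 u v w : u != v -> u != w -> v != w -> nb x = [set u; v; w] ->
    adj x u -> adj x v -> adj x w -> adj u v ->
    forall y z, adj x y -> adj x z -> adj y z -> y \in [set u; v].
  move=> uNv uNw vNw e' xu xv xw uv y z xy xz yz.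
  have : y \in nb x by rewrite inE.
  have : z \in nb x by rewrite inE.
  rewrite e' !inE => zS /orP[->//|/eqP yw]; exfalso.
  case/orP: zS yz => [/orP[]|] /eqP-> ; rewrite yw ?adjxx // => wu.
    by apply: (noboth w u v) => //; rewrite eq_sym.
  by apply: (noboth u v w) => //; rewrite adjC.
have := @subcubic_weight1 x a b c.
rewrite /= !inE !negb_or ab ac bc (adj_neq xa) (adj_neq xb) (adj_neq xc) => /(_ isT).
rewrite /weight !reg xa xb xc => q.
have [hab|nab] := boolP (adj a b).
  by exists a, b; split=> //; apply: (uniq2 a b c).
have [hac|nac] := boolP (adj a c).
  exists a, c; split=> //; apply: (uniq2 a c b) => //; first by rewrite eq_sym.
  by rewrite e; apply/setP=> v; rewrite !inE orbAC.
have [hbc|nbc] := boolP (adj b c); last by move: q; rewrite (negbTE nab) (negbTE nac) (negbTE nbc); case.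
exists b, c; split=> //; apply: (uniq2 b c a); rewrite // 1?eq_sym //.
by rewrite e; apply/setP=> v; rewrite !inE -orbA orbC.
Qed.

(** Every vertex lies in one triangle, so the triangles partition the ten
    vertices into sets of three. *)
Lemma subcubic_false : False.
Proof.
pose T x := x |: [set y | adj x y && [exists z, adj x z && adj y z]].
have n10 : #|G| = 10 by have := subcubic_excess3; rewrite subcubic_order7.
have TE x : exists a b, [/\ a != b, adj x a, adj x b, adj a b & T x = [set x; a; b]].
  have [a [b [ab xa xb hab u]]] := subcubic_triangle x; exists a, b; split=> //.
  apply/setP=> y; rewrite !inE -orbA; congr (_ || _); apply/andP/orP.
    case=> xy /existsP[z /andP[xz yz]]; apply/orP.
    by have := u y z xy xz yz; rewrite !inE.
  case=> /eqP->; split=> //; apply/existsP; [exists b|exists a]; rewrite ?xa ?xb ?hab //.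
  by rewrite adjC.
have cT x : #|T x| = 3.
  have [a [b [ab xa xb hab ->]]] := TE x.
  by rewrite -setUA cardsU1 cards2 ab !inE negb_or !adj_neq.
have Tsym x y : y \in T x -> T y = T x.
  move=> yx; have [a [b [ab xa xb hab e]]] := TE x.
  have sub v : v \in T x -> T x \subset T v.
    have inT p u w : adj p u -> adj p w -> adj u w -> u \in T p.
      by move=> vu vw uw; rewrite !inE vu; apply/orP; right; apply/existsP; exists w; rewrite vw.
    have inTx p : p \in T p by rewrite !inE eqxx.
    rewrite e => /setUP[/set2P[->|->]|/set1P->]; apply/subsetP=> u /setUP[/set2P[->|->]|/set1P->];
      solve [exact: inTx | by apply: (inT _ _ x); rewrite // adjC
            | by apply: (inT _ _ a); rewrite // adjC | by apply: (inT _ _ b); rewrite // adjC].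
  by apply/eqP; rewrite eq_sym eqEcard !cT sub.
pose P := [set T x | x in [set: G]].
have pP : partition P [set: G].
  apply/and3P; split.
  - apply/eqP/setP=> x; rewrite inE; apply/bigcupP; exists (T x); first by rewrite imset_f ?inE.
    by rewrite !inE eqxx.
  - apply/trivIsetP=> A B /imsetP[x _ ->] /imsetP[y _ ->] ne.
    rewrite -setI_eq0; apply: contraNT ne => /set0Pn[z]; rewrite inE => /andP[zx zy].
    by rewrite -(Tsym _ _ zx) (Tsym _ _ zy).
  - by apply/imsetP=> -[x _ e]; have := cT x; rewrite -e cards0.
have := card_uniform_partition (n := 3) _ pP; rewrite cardsT n10 => h.
have {}h := h ltac:(by move=> A /imsetP[x _ ->]).
slia.
Qed.
End Subcubic.

(** * Maximum degree 4 *)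

Lemma card4U (T : finType) (A B C D : {set T}) :
  #|A :|: (B :|: (C :|: D))| <= #|A| + (#|B| + (#|C| + #|D|)).
Proof.
by do 2![rewrite (leq_trans (leq_card_setU _ _).1) // leq_add2l]; exact: (leq_card_setU _ _).1.
Qed.

Section Quartic.
Variables (G H : sgraph).
Hypothesis arr : arrows G H.
Hypothesis nexc : ~ exc H.
Hypothesis k7 : 6 < #|H|.
Hypothesis kn : #|H| + 3 <= #|G|.
Variable iD : H.
Hypothesis hD : forall i : H, dg setT i <= 4.
Hypothesis hiD : dg setT iD = 4.
Hypothesis hDk : 4 + 3 <= #|H|.
Let k1 : 1 < #|H|. Proof. by slia. Qed.
Let k3 : 3 < #|H|. Proof. by slia. Qed.
Let kn2 : #|H| + 2 <= #|G|. Proof. by slia. Qed.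
Let top : forall v : G, dg setT v <= 4. Proof. exact: (top_exact arr k7 kn hD hiD hDk). Qed.
Implicit Types (K U W B : {set G}) (x y z a b c d v : G).

(** A vertex of degree 4, without neighbours outside [K], and a vertex of degree
    3 are exchanged for [b]. *)
Lemma quartic_inside_ge2 K b : good H K -> b \notin K -> 2 <= dg K b.
Proof.
move=> gK bK.
have [i3 d3] := has_dg arr nexc k7 kn hD hiD hDk (j := 3) isT ltac:(slia) isT.
have [g [gI Ke ga gd]] := good_fun gK.
have gin l : g l \in K by rewrite Ke imset_f ?inE.
have [|l e] := swap_dg arr k1 gK bK (gin iD) (gin i3).
  by rewrite inj_eq //; apply/eqP=> e; move: hiD; rewrite e d3.
have hb : adj (g iD) b = false by apply: (full_out arr k7 kn hD hiD hDk (K := K)); rewrite ?gd.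
move: e; rewrite !gd hiD d3 (adjC b (g iD)) hb.
by have := hD l; slia.
Qed.

(** If [n >= k + 4], the complement of a good set can be taken inside a set
    containing a vertex [x] of degree 4 and its neighbours. If [x] is in the good
    set, it is isolated there, against [lowest]; otherwise it has at most one
    neighbour there. *)
Lemma quartic_excess3 : #|G| = #|H| + 3.
Proof.
have := kn; rewrite leq_eqVlt => /predU1P[//|n4]; exfalso.
have [w dw low] := lowest arr nexc k7 kn hD hiD hDk isT.
have [x [_ [/fullP dx _ _ _]]] := full_not_clique arr nexc k7 kn hD hiD hDk.
have [||W sW cW] := @superset _ (cn x) (#|G| - #|H| + 1); [|slia|].
  by rewrite card_cn dx; slia.
have [r rW gr] := good_in arr k1 cW.
have [rx|rx] := eqVneq r x.
  have xK : x \in ~: (W :\ r) by rewrite !inE rx eqxx.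
  have d0 : dg (~: (W :\ r)) x = 0.
    rewrite /dg big1 // => y; rewrite inE rx !inE negb_and negbK => /orP[/eqP->|yW].
      by rewrite adjxx.
    by apply/eqP; rewrite eqb0; apply: contra yW => xy; apply: (subsetP sW); rewrite !inE xy orbT.
  by have [i e] := good_dg gr xK; have := low i; rewrite -e d0.
have xK : x \notin ~: (W :\ r).
  by rewrite !inE negbK eq_sym rx; apply: (subsetP sW); rewrite !inE eqxx.
have := quartic_inside_ge2 gr xK; have := dg_compl (W :\ r) x; rewrite dx.
have : dg (nb x :\ r) x <= dg (W :\ r) x.
  by apply: dg_sub; apply: setSD; apply: subset_trans sW; apply: subsetUr.
rewrite dg_all ?subD1set //; have := cardsD1 r (nb x); rewrite -dgT dx.
by case: (r \in nb x); slia.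
Qed.

(** There are more than [n - k] vertices of degree 4 to choose from. *)
Lemma quartic_full_triple eps :
  (forall K, good H K -> exists a b c,
     [/\ a != b, a != c, b != c, ~: K = [set a; b; c] & weight 4 a b c = eps]) ->
  exists K a b c, [/\ good H K, [/\ a != b, a != c & b != c], ~: K = [set a; b; c],
    [/\ a \in full G 4, b \in full G 4 & c \in full G 4] & adj a b + adj a c + adj b c = eps].
Proof.
move=> qU.
have [|W WF cW] := @subset_of _ (full G 4) (#|G| - #|H| + 1).
  by have := many_full arr nexc k7 kn hD hiD hDk; slia.
have [w wW gw] := good_in arr k1 cW.
have [x [y [z [xy xz yz e q]]]] := qU _ gw.
have [xU yU zU] : [/\ x \in full G 4, y \in full G 4 & z \in full G 4].
  by split; have := congr1 (fun A : {set G} => [&& x \in A, y \in A & z \in A]) e;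
   rewrite setCK !in_setU !in_set1 !eqxx !orbT !in_setD1 => /and3P[/andP[_ xW] /andP[_ yW] /andP[_ zW]];
   apply: (subsetP WF).
exists (~: (W :\ w)), x, y, z; split=> //.
by rewrite -q /weight (fullP _ _ xU) (fullP _ _ yU) (fullP _ _ zU) !addn0.
Qed.

Variable eps : nat.
Hypothesis qU : forall K, good H K -> exists a b c,
     [/\ a != b, a != c, b != c, ~: K = [set a; b; c] & weight 4 a b c = eps].
Hypothesis q4 : forall a b c d, uniq [:: a; b; c; d] ->
     [\/ weight 4 a b c = eps, weight 4 a b d = eps, weight 4 a c d = eps | weight 4 b c d = eps].

Lemma quartic_eps_gt0 : 0 < eps.
Proof.
rewrite lt0n; apply/eqP=> e0.
have [K [a [b [c [gK _ e [aF bF cF] q]]]]] := quartic_full_triple qU.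
have [ab0 ac0 bc0] : [/\ adj a b = false, adj a c = false & adj b c = false].
  by move: q; rewrite e0; case: (adj a b); case: (adj a c); case: (adj b c).
apply: (no_independent_outside arr nexc k1 kn top gK); rewrite e.
  move=> u v; rewrite !in_setU !in_set1 => /orP[/orP[]|] /eqP-> /orP[/orP[]|] /eqP->;
  by rewrite ?adjxx // ?ab0 ?ac0 ?bc0 // adjC ?ab0 ?ac0 ?bc0.
by move=> u; rewrite !in_setU !in_set1 => /orP[/orP[]|] /eqP->; apply/fullP.
Qed.

(** A triple of weight 3 is a triangle of vertices of degree 4, each with two
    neighbours in the copy; such a vertex cannot replace a vertex of degree 3 or 4. *)
Lemma quartic_eps_lt3 : eps < 3.
Proof.
rewrite ltnNge; apply/negP=> e3.
have [K [a [b [c [gK [ab ac bc] e [/fullP da /fullP db /fullP dc] q]]]]] := quartic_full_triple qU.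
have [hab hac hbc] : [/\ adj a b, adj a c & adj b c].
  by move: q e3; case: (adj a b); case: (adj a c); case: (adj b c) => //= <-.
have [i3 d3] := has_dg arr nexc k7 kn hD hiD hDk (j := 3) isT ltac:(slia) isT.
have [g [gI Ke ga gd]] := good_fun gK.
have gin l : g l \in K by rewrite Ke imset_f ?inE.
have [||u uK gu] := exchange_one arr k1 _ gK (gin iD) (gin i3); first by slia.
  by rewrite inj_eq //; apply/eqP=> e'; move: hiD; rewrite e' d3.
have uU : u \in [set a; b; c] by rewrite -e inE.
have du : dg K u = 2.
  have := dg_compl K u; rewrite e dg3 //.
  move: uU; rewrite !in_setU !in_set1 => /orP[/orP[]|] /eqP->;
  by rewrite ?da ?db ?dc ?adjxx ?hab ?hac ?hbc ?(adjC b a) ?(adjC c a) ?(adjC c b) ?hab ?hac ?hbc; slia.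
case: gu => gu; have := replace_dg gK uK (gin _) gu; rewrite gd ?hiD ?d3 du; slia.
Qed.

(** Weight 1 excludes 4-cycles and leaves room for at most one vertex of degree
    3; parity makes [G] regular. Vertices of degrees 1 and 2 in a copy have 3 and 2
    neighbours among the vertices left out, two of them in common. *)
Lemma quartic_eps_neq1 : eps != 1.
Proof.
apply/eqP=> e1.
have common t w a b : t != w -> a != b -> adj t a -> adj t b -> adj w a -> adj w b -> False.
  move=> tw ab ta tb wa wb; have := @q4 t w a b.
  rewrite /= !inE !negb_or tw ab (adj_neq ta) (adj_neq tb) (adj_neq wa) (adj_neq wb) => /(_ isT).
  by rewrite e1 /weight ta tb wa wb; case; slia.
have [x [_ [/fullP dx _ _ _]]] := full_not_clique arr nexc k7 kn hD hiD hDk.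
have one z z' : dg setT z < 4 -> dg setT z' < 4 -> z = z'.
  move=> dz dz'; apply: contraTeq isT => zz'.
  have [a xa az] : exists2 a, adj x a & a \notin [set z; z'].
    have /card_gt0P[a] : 0 < #|nb x :\: [set z; z']|.
      have := cardsID [set z; z'] (nb x); have := subset_leq_card (subsetIr (nb x) [set z; z']).
      by rewrite -dgT dx cards2 zz'; slia.
    by rewrite in_setD => /andP[az]; rewrite [in X in X -> _]inE => xa; exists a.
  move: az; rewrite !inE negb_or => /andP[az az'].
  have xz : x != z by apply: contraTneq dz => <-; rewrite dx.
  have xz' : x != z' by apply: contraTneq dz' => <-; rewrite dx.
  have := @q4 z z' x a.
  rewrite /= !inE !negb_or zz' !(eq_sym z) !(eq_sym z') xz xz' az az' (adj_neq xa) => /(_ isT).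
  by rewrite e1 /weight xa; case; slia.
have ge3 v : 3 <= dg setT v.
  have [K gK vK] := movable arr v k3 kn2 nexc.
  have [a [b [c [ab ac bc e q]]]] := qU gK.
  have : v \in [set a; b; c] by rewrite -e inE.
  by move: q; rewrite e1 /weight !inE => q /orP[/orP[]|] /eqP->; slia.
have reg v : dg setT v = 4.
  have := top v; have := ge3 v; rewrite leq_eqVlt => /predU1P[dv _|]; last by slia.
  have d4 u : u != v -> dg setT u = 4.
    move=> uv; have := top u; rewrite leq_eqVlt => /predU1P[//|du].
    by rewrite (one u v) ?eqxx -?dv in uv.
  have := ee_even [set: G]; rewrite /ee (bigD1 v) //= -dv.
  rewrite (eq_bigr (fun _ => 4)); last by move=> u /andP[_ /d4].
  by rewrite sum_nat_const oddD oddM andbF.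
have xF : x \in full G 4 by apply/fullP.
have [K gK [xK dK]] := full_dg arr k7 kn hiD hDk xF (j := 1) isT ltac:(slia) isT.
have [i2 d2] := has_dg arr nexc k7 kn hD hiD hDk (j := 2) isT ltac:(slia) isT.
have [t tK dt] := good_dg' gK i2; rewrite d2 in dt.
have [a [b [c [ab ac bc e _]]]] := qU gK.
have xt : x != t by apply: contra_eq_neq dK => ->; rewrite dt.
have := dg_compl K x; have := dg_compl K t; rewrite !reg dt dK e !dg3 //.
case xa: (adj x a); case xb: (adj x b); case xc: (adj x c) => //= + _.
case ta: (adj t a); case tb: (adj t b); case tc: (adj t c) => //= _.
- exact: (common x t a b).
- exact: (common x t a c).
- exact: (common x t b c).
Qed.

(** If a copy had two vertices of degree 4, every vertex left out would have
    three neighbours inside, and the triple only one edge. So there is one such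
    vertex, and [wide_pair] limits the common neighbours of adjacent vertices of
    degree 4. At most three vertices of [G] have smaller degree, because each of
    them adds to the weight of a triple; hence at least seven have degree 4. At
    most one of those is adjacent to neither end of an edge between two others.
    A triangle among them would leave room for six only. Without a triangle, each
    has at most three neighbours of degree 4, so there are exactly seven, and
    they induce a cubic graph, against parity. *)
Lemma quartic_eps_neq2 : eps != 2.
Proof.
apply/eqP=> e2; have n3 := quartic_excess3.
have [K0 [c0 [c1 [c2 [gK0 [c01 c02 c12] eU [F0 F1 F2] q0]]]]] := quartic_full_triple qU.
have lone (i j : H) : dg setT i = 4 -> dg setT j = 4 -> i = j.
  move=> di dj; apply: contraTeq isT => ij; exfalso.
  have [g [gI Ke ga gd]] := good_fun gK0.
  have gin l : g l \in K0 by rewrite Ke imset_f ?inE.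
  have ge3 b : b \notin K0 -> 3 <= dg K0 b.
    move=> bK; have [|l e] := swap_dg arr k1 gK0 bK (gin i) (gin j); first by rewrite inj_eq.
    move: e; rewrite !gd ga di dj (full_clique arr nexc k7 kn hD hiD hDk ij di dj).
    rewrite !(adjC b) !(full_out arr k7 kn hD hiD hDk (K := K0)) ?gd //.
    by have := hD l; slia.
  have le1 b : b \in [set c0; c1; c2] -> dg [set c0; c1; c2] b <= 1.
    by rewrite -eU inE => /ge3; have := dg_compl K0 b; have := top b; slia.
  have := le1 c0; have := le1 c1; have := le1 c2.
  rewrite !inE !eqxx !orbT !dg3 // !adjxx (adjC c1 c0) (adjC c2 c0) (adjC c2 c1).
  by move=> /(_ isT) h1 /(_ isT) h2 /(_ isT) h3; slia.
have wide x y : x \in full G 4 -> y \in full G 4 -> adj x y -> #|H| + #|cn x :&: cn y| <= 10.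
  move=> xF yF xy; have := wide_pair arr nexc k7 kn hD hiD hDk xF yF (adj_neq xy) (or_intror lone).
  have := cardsUI (cn x) (cn y); rewrite !card_cn (fullP _ _ xF) (fullP _ _ yF); slia.
have fewO : #|~: full G 4| <= 3.
  rewrite leqNgt; apply/negP=> lt.
  have [B sB cB] := subset_of lt.
  have [b bB] : exists b, b \in B by apply/card_gt0P; rewrite cB.
  have [a [c [d [ac ad cd e]]]] : exists p q r, [/\ p != q, p != r, q != r & B :\ b = [set p; q; r]].
    by apply: cards3; have := cardsD1 b B; rewrite bB cB; slia.
  have defO v : v \in B -> dg setT v < 4.
    by move=> /(subsetP sB); rewrite !inE => dv; rewrite ltn_neqAle dv top.
  have inB v : v \in [set a; c; d] -> v != b /\ dg setT v < 4.
    by rewrite -e in_setD1 => /andP[vb vB]; split=> //; apply: defO.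
  have [ab da] := inB a ltac:(by rewrite !inE eqxx).
  have [cb dc] := inB c ltac:(by rewrite !inE eqxx orbT).
  have [db dd] := inB d ltac:(by rewrite !inE eqxx orbT).
  have := defO b bB => dbb.
  have := @q4 a c d b; rewrite /= !inE !negb_or ac ad ab cd cb db => /(_ isT).
  by rewrite e2 /weight; case; slia.
have cF : #|full G 4| + #|~: full G 4| = #|G| := card_compl _.
have R1 x y : x \in full G 4 -> y \in full G 4 -> adj x y -> #|full G 4 :\: (cn x :|: cn y)| <= 1.
  move=> xF yF xy; rewrite leqNgt; apply/negP=> /card_gt1P[u [v []]].
  rewrite !in_setD => /andP[uN uF] /andP[vN vF] uv.
  move: uN vN; rewrite !inE !negb_or => /andP[/andP[ux nxu] /andP[uy nyu]] /andP[/andP[vx nxv] /andP[vy nyv]].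
  have := @q4 x y u v; rewrite /= !inE !negb_or (adj_neq xy) uv !(eq_sym x) !(eq_sym y) ux uy vx vy.
  move=> /(_ isT); rewrite e2 /weight (fullP _ _ xF) (fullP _ _ yF) (fullP _ _ uF) (fullP _ _ vF) xy.
  by rewrite (negbTE nxu) (negbTE nyu) (negbTE nxv) (negbTE nyv); case; slia.
have [x [y [xF yF xy]]] : exists x y, [/\ x \in full G 4, y \in full G 4 & adj x y].
  case h01: (adj c0 c1); first by exists c0, c1.
  case h02: (adj c0 c2); first by exists c0, c2.
  by move: q0; rewrite h01 h02 e2; case: (adj c1 c2).
have [[[u v] w]|noT] := pickP (fun p : G * G * G => [&& p.1.1 \in full G 4, p.1.2 \in full G 4,
    p.2 \in full G 4, adj p.1.1 p.1.2, adj p.1.1 p.2 & adj p.1.2 p.2]).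
  move=> /= /and5P[uF vF wF uv /andP[uw vw]].
  have two a b c d : a \in full G 4 -> b \in full G 4 -> adj a b -> c != d ->
      adj a c -> adj b c -> adj a d -> adj b d -> False.
    move=> aF bF ab cd ac bc ad bd; have := wide a b aF bF ab.
    suff : 4 <= #|cn a :&: cn b| by slia.
    have <- : #|[set a; b; c; d]| = 4.
      by apply: cards4; rewrite /= !inE !negb_or cd (adj_neq ab) (adj_neq ac) (adj_neq ad) (adj_neq bc) (adj_neq bd).
    apply: subset_leq_card; apply/subsetP=> z; rewrite !in_setU !in_set1.
    by case/orP=> [/orP[/orP[]|]|] /eqP->; rewrite !inE ?eqxx ?ab 1?(adjC b a) ?ab ?ac ?bc ?ad ?bd ?orbT.
  have sub : full G 4 \subset [set u; v; w] :|: ((full G 4 :\: (cn u :|: cn v)) :|: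
      ((full G 4 :\: (cn u :|: cn w)) :|: (full G 4 :\: (cn v :|: cn w)))).
    apply/subsetP=> z zF; rewrite !in_setU !in_set1 !in_setD zF !inE !andbT.
    have [zu|zu] := eqVneq z u; first by [].
    have [zv|zv] := eqVneq z v; first by rewrite orbT.
    have [zw|zw] := eqVneq z w; first by rewrite orbT.
    case uz: (adj u z); case vz: (adj v z); case wz: (adj w z) => //=; exfalso.
    - by apply: (two u v w z) => //; rewrite eq_sym.
    - by apply: (two u v w z) => //; rewrite eq_sym.
    - by apply: (two u w v z); rewrite // 1?eq_sym // adjC.
    - by apply: (two v w u z); rewrite // 1?eq_sym // adjC.
  have := subset_leq_card sub; have := R1 u v uF vF uv; have := R1 u w uF wF uw; have := R1 v w vF wF vw.
  have := card3_le u v w.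
  by move=> h1 h2 h3 h4 /leq_trans/(_ (card4U _ _ _ _)) h5; slia.
have degF a : a \in full G 4 -> #|full G 4 :&: nb a| <= 3.
  move=> aF; rewrite leqNgt; apply/negP=> lt.
  have [B sB cB] := subset_of lt.
  have [b bB] : exists b, b \in B by apply/card_gt0P; rewrite cB.
  have [c [d [f [cd cf df e]]]] : exists p q r, [/\ p != q, p != r, q != r & B :\ b = [set p; q; r]].
    by apply: cards3; have := cardsD1 b B; rewrite bB cB; slia.
  have inB z : z \in B -> dg setT z = 4 /\ adj a z.
    by move=> /(subsetP sB); rewrite !inE => /andP[/eqP].
  have inB' z : z \in [set c; d; f] -> z != b /\ z \in B by rewrite -e in_setD1 => /andP[].
  have [cb cB'] := inB' c ltac:(by rewrite !inE eqxx).
  have [db dB] := inB' d ltac:(by rewrite !inE eqxx orbT).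
  have [fb fB] := inB' f ltac:(by rewrite !inE eqxx orbT).
  have ind z z' : z \in B -> z' \in B -> adj z z' = false.
    move=> zB z'B; have [dz az] := inB z zB; have [dz' az'] := inB z' z'B.
    by have := noT (a, z, z'); rewrite /= aF az az' !inE dz dz' eqxx.
  have := @q4 c d f b; rewrite /= !inE !negb_or cd cf cb df db fb => /(_ isT).
  rewrite e2 /weight !ind // (inB c cB').1 (inB d dB).1 (inB f fB).1 (inB b bB).1.
  by case.
have p7 : #|full G 4| <= 7.
  have := R1 x y xF yF xy; have := cardsID (cn x :|: cn y) (full G 4).
  have : #|full G 4 :&: (cn x :|: cn y)| <= #|full G 4 :&: nb x| + #|full G 4 :&: nb y|.
    rewrite (leq_trans _ (leq_card_setU _ _).1) //; apply: subset_leq_card; apply/subsetP=> z.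
    rewrite !in_setU !in_setI !in_setU !in_set1 => /andP[->] /=.
    by case/orP=> /predU1P[->|->]; rewrite ?orbT // !inE ?(adjC y x) xy ?orbT.
  by have := degF x xF; have := degF y yF; slia.
have cO : #|~: full G 4| = 3 by slia.
have [z1 [z2 [z3 [z12 z13 z23 eO]]]] := cards3 cO.
have defO v : v \in [set z1; z2; z3] -> dg setT v < 4.
  by rewrite -eO !inE => dv; rewrite ltn_neqAle dv top.
have d1 := defO z1 ltac:(by rewrite !inE eqxx).
have d2 := defO z2 ltac:(by rewrite !inE eqxx orbT).
have d3 := defO z3 ltac:(by rewrite !inE eqxx orbT).
have regF a : a \in full G 4 -> dg (full G 4) a = 3.
  move=> aF; apply/eqP; rewrite eqn_leq; apply/andP; split.
    rewrite dgE; apply: leq_trans (degF a aF); apply: subset_leq_card; apply/subsetP=> z.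
    by rewrite !inE.
  have := dg_compl (full G 4) a; rewrite (fullP _ _ aF) eO dg3 // => eq4.
  have naO : a \notin [set z1; z2; z3] by rewrite -eO inE negbK.
  move: naO; rewrite !inE !negb_or => /andP[/andP[a1 a2] a3].
  have := @q4 z1 z2 z3 a; rewrite /= !inE !negb_or z12 z13 z23 !(eq_sym _ a) a1 a2 a3 => /(_ isT).
  rewrite e2 /weight (fullP _ _ aF) !(adjC _ a); case=> q; slia.
have := ee_even (full G 4); rewrite /ee (eq_bigr (fun _ => 3)) // sum_nat_const.
by have -> : #|full G 4| = 7 by slia.
Qed.
End Quartic.

(** If some degree of [H] exceeds [k - 3], then by [no_wide_degrees] no degree is
    below 2, and the complement has all degrees at most [k - 3]. *)
Lemma large_order G H : arrows G H -> ~ exc H -> 6 < #|H| -> #|H| + 3 <= #|G| -> False.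
Proof.
move=> + + + +; wlog: G H / (forall i : H, dg setT i + 3 <= #|H|).
  move=> wl arr nexc k7 kn; have nexc' : ~ exc (compl H) by move/exc_compl.
  case: (boolP [forall i : H, dg setT i + 3 <= #|H|]) => [/forallP h|]; first exact: (wl G H).
  case/forallPn=> i; rewrite -ltnNge => hi.
  case: (boolP [exists i : H, dg setT i <= 1]) => [/existsP[j hj]|/existsPn h].
    by apply: (no_wide_degrees arr nexc k7); [slia|exists i; slia|exists j].
  apply: (wl (compl G) (compl H) _ (arrows_compl arr)) => // j.
  by have := @codeg H j; have := h j; cosimp; rewrite -ltnNge; slia.
move=> low arr nexc k7 kn.
have [iD hD] := max_dg (H := H) ltac:(slia); move D_ : (dg setT iD) hD => D hD.
have hDk : D + 3 <= #|H| by rewrite -D_.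
have D4 := max_degree_le4 arr nexc k7 kn hD D_ hDk.
have k2 := order_le arr nexc k7 kn hD D_ hDk.
have /orP[/eqP e|/eqP e] : (D == 3) || (D == 4) by slia.
  subst D; case: (pickP (fun p : H * H => [&& p.1 != p.2, dg setT p.1 == 3 & dg setT p.2 == 3])).
    move=> [i j] /= /and3P[ij /eqP di /eqP dj].
    by rewrite e in hD; exact: (subcubic_false arr nexc k7 kn hD e ij di dj).
  move=> no; rewrite e in hD; apply: (subcubic_lone arr nexc k7 kn hD e) => i j di dj.
  by have := no (i, j); rewrite /= di dj !andbT => /negbFE/eqP.
rewrite e in hD D_ hDk.
have top := top_exact arr k7 kn hD D_ hDk.
have n3 := quartic_excess3 arr nexc k7 kn hD D_ hDk.
have [eps [qU q4]] := weight_const arr ltac:(slia) n3 top.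
have := quartic_eps_gt0 arr nexc k7 kn hD D_ hDk qU.
have := quartic_eps_lt3 arr nexc k7 kn hD D_ hDk qU.
have /eqP := quartic_eps_neq1 arr nexc k7 kn hD D_ hDk qU q4.
have /eqP := quartic_eps_neq2 arr nexc k7 kn hD D_ hDk qU q4.
slia.
Qed.

(** * Orders 5 and 6: the search *)

Fixpoint bits n : seq bitseq :=
  if n is m.+1 then [seq false :: s | s <- bits m] ++ [seq true :: s | s <- bits m] else [:: [::]].

Fixpoint masks n j : seq bitseq :=
  if n is m.+1 then [seq false :: s | s <- masks m j] ++
    (if j is i.+1 then [seq true :: s | s <- masks m i] else [::])
  else if j is 0 then [:: [::]] else [::].

(** A graph on a list of vertices is encoded by one row for each vertex, with its
    adjacency to the later vertices. Thus prepending a vertex prepends a row. *)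
Fixpoint codes n : seq (seq bitseq) :=
  if n is m.+1 then [seq r :: c | c <- codes m, r <- bits m] else [:: [::]].

Fixpoint subcode (m : bitseq) (c : seq bitseq) : seq bitseq :=
  match m, c with
  | b :: m', r :: c' => if b then mask m' r :: subcode m' c' else subcode m' c'
  | _, _ => [::]
  end.

Fixpoint addbits (r : bitseq) (ds : seq nat) : seq nat :=
  match r, ds with
  | b :: r', d :: ds' => (if b then d.+1 else d) :: addbits r' ds'
  | _, _ => [::]
  end.

Fixpoint degs (c : seq bitseq) : seq nat :=
  if c is r :: c' then count id r :: addbits r (degs c') else [::].

(** By [extend] any [k - 1] vertices of [G] induce a vertex-deleted subgraph of
    [H]. Comparing sorted degree sequences is a cheap necessary condition. *)
Definition cards (c : seq bitseq) : seq (seq nat) :=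
  [seq sort leq (degs (subcode m c)) | m <- masks (size c) (size c).-1].

(** Boolean connectives are functions, which the evaluation used here applies
    only to evaluated arguments; nested conditionals stop the search early. *)
Fixpoint lall (T : Type) (p : T -> bool) s := if s is x :: s' then if p x then lall p s' else false else true.
Fixpoint lhas (T : Type) (p : T -> bool) s := if s is x :: s' then if p x then true else lhas p s' else false.

Definition admissible (ds : seq (seq nat)) (ms : seq bitseq) (c : seq bitseq) :=
  lall (fun m => sort leq (degs (subcode (true :: m) c)) \in ds) ms.

(** Whether [s] vertices can be added one by one to the encoded graph such that
    any [k - 1] vertices including the newest have an admissible degree sequence.
    A copy of [H] in an arrowing graph of order at least [k + s] passes this test. *)
Fixpoint grows (k : nat) (ds : seq (seq nat)) (s : nat) (c : seq bitseq) : bool :=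
  if s is s'.+1 then
    let ms := masks (size c) (k - 2) in
    lhas (fun r => if admissible ds ms (r :: c) then grows k ds s' (r :: c) else false) (bits (size c))
  else true.

Definition adjc (c : seq bitseq) i j : bool :=
  if i < j then nth false (nth [::] c i) (j - i.+1)
  else if j < i then nth false (nth [::] c j) (i - j.+1) else false.

Definition pairs_of n := [seq (i, j) | j <- iota 0 n, i <- iota 0 j].

Definition pairwise_meeting (es : seq (nat * nat)) :=
  all (fun e => all (fun e' => [|| e.1 == e'.1, e.1 == e'.2, e.2 == e'.1 | e.2 == e'.2]) es) es.

(** Disjoint unions of cliques with at most three vertices, one of them a
    triangle. *)
Definition clustered (c : seq bitseq) :=
  all (fun d => d <= 2) (degs c) && (2 \in degs c) &&
  all (fun i => all (fun j => all (fun l => [&& adjc c i j, adjc c j l & i != l] ==> adjc c i l)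
   (iota 0 (size c))) (iota 0 (size c))) (iota 0 (size c)).

(** It suffices to treat graphs with at most half of all possible edges, listed
    by decreasing degree. Besides the graphs in which all edges, or all non-edges,
    meet pairwise, only [K1 + K2 + K3] survives, where the degree sequences do not
    decide; [clustered_exc] does. *)
Definition verdict k c :=
  let ds := degs c in
  if (2 * sumn ds <= k * k - k) && sorted geq ds then
    let ps := pairs_of k in
    if pairwise_meeting [seq p <- ps | adjc c p.1 p.2] then true else
    if pairwise_meeting [seq p <- ps | ~~ adjc c p.1 p.2] then true else
    if grows k (undup (cards c)) 3 c then clustered c && (k == 6) else true
  else true.

Lemma verdict5 : all (verdict 5) (codes 5).
Proof. by vm_compute. Qed.
Lemma verdict6 : all (verdict 6) (codes 6).
Proof. by vm_compute. Qed.

(** * Orders 5 and 6: from the search to arbitrary graphs *)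

Lemma lallE (T : Type) (p : T -> bool) s : lall p s = all p s.
Proof. by elim: s => //= x s ->; case: (p x). Qed.

Lemma lhasE (T : Type) (p : T -> bool) s : lhas p s = has p s.
Proof. by elim: s => //= x s ->; case: (p x). Qed.

Lemma mem_bits n s : (s \in bits n) = (size s == n).
Proof.
elim: n s => [|n IH] [|b s] //=; rewrite ?mem_cat.
  by apply/negP=> /orP[] /mapP[].
rewrite eqSS -IH; apply/orP/idP => [[] /mapP[s' h [_ ->]]//|h].
by case: b; [right|left]; apply: map_f.
Qed.

Lemma mem_masks n j m : (m \in masks n j) = (size m == n) && (count id m == j).
Proof.
elim: n j m => [|n IH] [|j] [|b m] //=; rewrite ?cats0 ?mem_cat.
- by apply/negP=> /mapP[].
- rewrite eqSS; apply/mapP/idP => [[s' h [-> ->]]|].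
    by move: h; rewrite IH.
  by case: b => //=; rewrite ?andbF // => h; exists m; rewrite // IH.
- by apply/negP=> /orP[] /mapP[].
rewrite eqSS; apply/orP/idP => [[] /mapP[s' h [-> ->]]|].
- by move: h; rewrite IH.
- by move: h; rewrite IH.
by case: b => /=; rewrite ?add1n ?eqSS ?add0n => h; [right|left]; rewrite map_f // IH.
Qed.

Section Code.
Variable G : sgraph.
Implicit Types (t : seq G) (v : G).

Fixpoint code t : seq bitseq := if t is v :: t' then [seq adj v u | u <- t'] :: code t' else [::].

Lemma size_code t : size (code t) = size t.
Proof. by elim: t => //= v t ->. Qed.

Lemma addbits_map (T : Type) (p : T -> bool) (F : T -> nat) s :
  addbits [seq p u | u <- s] [seq F u | u <- s] = [seq p u + F u | u <- s].
Proof. by elim: s => //= u s ->; case: (p u). Qed.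

Lemma degs_code t : degs (code t) = [seq count (adj v) t | v <- t].
Proof.
elim: t => //= v t ->; rewrite adjxx add0n count_map addbits_map.
congr (_ :: _); last by apply: eq_map => u; rewrite adjC.

Qed.

Lemma subcode_code m t : subcode m (code t) = code (mask m t).
Proof.
elim: m t => [|b m IH] [|v t] //=.
by rewrite IH; case: b => //=; rewrite map_mask.
Qed.

Lemma code_codes t : code t \in codes (size t).
Proof.
elim: t => //= v t IH; apply/allpairsP; exists (code t, [seq adj v u | u <- t]).
by rewrite /= IH mem_bits size_map eqxx.
Qed.

Lemma adjc_lt x t i j : i < j -> j < size t -> adjc (code t) i j = adj (nth x t i) (nth x t j).
Proof.
move=> ij jt; rewrite /adjc ij; elim: t i j ij jt => // v t IH [|i] [|j] //= ij jt.
  by rewrite subSS subn0 (nth_map x).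
by rewrite subSS IH.
Qed.

Lemma adjcE x t i j : i < size t -> j < size t -> adjc (code t) i j = adj (nth x t i) (nth x t j).
Proof.
move=> it jt; have [ij|ji|->] := ltngtP i j; first exact: adjc_lt.
  rewrite adjC -(adjc_lt x ji it) /adjc ji.
  by rewrite ltnNge (ltnW ji).
by rewrite /adjc ltnn adjxx.
Qed.

Lemma degs_perm t t' : perm_eq t t' -> sort leq (degs (code t)) = sort leq (degs (code t')).
Proof.
move=> p; apply/perm_sortP; [exact: leq_total|exact: leq_trans|exact: anti_leq|].
rewrite !degs_code.
have -> : [seq count (adj v) t | v <- t] = [seq count (adj v) t' | v <- t].
  by apply: eq_map => v; apply/seq.permP.
exact: perm_map.
Qed.

Lemma count_adj t v : uniq t -> count (adj v) t = dg [set x in t] v.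
Proof.
move=> un; rewrite dgE -size_filter -(card_uniqP (filter_uniq _ un)) -cardsE.
by apply: eq_card => x; rewrite !inE mem_filter andbC.
Qed.
End Code.

Lemma code_map (G H : sgraph) (g : H -> G) (s : seq H) :
  (forall i j, adj (g i) (g j) = adj i j) -> code [seq g i | i <- s] = code s.
Proof.
move=> ga; elim: s => //= i s ->; congr (_ :: _).
by rewrite -map_comp; apply: eq_map => j /=; rewrite ga.
Qed.

Section Search.
Variables (G H : sgraph).
Hypothesis arr : arrows G H.
Hypothesis k1 : 1 < #|H|.
Variable h0 : seq H.
Hypothesis h0u : uniq h0.
Hypothesis h0a : forall i, i \in h0.

Let sh0 : size h0 = #|H|.
Proof. by rewrite -(card_uniqP h0u); apply: eq_card => i; rewrite h0a. Qed.

Lemma card_in_cards (T : seq G) : uniq T -> size T = #|H|.-1 ->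
  sort leq (degs (code T)) \in cards (code h0).
Proof.
move=> uT sT; have [|z zT gz] := extend arr (T := [set x in T]) k1.
  by rewrite cardsE (card_uniqP uT) sT.
have [g [gI Ke ga]] := (goodP H _).1 gz.
have /imsetP[i _ ei] : z \in [set g i | i in [set: H]] by rewrite -Ke setU11.
have p : perm_eq T [seq g j | j <- filter (predC1 i) h0].
  apply: uniq_perm => //; first by rewrite map_inj_uniq // filter_uniq.
  move=> x; apply/idP/mapP.
    move=> xT; have : x \in z |: [set x in T] by rewrite !inE xT orbT.
    rewrite Ke => /imsetP[j _ ej]; exists j => //; rewrite mem_filter h0a andbT /=.
    by apply: contraNneq zT => e; rewrite inE ei -e -ej.
  case=> j; rewrite mem_filter /= => /andP[ji _] ej.
  have : x \in z |: [set x in T] by rewrite Ke ej imset_f ?inE.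
  by rewrite !inE ej ei (inj_eq gI) (negbTE ji).
rewrite (degs_perm p) code_map // filter_mask.
apply/mapP; exists [seq predC1 i j | j <- h0]; last by rewrite subcode_code.
rewrite mem_masks size_code size_map eqxx count_map /=.
rewrite (eq_count (a2 := predC (pred1 i))) //.
have := count_predC (pred1 i) h0; rewrite (count_uniq_mem i h0u) h0a sh0; slia.
Qed.

Lemma grows_code s (t : seq G) : uniq t -> size t + s <= #|G| ->
  grows #|H| (undup (cards (code h0))) s (code t).
Proof.
elim: s t => //= s IH t ut st; rewrite lhasE.
have /card_gt0P[b] : 0 < #|~: [set x in t]|.
  by have := card_compl [set x in t]; rewrite cardsE (card_uniqP ut); slia.
rewrite !inE => bt; apply/hasP; exists [seq adj b u | u <- t].
  by rewrite mem_bits size_map size_code.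
have -> : admissible (undup (cards (code h0))) (masks (size (code t)) (#|H| - 2))
     ([seq adj b u | u <- t] :: code t); last first.
  by rewrite -/(code (b :: t)) IH /= ?bt // addSnnS.
rewrite /admissible lallE; apply/allP => m; rewrite mem_masks size_code => /andP[/eqP sm /eqP cm].
rewrite mem_undup -/(code (b :: t)) subcode_code; apply: (@card_in_cards (b :: mask m t)).
  by rewrite /= mask_uniq // andbT; apply: contra bt; apply: mem_mask.
by rewrite /= size_mask // cm; slia.
Qed.

Lemma pairwise_meeting_edges (x0 : H) (es : seq (nat * nat)) (e : rel H) : symmetric e -> irreflexive e ->
  (forall i j, i < j -> j < #|H| -> e (nth x0 h0 i) (nth x0 h0 j) -> (i, j) \in es) ->
  pairwise_meeting es -> forall a b c d, e a b -> e c d -> [|| a == c, a == d, b == c | b == d].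
Proof.
move=> es_sym eirr esP no a b c d ab cd.
have key a' b' : e a' b' -> exists p, p \in es /\
    ((a', b') = (nth x0 h0 p.1, nth x0 h0 p.2) \/ (b', a') = (nth x0 h0 p.1, nth x0 h0 p.2)).
  move=> eab; have ia : index a' h0 < #|H| by rewrite -sh0 index_mem h0a.
  have ib : index b' h0 < #|H| by rewrite -sh0 index_mem h0a.
  have [ij|ji|eq] := ltngtP (index a' h0) (index b' h0).
  - exists (index a' h0, index b' h0); split; last by left; rewrite /= !nth_index.
    by apply: esP => //; rewrite !nth_index.
  - exists (index b' h0, index a' h0); split; last by right; rewrite /= !nth_index.
    by apply: esP => //; rewrite !nth_index // es_sym.
  by have := eirr a'; rewrite -{2}(nth_index x0 (h0a a')) eq nth_index // eab.
have [p [pes pe]] := key a b ab; have [q [qes qe]] := key c d cd.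
move/allP/(_ p pes)/allP/(_ q qes): no.
by case: pe => -[-> ->]; case: qe => -[-> ->];
  case/or4P=> /eqP->; rewrite eqxx ?orbT.
Qed.
End Search.

Lemma embed_small (G H : sgraph) (A : {set G}) : arrows G H -> 1 < #|H| -> #|A| < #|H| ->
  exists (K : {set G}) (g : H -> G), [/\ A \subset K, good H K, injective g,
    forall x, x \in A -> exists i, x = g i & forall i j, adj (g i) (g j) = adj i j].
Proof.
move=> arr k1 cA; have [K AK gK] := extend_sub arr k1 cA.
have [g [gI Ke ga]] := (goodP H _).1 gK; exists K, g; split=> // x /(subsetP AK).
by rewrite Ke => /imsetP[i _ ->]; exists i.
Qed.

(** Two disjoint edges of [G] span four vertices, which lie in a good set. *)
Lemma nomatching_of_small (G H : sgraph) : arrows G H -> 4 < #|H| -> #|H| + 2 <= #|G| ->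
  (forall a b c d : H, adj a b -> adj c d -> [|| a == c, a == d, b == c | b == d]) -> exc H.
Proof.
move=> arr k4 kn no; apply: (nomatching_exc arr) => // [|a b c d ab cd]; first by slia.
apply: contraT; rewrite !negb_or => /and4P[ac ad bc bd].
have [||K [g [_ _ gI gP ga]]] := @embed_small _ _ [set a; b; c; d] arr; first by slia.
  by rewrite (leq_trans _ k4) // ltnS !cardsU !cards1; slia.
have [i ei] := gP a ltac:(by rewrite !inE eqxx).
have [j ej] := gP b ltac:(by rewrite !inE eqxx ?orbT).
have [l el] := gP c ltac:(by rewrite !inE eqxx ?orbT).
have [m em] := gP d ltac:(by rewrite !inE eqxx ?orbT).
subst; rewrite !ga in ab cd; rewrite !(inj_eq gI) in ac ad bc bd.
by have := no _ _ _ _ ab cd; rewrite (negbTE ac) (negbTE ad) (negbTE bc) (negbTE bd).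
Qed.

Lemma cn_trans (G : sgraph) :
  (forall x y z : G, adj x y -> adj y z -> x != z -> adj x z) ->
  forall x y : G, y \in cn x -> cn y = cn x.
Proof.
move=> tr x y; rewrite !inE => /predU1P[->//|xy]; apply/setP=> z; rewrite !inE.
have [->|zy] := eqVneq z y; first by rewrite xy orbT.
have [->|zx] := eqVneq z x; first by rewrite adjC xy.
by apply/idP/idP => h; [apply: (tr _ y)|apply: (tr _ x)]; rewrite // 1?eq_sym // adjC.
Qed.

(** When adjacency is transitive, the closed neighbourhoods partition the
    vertices; one pair is chosen in each. *)
Lemma cluster_pairs (G : sgraph) (A : {set G}) c : 1 < c ->
  (forall x y z : G, adj x y -> adj y z -> x != z -> adj x z) ->
  (forall x, x \in A -> c <= #|cn x| /\ cn x \subset A) ->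
  exists ps : seq (G * G), c * size ps <= #|A| /\
    forall x, x \in A -> exists p, [/\ p \in ps, p.1 != p.2, p.1 \in cn x & p.2 \in cn x].
Proof.
move=> c1 tr.
have cnE := cn_trans tr.
have [m] := ubnP #|A|; elim: m A => // m IH A cA cl.
have [->|/set0Pn[x xA]] := eqVneq A set0.
  by exists [::]; rewrite muln0; split=> // x; rewrite inE.
have [cx sx] := cl x xA.
have [||ps [sps pP]] := IH (A :\: cn x).
- by have := cardsID (cn x) A; rewrite (setIidPr sx); slia.
- move=> y; rewrite in_setD => /andP[ynx yA]; have [cy sy] := cl y yA; split=> //.
  apply/subsetP=> z zy; rewrite in_setD (subsetP sy) // andbT; apply: contra ynx => zx.
  by rewrite -(cnE _ _ zx) (cnE _ _ zy) !inE eqxx.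
have [y _ xy] := @dg_pos _ setT x ltac:(by rewrite card_cn in cx; slia).
exists ((x, y) :: ps); split.
  by have := cardsID (cn x) A; rewrite (setIidPr sx) /= mulnS; slia.
move=> z zA; case: (boolP (z \in cn x)) => zx.
  by exists (x, y); rewrite inE eqxx /= adj_neq // (cnE _ _ zx) !inE eqxx xy orbT; split.
have [|p [h1 h2 h3 h4]] := pP z; first by rewrite in_setD zx.
by exists p; rewrite inE h1 orbT.
Qed.

(** Adjacency is transitive and degrees are at most 2 in [G] as in [H]. So the
    vertices of degree 2 of [G] form triangles, at most [n / 3] of them. Since
    [n >= 9] this is at most [n - 6], and a good set can miss a vertex of each of
    them, although [H] contains a triangle. *)
Lemma clustered_exc (G H : sgraph) : arrows G H -> #|H| = 6 -> 9 <= #|G| ->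
  (forall i : H, dg setT i <= 2) -> (exists i : H, dg setT i = 2) ->
  (forall i j l : H, adj i j -> adj j l -> i != l -> adj i l) -> exc H.
Proof.
move=> arr k6 n9 d2 [i2 di2] tr.
have k1 : 1 < #|H| by rewrite k6.
have trG (x y z : G) : adj x y -> adj y z -> x != z -> adj x z.
  move=> xy yz xz.
  have [|K [g [_ _ gI gP ga]]] := @embed_small _ _ [set x; y; z] arr k1.
    by rewrite k6 (@leq_ltn_trans 3) // !cardsU !cards1; slia.
  have [i ei] := gP x ltac:(by rewrite !inE eqxx).
  have [j ej] := gP y ltac:(by rewrite !inE eqxx ?orbT).
  have [l el] := gP z ltac:(by rewrite !inE eqxx ?orbT).
  subst; rewrite !ga in xy yz *; rewrite !(inj_eq gI) in xz; exact: tr xy yz xz.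
have top v : dg [set: G] v <= 2.
  rewrite leqNgt; apply/negP=> dv.
  have [|B BN cB] := @subset_of _ (nb v) 3; first by rewrite -dgT.
  have vB : v \notin B by apply/negP=> /(subsetP BN); rewrite inE adjxx.
  have [|K sK gK] := extend_sub arr (A := v |: B) k1; first by rewrite cardsU1 vB cB k6.
  have vK : v \in K by apply: (subsetP sK); rewrite setU11.
  have [i e] := good_dg gK vK; have := d2 i; rewrite -e.
  have : dg B v <= dg K v; last by rewrite (dg_all BN) cB; slia.
  by apply: dg_sub; apply: subset_trans sK; apply: subsetUr.
pose F := [set v : G | dg setT v == 2].
exfalso; have [|ps [sps pP]] := @cluster_pairs _ F 3 isT trG.
  move=> x; rewrite inE => /eqP dx; split; first by rewrite card_cn dx.
  apply/subsetP=> z; rewrite !inE => /predU1P[->|xz]; first by rewrite dx.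
  have := card_cn z; rewrite (cn_trans trG (x := x)) ?inE ?xz ?orbT // card_cn dx.
  by case=> <-.
have [||K gK Kx] := avoid_pairs arr (ps := ps); first by rewrite k6.
  by have := subset_leq_card (subsetT F); rewrite cardsT k6; slia.
have [m mK dm] := good_dg' gK i2; rewrite di2 in dm.
have mT : dg setT m = 2 by have := dgT_ge K m; have := top m; slia.
have [p [pps p12 p1 p2]] := pP m ltac:(by rewrite inE mT).
have sub : cn m \subset K.
  apply/subsetP=> z; rewrite !inE => /predU1P[->//|mz]; apply: contraT => zK.
  have d0 : dg (~: K) m = 0 by have := dg_compl K m; slia.
  by have := dg0 d0 (y := z); rewrite mz inE zK => /(_ isT).
by apply: (Kx p pps p12); apply: (subsetP sub).
Qed.

Lemma small_order_half (G H : sgraph) : arrows G H -> (#|H| == 5) || (#|H| == 6) -> #|H| + 3 <= #|G| ->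
  2 * ee [set: H] <= #|H| * #|H| - #|H| -> exc H.
Proof.
move=> arr k56 kn half; have k1 : 1 < #|H| by case/orP: k56 => /eqP->.
have k4 : 4 < #|H| by case/orP: k56 => /eqP->.
pose h0 := sort (fun x y : H => dg setT y <= dg setT x) (enum H).
have ph0 : perm_eq h0 (enum H) by rewrite /h0; apply/seq.permPl; apply: perm_sort.
have h0u : uniq h0 by rewrite (perm_uniq ph0) enum_uniq.
have h0a i : i \in h0 by rewrite (perm_mem ph0) mem_enum.
have sh0 : size h0 = #|H| by rewrite (perm_size ph0) -cardE.
have dgh : degs (code h0) = [seq dg setT i | i <- h0].
  rewrite degs_code; apply: eq_map => i; rewrite count_adj //; congr (dg _ _).
  by apply/setP=> j; rewrite !inE h0a.
have vd : verdict #|H| (code h0).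
  have := code_codes h0; rewrite sh0.
  by case/orP: k56 => /eqP->; [move/(allP verdict5)|move/(allP verdict6)].
have sdg : sumn (degs (code h0)) = ee [set: H].
  rewrite dgh sumnE big_map (perm_big _ ph0) /= /ee big_enum /=.
  by apply: eq_bigl => i; rewrite !inE.
have srt : sorted geq (degs (code h0)).
  rewrite dgh sorted_map; apply: (@sort_sorted _ (fun x y : H => dg setT y <= dg setT x)).
  by move=> x y; apply: leq_total.
have [K [g [_ gK gI _ ga]]] := embed_small (A := set0) arr k1 ltac:(rewrite cards0; slia).
have gr : grows #|H| (undup (cards (code h0))) 3 (code h0).
  rewrite -{2}(code_map h0 ga); apply: (grows_code arr k1 h0u h0a).
    by rewrite map_inj_uniq.
  by rewrite size_map sh0.
have /card_gt0P[x0 _] : 0 < #|H| by slia.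
have mem_ps i j : i < j -> j < #|H| -> (i, j) \in pairs_of #|H|.
  by move=> ij jk; apply/allpairsPdep; exists j, i; rewrite !mem_iota.
move: vd; rewrite /verdict; cbv zeta; rewrite sdg half srt gr andbT.
case: ifP => [no _|_].
  apply: (nomatching_of_small arr k4); first by slia.
  apply: (pairwise_meeting_edges h0u h0a (x0 := x0) _ _ _ no); [exact: adj_sym|exact: adj_irr|].
  move=> i j ij jk; rewrite mem_filter mem_ps // (adjcE x0) ?sh0 ?andbT //.
  exact: ltn_trans jk.
case: ifP => [no _|_].
  apply: exc_compl; apply: (nomatching_of_small (arrows_compl arr) k4); first by rewrite /=; slia.
  apply: (pairwise_meeting_edges h0u h0a (x0 := x0) _ _ _ no); [exact: compl_sym|exact: compl_irr|].
  move=> i j ij jk; rewrite mem_filter mem_ps // (adjcE x0) ?sh0 ?andbT //.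
    by case/andP.
  exact: ltn_trans jk.
case/andP=> /andP[/andP[c1 c2] c3] /eqP k6.
have inh i : exists2 a, a < #|H| & nth x0 h0 a = i.
  by exists (index i h0); rewrite ?nth_index // -sh0 index_mem.
apply: (clustered_exc arr k6); first by slia.
- move=> i; move/allP: c1; apply; rewrite dgh; exact: map_f.
- by move: c2; rewrite dgh => /mapP[i _ e]; exists i.
move=> i j l; have [a ak <-] := inh i; have [b bk <-] := inh j; have [c ck <-] := inh l.
rewrite size_code sh0 in c3.
have := allP c3 a; rewrite mem_iota ak => /(_ isT)/allP/(_ b).
rewrite mem_iota bk => /(_ isT)/allP/(_ c); rewrite mem_iota ck => /(_ isT).
rewrite !(adjcE x0) ?sh0 // => /implyP h ab bc ac; apply: h; rewrite ab bc /=.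
by apply: contraNneq ac => ->.
Qed.

Lemma small_order (G H : sgraph) : arrows G H -> (#|H| == 5) || (#|H| == 6) -> #|H| + 3 <= #|G| -> exc H.
Proof.
move=> arr k56 kn.
have [half|half] := leqP (2 * ee [set: H]) (#|H| * #|H| - #|H|); first exact: (small_order_half arr k56 kn half).
apply: exc_compl; apply: (small_order_half (arrows_compl arr)) => //=.
have := ee_co (G := H) [set: H]; rewrite cardsT.
have k4 : 4 < #|H| by case/orP: k56 => /eqP e; slia.
have : #|H| <= #|H| * #|H| by rewrite leq_pmulr //; slia.
by cosimp; slia.
Qed.

(** * Orders at most 4, and the general bound *)

Lemma order_le3_exc (H : sgraph) : #|H| <= 3 -> exc H.
Proof.
move=> k3; have [h3|h3] := eqVneq #|H| 3.
  have [|a [b [c [ab ac bc e]]]] := @cards3 H setT; first by rewrite cardsT.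
  have inH x : [|| x == a, x == b | x == c].
    by have := in_setT x; rewrite e !inE -orbA.
  have pick (p q r : H) : p != q -> p != r -> (forall x, [|| x == p, x == q | x == r]) ->
      adj p q = adj p r -> exc H.
    move=> pq pr all e2; apply: (@homog_exc _ p (adj q r) (adj p q)) => [x xp|x y xp yp xy].
      by have := all x; rewrite (negbTE xp) /= => /orP[] /eqP->.
    have := all x; have := all y; rewrite (negbTE xp) (negbTE yp) /=.
    by case/orP=> /eqP ey /orP[] /eqP ex; move: xy; rewrite ex ey ?eqxx // adjC.
  case e1: (adj a b); case e2: (adj a c); case e3: (adj b c);
   solve [ by apply: (pick a b c) => //; rewrite e1 e2
         | by apply: (pick b a c); rewrite // 1?eq_sym // ?(adjC b a) ?e1 ?e3 //; move=> x; rewrite orbCA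
         | by apply: (pick c a b); rewrite // 1?eq_sym // ?(adjC c a) ?(adjC c b) ?e2 ?e3 //; move=> x; rewrite orbC -orbA ].
have [h0|/card_gt0P[p _]] := posnP #|H|.
  by apply: edgeless_exc => x; have := card0_eq h0 x; rewrite inE.
have h2 : #|H| <= 2 by rewrite -ltnS ltn_neqAle h3.
have le1 : #|[set: H] :\ p| <= 1 by have := cardsD1 p [set: H]; rewrite inE cardsT; slia.
have [h1|/card_gt0P[q qp]] := posnP #|[set: H] :\ p|.
  apply: (@homog_exc _ p true true) => [x xp|x y xp yp xy]; exfalso;
  by have := cards0_eq h1 => /setP/(_ x); rewrite !inE xp.
have only x : x != p -> x = q.
  by move=> xp; apply: (card_le1_eqP le1); rewrite // !inE xp.
apply: (@homog_exc _ p true (adj p q)) => [x /only->//|x y /only-> /only->].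
by rewrite eqxx.
Qed.

Lemma P3K1_exc (H : sgraph) (a b c d : H) : #|H| = 4 -> uniq [:: a; b; c; d] ->
  adj a b -> adj b c -> ~~ adj a c -> ~~ adj a d -> ~~ adj b d -> ~~ adj c d -> exc H.
Proof.
move=> h4 un ab bc ac ad bd cd; left; apply: Or33; apply: sg_iso_sym.
pose l := [:: a; b; c; d].
pose h (u : 'I_3 + 'I_1) : H := match u with inl i => nth a l i | inr _ => d end.
have lt4 (i : 'I_3) : i < size l := leq_trans (ltn_ord i) (isT : 3 <= 4).
have hI : injective h.
  move=> [i|i] [j|j] /= /eqP.
  - by rewrite nth_uniq // => /eqP/val_inj->.
  - by rewrite -[d]/(nth a l 3) nth_uniq //; case: i => -[|[|[|i]]].
  - by rewrite -[d]/(nth a l 3) nth_uniq //; case: j => -[|[|[|j]]].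
  - by rewrite (ord1 i) (ord1 j).
exists h; first by apply: inj_card_bij hI _; rewrite card_sum !card_ord h4.
move: ac ad bd cd => /negbTE ac /negbTE ad /negbTE bd /negbTE cd.
by case=> [[[|[|[|i]]] hi]|[[|i] hi]]; case=> [[[|[|[|j]]] hj]|[[|j] hj]] //=;
  rewrite /path_rel /complete_rel /= ?adjxx ?ab ?bc ?ac ?ad ?bd ?cd // adjC ?ab ?bc ?ac ?ad ?bd ?cd.
Qed.

(** A copy of [H] contains the three independent vertices. Its fourth vertex has
    at most one neighbour unless [H] is a star or [P3 + K1]. Hence [H], and with it
    [G], has no path with two edges. The edges of [G] are disjoint, at most [n / 2]
    of them, and since [n >= 7] a good set can avoid all of them. *)
Lemma order4_indep (G H : sgraph) (a b c : G) : arrows G H -> #|H| = 4 -> 7 <= #|G| ->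
  a != b -> a != c -> b != c -> ~~ adj a b -> ~~ adj a c -> ~~ adj b c -> exc H.
Proof.
move=> arr h4 n7 ab ac bc nab nac nbc; have k1 : 1 < #|H| by rewrite h4.
apply: boolp.contrapT => nexc; apply: (nexc).
have [|z zT gz] := extend arr (T := [set a; b; c]) k1.
  by rewrite h4 -setUA cardsU1 cards2 bc !inE negb_or ab ac.
have [g [gI Ke ga]] := (goodP H _).1 gz.
have inH x : x \in z |: [set a; b; c] -> exists i, x = g i.
  by rewrite Ke => /imsetP[i _ ->]; exists i.
have [i ei] := inH a ltac:(by rewrite !inE eqxx ?orbT).
have [j ej] := inH b ltac:(by rewrite !inE eqxx ?orbT).
have [l el] := inH c ltac:(by rewrite !inE eqxx ?orbT).
have [m em] := inH z ltac:(by rewrite !inE eqxx ?orbT).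
have all4 x : [|| x == i, x == j, x == l | x == m].
  have : g x \in z |: [set a; b; c] by rewrite Ke imset_f ?inE.
  by rewrite !inE ei ej el em !(inj_eq gI) orbC -!orbA.
move: zT; rewrite !inE !negb_or => /andP[/andP[zi zj] zl].
subst; rewrite !(inj_eq gI) in ab ac bc zi zj zl; rewrite !ga in nab nac nbc.
have edge x y : x != m -> y != m -> adj x y = false.
  move=> xm ym; have := all4 x; have := all4 y; rewrite (negbTE xm) (negbTE ym) !orbF.
  by case/or3P=> /eqP-> /or3P[] /eqP->; rewrite ?adjxx //; apply/negbTE; rewrite // adjC.
have third p q : p != m -> q != m -> p != q ->
    exists r, [/\ r != p, r != q, r != m & forall x, [|| x == p, x == q, x == r | x == m]].
  move=> pm qm pq; have := all4 p; have := all4 q; rewrite (negbTE pm) (negbTE qm) !orbF.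
  have w r : r != p -> r != q -> r != m -> [set p; q; r; m] = [set i; j; l; m] ->
     exists r, [/\ r != p, r != q, r != m & forall x, [|| x == p, x == q, x == r | x == m]].
    move=> rp rq rm es; exists r; split=> // x; have := congr1 (fun A : {set H} => x \in A) es.
    by rewrite /= !inE -!orbA all4.
  case/or3P=> /eqP e1 /or3P[] /eqP e2; subst; rewrite ?eqxx in pq => //;
  solve [ by apply: (w i); rewrite // 1?eq_sym //; apply/setP=> x; rewrite !inE; case: (x == i); case: (x == j); case: (x == l)
        | by apply: (w j); rewrite // 1?eq_sym //; apply/setP=> x; rewrite !inE; case: (x == i); case: (x == j); case: (x == l)
        | by apply: (w l); rewrite // 1?eq_sym //; apply/setP=> x; rewrite !inE; case: (x == i); case: (x == j); case: (x == l)].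
have only_nb p q : adj m p -> adj m q -> p = q.
  move=> amp amq; apply: contraTeq isT => pq; exfalso; apply: nexc.
  have pm : p != m by rewrite eq_sym adj_neq.
  have qm : q != m by rewrite eq_sym adj_neq.
  have [r [rp rq rm all]] := third p q pm qm pq.
  case amr: (adj m r).
    apply: (@star_exc _ m) => [x xm|x y xm ym]; last exact: edge.
    by have := all x; rewrite (negbTE xm) orbF => /or3P[] /eqP->.
  apply: (@P3K1_exc _ p m q r h4); rewrite ?amr ?(edge p q) ?(edge p r) ?(edge q r) // 1?adjC //.
  by rewrite /= !inE !negb_or pm pq (eq_sym p r) rp (eq_sym m q) qm (eq_sym m r) rm (eq_sym q r) rq.
have trH (x y z : H) : adj x y -> adj y z -> x = z.
  move=> xy yz; have [ym|ym] := eqVneq y m.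
    by apply: only_nb; rewrite -ym // adjC.
  have [xm|xm] := eqVneq x m; last by rewrite edge in xy.
  by have [->//|zm] := eqVneq z m; rewrite edge in yz.
have trG (x y z : G) : adj x y -> adj y z -> x = z.
  move=> xy yz; apply: contraTeq isT => xz; exfalso.
  have [|K [h [_ _ hI hP ha]]] := @embed_small _ _ [set x; y; z] arr k1.
    by rewrite h4 ltnS; have := card3_le x y z.
  have [i1 e1] := hP x ltac:(by rewrite !inE eqxx).
  have [j1 e2] := hP y ltac:(by rewrite !inE eqxx ?orbT).
  have [l1 e3] := hP z ltac:(by rewrite !inE eqxx ?orbT).
  by subst; rewrite !ha in xy yz; rewrite (trH _ _ _ xy yz) eqxx in xz.
pose F := [set v : G | 0 < dg setT v].
have [|x|ps [sps pP]] := @cluster_pairs _ F 2 isT.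
- by move=> x y z xy yz; rewrite (trG _ _ _ xy yz) eqxx.
- rewrite inE => dx; split; first by rewrite card_cn.
  apply/subsetP=> z; rewrite !inE => /predU1P[->//|xz].
  by rewrite dgT card_gt0; apply/set0Pn; exists x; rewrite inE adjC.
have [||K gK Kx] := avoid_pairs arr (ps := ps); first by rewrite h4.
  by have := subset_leq_card (subsetT F); rewrite cardsT h4; slia.
apply: (good_edgeless gK) => x y xK yK; apply/negP=> xy.
have [|p [pps p12 p1 p2]] := pP x.
  by rewrite inE dgT card_gt0; apply/set0Pn; exists y; rewrite inE.
have sub : cn x \subset K.
  apply/subsetP=> z; rewrite !inE => /predU1P[->//|xz].
  by rewrite (trG z x y) // adjC.
by apply: (Kx p pps p12); apply: (subsetP sub).
Qed.

(** Three neighbours or three non-neighbours of a vertex provide three vertices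
    that are pairwise adjacent or pairwise nonadjacent. *)
Lemma order4 (G H : sgraph) : arrows G H -> #|H| = 4 -> 7 <= #|G| -> exc H.
Proof.
move=> arr h4 n7; have /card_gt0P[v _] : 0 < #|G| by slia.
have tri (Q P : sgraph) : arrows Q P -> #|P| = 4 -> 7 <= #|Q| -> forall v : Q, 3 <= #|mb v| -> exc P.
  move=> ar p4 q7 u /subset_of[B sB cB].
  have [a [b [c [ab ac bc e]]]] := cards3 cB.
  have inB x : x \in [set a; b; c] -> (x != u) && ~~ adj u x.
    by rewrite -e => /(subsetP sB); rewrite inE.
  have /andP[au nua] := inB a ltac:(by rewrite !inE eqxx).
  have /andP[bu nub] := inB b ltac:(by rewrite !inE eqxx orbT).
  have /andP[cu nuc] := inB c ltac:(by rewrite !inE eqxx orbT).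
  have [hab|nab] := boolP (adj a b); last first.
    by apply: (@order4_indep _ _ u a b ar); rewrite // eq_sym.
  have [hac|nac] := boolP (adj a c); last first.
    by apply: (@order4_indep _ _ u a c ar); rewrite // eq_sym.
  have [hbc|nbc] := boolP (adj b c); last first.
    by apply: (@order4_indep _ _ u b c ar); rewrite // eq_sym.
  apply: exc_compl; apply: (@order4_indep (compl Q) (compl P) a b c (arrows_compl ar)) => //;
  by rewrite /= /compl_rel negb_and negbK ?hab ?hac ?hbc orbT.
have := card_mb v; have [h|h] := leqP 3 #|mb v|; first by move=> _; apply: (tri _ _ arr h4 n7 v).
move=> e; apply: exc_compl; apply: (tri _ _ (arrows_compl arr) h4 n7 v).
have := card_mb (G := compl G) v; have := @codeg G v; cosimp; slia.
Qed.

Lemma order_bound (G H : sgraph) : arrows G H -> ~ exc H -> #|G| <= #|H| + 2.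
Proof.
move=> arr nexc; rewrite leqNgt; apply/negP=> lt.
have [k3|k3] := leqP #|H| 3; first exact/nexc/order_le3_exc.
have [e4|n4] := eqVneq #|H| 4; first by apply: nexc; apply: (order4 arr); slia.
have [k6|k6] := leqP #|H| 6; last by apply: (large_order arr nexc k6); slia.
by apply: nexc; apply: (small_order arr); [move: n4 k3 k6; case: #|H| => // -[|[|[|[|[|[|[|]]]]]]]|slia].
Qed.

(** * Odd order: pairs of vertices left out *)

Section Pairs.
Variables (G H : sgraph).
Hypothesis arr : arrows G H.
Hypothesis k1 : 1 < #|H|.
Hypothesis n2 : #|G| = #|H| + 2.
Implicit Types (x y z v : G).

Definition left_out x y : bool := boolp.asbool (x != y /\ good H (~: [set x; y])).

Lemma left_outP x y : reflect (x != y /\ good H (~: [set x; y])) (left_out x y).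
Proof. exact: boolp.asboolP. Qed.

Lemma left_outC x y : left_out x y = left_out y x.
Proof. by apply/left_outP/left_outP; rewrite eq_sym setUC. Qed.

(** The three vertices form one colour class. *)
Lemma left_out3 x y z : x != y -> x != z -> y != z ->
  [|| left_out x y, left_out x z | left_out y z].
Proof.
move=> xy xz yz.
have [|w wW] := good_in arr (W := [set x; y; z]) k1.
  by rewrite -setUA cardsU1 cards2 yz !inE negb_or xy xz n2 /=; slia.
rewrite !inE in wW => gw; case/orP: wW => [/orP[]|] /eqP ew; subst w.
- apply/or3P/Or33; apply/left_outP; split=> //.
  suff <- : [set x; y; z] :\ x = [set y; z] by [].
  apply/setP=> v; rewrite !inE; case: (v =P x) => [->|] //=.
  by rewrite (negbTE xy) (negbTE xz).
- apply/or3P/Or32; apply/left_outP; split=> //.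
  suff <- : [set x; y; z] :\ y = [set x; z] by [].
  apply/setP=> v; rewrite !inE; case: (v =P y) => [->|_] //=; last by rewrite orbF.
  by rewrite eq_sym (negbTE xy) (negbTE yz).
apply/or3P/Or31; apply/left_outP; split=> //.
suff <- : [set x; y; z] :\ z = [set x; y] by [].
apply/setP=> v; rewrite !inE; case: (v =P z) => [->|_] //=; last by rewrite orbF.
by rewrite !(eq_sym z) (negbTE xz) (negbTE yz).
Qed.

(** The colour classes are [x], [y] and [z], [v]. *)
Lemma left_out4 x y z v : uniq [:: x; y; z; v] ->
  [|| left_out x z, left_out x v, left_out y z | left_out y v].
Proof.
rewrite /= !inE !negb_or !andbT => /and3P[/and3P[xy xz xv] /andP[yz yv] zv].
have [||||w1 [w2 [w1W w2W g]]] := @two_class _ _ arr [set x; y] [set z; v] k1.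
- rewrite -setI_eq0; apply/eqP/setP=> u; rewrite !inE; apply/negP=> /andP[].
  by case/orP=> /eqP-> /orP[] /eqP e; move: xz xv yz yv; rewrite ?e ?eqxx ?andbF -?e ?eqxx.
- by apply/set0Pn; exists x; rewrite !inE eqxx.
- by apply/set0Pn; exists z; rewrite !inE eqxx.
- by rewrite !cards2 xy zv n2; slia.
have out a b a' b' : a != b -> [set a; b] = [set x; y] -> [set a'; b'] = [set z; v] -> b != b' ->
    a' != b' -> a != a' -> a != b' -> b != a' ->
    good H (a' |: (a |: ~: ([set x; y] :|: [set z; v]))) -> left_out b b'.
  move=> ab e1 e2 bb' ab' aa' ab2 ba' gd; apply/left_outP; split=> //.
  suff <- : a' |: (a |: ~: ([set x; y] :|: [set z; v])) = ~: [set b; b'] by [].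
  rewrite -e1 -e2; apply/setP=> u; rewrite !inE.
  case: (u =P a) => [->|_]; first by rewrite (negbTE ab) (negbTE ab2) orbT.
  by case: (u =P a') => [->|_] //=; rewrite (eq_sym a' b) (negbTE ba') (negbTE ab').
case/set2P: w1W => e1; case/set2P: w2W => e2; subst w1 w2; apply/or4P.
- by apply: Or44; apply: (out x y z v).
- by apply: Or43; apply: (out x y v z); rewrite // 1?eq_sym // setUC.
- by apply: Or42; apply: (out y x z v); rewrite // 1?eq_sym // setUC.
by apply: Or41; apply: (out y x v z); rewrite // 1?eq_sym // setUC.
Qed.

Lemma ee2 x y : x != y -> ee [set x; y] = 2 * adj x y.
Proof.
move=> xy; rewrite ee_U1 ?inE // {1}/ee big_set1 !dgE.
rewrite (_ : [set u in [set y] | adj y u] = set0); last first.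
  by apply/setP=> u; rewrite !inE; case: eqP => [->|//]; rewrite adjxx.
rewrite cards0 add0n; case xy': (adj x y).
  by rewrite (_ : [set u in [set y] | adj x u] = [set y]) ?cards1 //; apply/setP=> u;
    rewrite !inE; case: eqP => [->|//].
by rewrite (_ : [set u in [set y] | adj x u] = set0) ?cards0 //; apply/setP=> u;
    rewrite !inE; case: eqP => [->|//].
Qed.

Lemma left_out_dg : exists c, forall x y, left_out x y -> dg setT x + dg setT y = c + adj x y.
Proof.
have key x y : left_out x y -> ee [set: G] + 2 * adj x y = ee [set: H] + 2 * (dg setT x + dg setT y).
  case/left_outP=> xy gd; have := ee_split [set x; y]; rewrite (good_ee gd) ee2 //.
  by rewrite big_setU1 ?inE //= big_set1.
have /card_gt2P[x [y [z [_ [xy yz zx]]]]] : 2 < #|[set: G]| by rewrite cardsT n2; slia.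
have c0 u v w w' : left_out u v -> left_out w w' ->
    dg setT u + dg setT v + adj w w' = dg setT w + dg setT w' + adj u v.
  by move=> /key h1 /key h2; slia.
have le u v : left_out u v -> adj u v <= dg setT u + dg setT v.
  move=> _; case uv: (adj u v) => //=; have : 0 < dg setT u; last by slia.
  by rewrite dgT card_gt0; apply/set0Pn; exists v; rewrite inE.
have [u [v uv]] : exists u v, left_out u v.
  rewrite eq_sym in zx; have := left_out3 xy zx yz.
  by case/or3P=> h; [exists x, y|exists x, z|exists y, z].
exists (dg setT u + dg setT v - adj u v) => w w' ww'.
by have := c0 _ _ _ _ uv ww'; have := le _ _ uv; slia.
Qed.
End Pairs.

Section EvenSum.
Variables (G H : sgraph).
Hypothesis arr : arrows G H.
Hypothesis nexc : ~ exc H.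
Hypothesis k5 : 4 < #|H|.
Hypothesis n2 : #|G| = #|H| + 2.
Hypothesis oddn : odd #|G|.
Variable a : nat.
Hypothesis sum2a : forall x y : G, left_out H x y -> dg setT x + dg setT y = 2 * a + adj x y.
Let k1 : 1 < #|H|. Proof. by slia. Qed.
Let n7 : 6 < #|G|. Proof. by slia. Qed.
Implicit Types (x y z v m l : G).

Local Notation d x := (dg [set: G] x).
Local Notation R x y := (left_out H x y).

Lemma left_out_third x y z : x != y -> x != z -> y != z -> ~~ R x y -> ~~ R x z -> R y z.
Proof.
by move=> xy xz yz /negbTE r1 /negbTE r2; have := left_out3 arr k1 n2 xy xz yz; rewrite r1 r2.
Qed.

Lemma left_out_fourth x y z v : uniq [:: x; y; z; v] -> ~~ R x z -> ~~ R x v -> ~~ R y z -> R y v.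
Proof.
by move=> un /negbTE r1 /negbTE r2 /negbTE r3; have := left_out4 arr k1 n2 un; rewrite r1 r2 r3.
Qed.

Lemma low_R x y : d x < a -> d y <= a -> ~~ R x y.
Proof. by move=> dx dy; apply/negP=> /sum2a; slia. Qed.

Lemma high_R x y : a < d x -> a < d y -> ~~ R x y.
Proof. by move=> dx dy; apply/negP=> /sum2a; have := leq_b1 (adj x y); slia. Qed.

Lemma mid_R x y : d x = a -> d y = a -> adj x y -> ~~ R x y.
Proof. by move=> dx dy xy; apply/negP=> /sum2a; rewrite xy; slia. Qed.

Lemma mid_high_R x m : d x = a -> a < d m -> R x m -> d m = a.+1 /\ adj x m.
Proof. by move=> dx dm /sum2a; rewrite dx; case: (adj x m); slia. Qed.

Definition mid := [set v : G | d v == a].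
Definition high := [set v : G | a < d v].
Definition low := [set v : G | d v < a].

Lemma midP v : reflect (d v = a) (v \in mid).
Proof. by rewrite inE; apply: eqP. Qed.

Lemma card_levels : #|low| + #|mid| + #|high| = #|G|.
Proof.
have := card_compl mid; have := cardsID low (~: mid).
have -> : ~: mid :&: low = low by apply/setP=> v; rewrite !inE; case: ltngtP.
have -> : ~: mid :\: low = high by apply/setP=> v; rewrite !inE; case: ltngtP.
slia.
Qed.

Lemma card_high : #|high| <= 2.
Proof.
rewrite leqNgt; apply/negP=> /card_gt2P[x [y [z [[xM yM zM] [xy yz zx]]]]].
rewrite !inE in xM yM zM; rewrite eq_sym in zx.
by have := left_out_third xy zx yz (high_R xM yM) (high_R xM zM); rewrite (negbTE (high_R yM zM)).
Qed.

Lemma card_low2 : #|low| <= 2.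
Proof.
rewrite leqNgt; apply/negP=> /card_gt2P[x [y [z [[xM yM zM] [xy yz zx]]]]].
rewrite !inE in xM yM zM; rewrite eq_sym in zx.
by have := left_out_third xy zx yz (low_R xM (ltnW yM)) (low_R xM (ltnW zM)); rewrite (negbTE (low_R yM (ltnW zM))).
Qed.

Lemma two_mid : exists x y, [/\ d x = a, d y = a & x != y].
Proof.
have /card_gt1P[x [y [/midP xA /midP yA xy]]] : 1 < #|mid|.
  by have := card_levels; have := card_high; have := card_low2; slia.
by exists x, y.
Qed.

(** Pairs that are not left out form no triangle, so any two vertices of degree
    [a], neither of them left out with [u], are left out together, and they are
    nonadjacent by the degree sum. They form no 4-cycle either, so [m] is left out with all vertices
    of degree [a] but one at most; the degree sum gives [d m] and adjacency. *)
Lemma isolated_mid u : (forall x, d x = a -> u != x /\ ~~ R u x) ->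
  (forall x y, d x = a -> d y = a -> adj x y = false) /\
  (forall m, m != u -> a < d m -> d m = a.+1 /\ #|mid :\: nb m| <= 1).
Proof.
move=> uR; split=> [x y dx dy|m mu dm].
  have [->|xy] := eqVneq x y; first exact: adjxx.
  have [ux rx] := uR x dx; have [uy ry] := uR y dy.
  by apply: contraTF (left_out_third ux uy xy rx ry); apply: mid_R.
have step x y : d x = a -> d y = a -> x != y -> ~~ R m x -> R m y.
  move=> dx dy xy mx; have [ux rx] := uR x dx; have [uy ry] := uR y dy.
  have nmx : m != x by apply: contraTneq dm => ->; rewrite dx ltnn.
  have nmy : m != y by apply: contraTneq dm => ->; rewrite dy ltnn.
  by apply: (@left_out_fourth u m x y) => //; rewrite /= !inE !negb_or (eq_sym u m) mu ux uy xy nmx nmy.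
split.
  have [x [y [dx dy xy]]] := two_mid.
  have [rx|rx] := boolP (R m x); first by rewrite left_outC in rx; case: (mid_high_R dx dm rx).
  by have := step x y dx dy xy rx; rewrite left_outC => ry; case: (mid_high_R dy dm ry).
rewrite leqNgt; apply/negP=> /card_gt1P[x [y []]]; rewrite !inE => /andP[nx /eqP dx] /andP[ny /eqP dy] xy.
have [rx|rx] := boolP (R m x).
  by rewrite left_outC in rx; case: (mid_high_R dx dm rx); rewrite adjC (negbTE nx).
by have := step x y dx dy xy rx; rewrite left_outC => ry; case: (mid_high_R dy dm ry); rewrite adjC (negbTE ny).
Qed.

Lemma mid_edge_count : (forall x y, d x = a -> d y = a -> adj x y = false) ->
  a * #|mid| <= \sum_(u in ~: mid) d u.
Proof.
move=> ind; rewrite mulnC -sum_nat_const.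
have -> : \sum_(x in mid) a = \sum_(x in mid) dg (~: mid) x.
  apply: eq_bigr => x /midP dx; have := dg_compl mid x.
  by rewrite {1}/dg big1 ?dx // => y /midP dy; rewrite ind.
rewrite /dg exchange_big /=; apply: leq_sum => u _.
rewrite (eq_bigr (fun x => adj u x : nat)); last by move=> x _; rewrite adjC.
exact: dg_sub (subsetT mid).
Qed.

(** A vertex of degree below [a] is left out with no vertex of degree [a]. Then
    the vertices of degree [a] are independent, and the at most three remaining
    vertices cannot absorb their edges. *)
Lemma no_low : low = set0.
Proof.
apply/eqP; rewrite -subset0; apply/subsetP=> l; rewrite !inE => dl; exfalso.
have lR x : d x = a -> l != x /\ ~~ R l x.
  by move=> dx; split; [apply: contraTneq dl => ->; rewrite dx ltnn|apply: low_R; rewrite ?dx].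
have [ind hi] := isolated_mid lR.
have lowE : low = [set l].
  apply/setP=> l'; rewrite !inE; apply/idP/eqP=> [dl'|->//].
  apply: contraTeq isT => ll'; exfalso; have [x [y [dx dy xy]]] := two_mid.
  have [lx rx] := lR x dx; have [ly ry] := lR y dy.
  have [l'x r'x] : l' != x /\ ~~ R l' x.
    by split; [apply: contraTneq dl' => ->; rewrite dx ltnn|apply: low_R; rewrite ?dx].
  have [l'y r'y] : l' != y /\ ~~ R l' y.
    by split; [apply: contraTneq dl' => ->; rewrite dy ltnn|apply: low_R; rewrite ?dy].
  have un : uniq [:: l; l'; x; y].
    by rewrite /= !inE !negb_or (eq_sym l l') ll' lx ly l'x l'y xy.
  by have := left_out_fourth un rx ry r'x; rewrite (negbTE r'y).
have cl := card_levels; rewrite lowE cards1 in cl; have ch := card_high.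
have := mid_edge_count ind; have -> : ~: mid = l |: high.
  apply/setP=> v; rewrite !inE; have := congr1 (fun A : {set G} => v \in A) lowE; rewrite !inE.
  by case: ltngtP => // _; case: (v == l).
have lh : l \notin high by rewrite inE -leqNgt ltnW.
rewrite big_setU1 //= (eq_bigr (fun _ => a.+1)) ?sum_nat_const; last first.
  move=> m; rewrite inE => dm; apply: (hi m _ dm).1.
  by apply: contraTneq dm => ->; rewrite -leqNgt ltnW.
have [h0|/set0Pn[m mM]] := eqVneq high set0.
  rewrite h0 cards0 mul0n addn0; rewrite h0 cards0 in cl => le.
  have : a * 1 <= a * #|mid| by rewrite leq_mul2l; apply/orP; right; slia.
  slia.
have dm : a < d m by rewrite inE in mM.
have ml : m != l by apply: contraTneq dm => ->; rewrite -leqNgt ltnW.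
have [dm1 cm] := hi m ml dm.
have := cardsID (nb m) mid; have : #|mid :&: nb m| <= a.+1.
  by rewrite -dm1 dgT; apply: subset_leq_card; apply: subsetIr.
move=> c1 c2 c3; have m4 : 4 <= #|mid| by slia.
have a2 : 2 <= a by slia.
have : a * (6 - #|high|) <= a * #|mid| by rewrite leq_mul2l; apply/orP; right; slia.
have [h1|h2] : #|high| = 1 \/ #|high| = 2.
- by have : 0 < #|high|; [rewrite card_gt0; apply/set0Pn; exists m|slia].
- by rewrite h1 in c3 *; slia.
by rewrite h2 in c3 *; slia.
Qed.

Lemma ge_mid v : a <= d v.
Proof.
by rewrite leqNgt; apply/negP=> dv; have := in_set0 v; rewrite -no_low inE dv.
Qed.

Lemma not_mid : ~: mid = high.
Proof. by apply/setP=> v; rewrite !inE; have := ge_mid v; case: ltngtP. Qed.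

Lemma mid_large : 5 <= #|mid|.
Proof. by have := card_compl mid; rewrite not_mid; have := card_high; slia. Qed.

(** A vertex of degree above [a + 1] is left out with no vertex of degree [a], so
    those vertices are independent by [isolated_mid]. If it is the only vertex of
    degree above [a], it meets all edges. A second such vertex is adjacent to
    almost all vertices of degree [a], whose number is then too small. *)
Lemma high_eq m : a < d m -> d m = a.+1.
Proof.
move=> dm; have := dm; rewrite leq_eqVlt => /predU1P[//|dm2]; exfalso.
have mR x : d x = a -> m != x /\ ~~ R m x.
  move=> dx; split; first by apply: contraTneq dm => ->; rewrite dx ltnn.
  by rewrite left_outC; apply/negP=> /(mid_high_R dx dm)[e _]; move: dm2; rewrite e ltnn.
have [ind hi] := isolated_mid mR.
have [h0|/set0Pn[m']] := eqVneq (high :\ m) set0.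
  have highE v : a < d v -> v = m.
    move=> dv; apply/eqP; apply: contraT => vm.
    by have := in_set0 v; rewrite -h0 !inE vm dv.
  have edge x y : adj x y -> (x == m) || (y == m).
    move=> xy; have := ge_mid x; rewrite leq_eqVlt => /predU1P[dx|/highE->]; last by rewrite eqxx.
    have := ge_mid y; rewrite leq_eqVlt => /predU1P[dy|/highE->]; last by rewrite eqxx orbT.
    by rewrite ind in xy.
  apply: nexc; apply: (nomatching_exc arr k1); first by slia.
  move=> x y z w /edge + /edge.
  by case/orP=> /eqP-> /orP[] /eqP->; rewrite eqxx ?orbT.
rewrite !inE => /andP[m'm dm']; have [dm1 cm] := hi m' m'm dm'.
have [x [_ [dx _ _]]] := two_mid.
have : d x <= #|high|.
  rewrite -not_mid -(dg_compl mid x) {1}/dg big1 ?dg_card // => y /midP dy.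
  by rewrite ind.
have := cardsID (nb m') mid; have : #|mid :&: nb m'| <= a.+1.
  by rewrite -dm1 dgT; apply: subset_leq_card; apply: subsetIr.
by have := mid_large; have := card_high; slia.
Qed.

Lemma mid_triangle x y z : x \in mid -> y \in mid -> z \in mid ->
  adj x y -> adj x z -> adj y z -> False.
Proof.
move=> /midP dx /midP dy /midP dz xy xz yz.
have := left_out_third (adj_neq xy) (adj_neq xz) (adj_neq yz) (mid_R dx dy xy) (mid_R dx dz xz).
by rewrite (negbTE (mid_R dy dz yz)).
Qed.

Lemma mid_C4 t w u v : t \in mid -> w \in mid -> u \in mid -> v \in mid -> t != w -> u != v ->
  adj t u -> adj t v -> adj w u -> adj w v -> False.
Proof.
move=> /midP dt /midP dw /midP du /midP dv tw uv tu tv wu wv.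
have un : uniq [:: t; w; u; v].
  by rewrite /= !inE !negb_or tw uv (adj_neq tu) (adj_neq tv) (adj_neq wu) (adj_neq wv).
have := left_out_fourth un (mid_R dt du tu) (mid_R dt dv tv) (mid_R dw du wu).
by rewrite (negbTE (mid_R dw dv wv)).
Qed.

Lemma mid_common x y (B : {set G}) : x \in mid -> y \in mid -> x != y -> B \subset mid ->
  #|B :&: (nb x :&: nb y)| <= 1.
Proof.
move=> xA yA xy BA; rewrite leqNgt; apply/negP=> /card_gt1P[u [v []]].
rewrite !in_setI => /andP[uB /andP[]]; rewrite [u \in nb x]inE [u \in nb y]inE => xu yu.
case/andP=> vB /andP[]; rewrite [v \in nb x]inE [v \in nb y]inE => xv yv uv.
exact: (@mid_C4 x y u v xA yA (subsetP BA u uB) (subsetP BA v vB)).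
Qed.

Lemma dg_nb (B : {set G}) x : dg B x = #|B :&: nb x|.
Proof. by rewrite dgE; apply: eq_card => y; rewrite !inE. Qed.

Lemma dense_bound (B : {set G}) x y : B \subset mid -> x \in mid -> y \in mid -> x != y ->
  dg B x + dg B y <= #|B :\ x :\ y| + adj x y * 2 + 1.
Proof.
move=> BA xA yA xy; rewrite !dg_nb -cardsUI setIACA setIid.
have := mid_common xA yA xy BA.
have : #|B :&: nb x :|: B :&: nb y| <= #|B :\ x :\ y| + adj x y * 2; last by slia.
case xy': (adj x y) => /=.
  have := cardsD1 x B; have := cardsD1 y (B :\ x).
  have : #|B :&: nb x :|: B :&: nb y| <= #|B|.
    by apply: subset_leq_card; rewrite subUset !subsetIl.
  by case: (x \in B); case: (y \in _); slia.
rewrite addn0; apply: subset_leq_card; apply/subsetP=> v; rewrite !inE.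
case/orP=> /andP[vB h]; rewrite vB andbT; apply/andP; split.
- by apply: contraTneq h => ->; rewrite xy'.
- by rewrite eq_sym adj_neq.
- by rewrite eq_sym adj_neq.
by apply: contraTneq h => ->; rewrite adjC xy'.
Qed.

Lemma two_nbs (B : {set G}) y : 1 < dg B y -> exists u v, [/\ u \in B, v \in B, adj y u, adj y v & u != v].
Proof.
rewrite dgE => /card_gt1P[u [v []]]; rewrite !inE => /andP[uB yu] /andP[vB yv] uv.
by exists u, v.
Qed.

(** The vertices of degree [a] span no triangle and no 4-cycle: [u] and [v] are
    nonadjacent and have at most one common neighbour of degree [a]. *)
Lemma mid_cherry y u v : y \in mid -> u \in mid -> v \in mid -> adj y u -> adj y v -> u != v ->
  dg mid u + dg mid v < #|mid|.
Proof.
move=> yA uA vA yu yv uv.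
have nuv : adj u v = false by apply/negP=> uv'; apply: (mid_triangle yA uA vA).
have := dense_bound (subxx mid) uA vA uv; rewrite nuv mul0n addn0.
have := cardsD1 u mid; have := cardsD1 v (mid :\ u).
by rewrite uA in_setD1 vA (eq_sym v) uv /=; slia.
Qed.

Lemma dg_total : ~~ odd (a * #|G| + #|high|).
Proof.
have := ee_even [set: G]; suff -> : ee [set: G] = a * #|G| + #|high| by [].
rewrite /ee (big_setID mid) /= setTI setTD not_mid.
rewrite (eq_bigr (fun _ => a)) => [|v /midP//].
rewrite [X in _ + X](eq_bigr (fun _ => a.+1)) => [|v]; last by rewrite inE => /high_eq.
rewrite !sum_nat_const -(card_compl mid) not_mid mulnS.
by rewrite mulnDr !(mulnC a) -addnA (addnC #|high|).
Qed.

(** Let [m] be the vertex of degree [a + 1], and [X] the set of vertices not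
    adjacent to it. No element of [X] is left out with [m], so [X] is independent
    and a neighbour of [m] has at most one neighbour in [X]. Counting edges gives
    [a * #|X| <= a + 1], and then [n <= a + 2] by parity: too many edges for a graph
    without 4-cycles. *)
Lemma high_neq1 : #|high| != 1.
Proof.
apply/eqP=> h1; have /cards1P[m hm] : #|high| == 1 by rewrite h1.
have mM : m \in high by rewrite hm inE.
have dm : a < d m by rewrite inE in mM.
have dm1 := high_eq dm.
have cA : #|mid| + 1 = #|G| by have := card_compl mid; rewrite not_mid h1.
have mA : m \notin mid by rewrite inE dm1; slia.
have Am v : v \in mid -> v != m by apply: contraTneq => ->.
have sub : nb m \subset mid.
  apply/subsetP=> v; rewrite inE => mv; rewrite -(setCK mid) not_mid hm !inE.
  by rewrite eq_sym adj_neq.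
pose X := mid :\: nb m.
have cX : #|X| + a.+1 = #|mid|.
  by have := cardsID (nb m) mid; rewrite (setIidPr sub) -dgT dm1 addnC.
have nR x : x \in X -> ~~ R m x.
  rewrite !inE => /andP[mx /eqP dx]; rewrite left_outC; apply/negP=> /(mid_high_R dx dm)[_].
  by rewrite adjC (negbTE mx).
have XA x : x \in X -> x \in mid by rewrite inE => /andP[].
have Xind x x' : x \in X -> x' \in X -> adj x x' = false.
  move=> xX x'X; have [->|xx'] := eqVneq x x'; first exact: adjxx.
  have r : R x x'.
    apply: (@left_out_third m) => //; [| |exact: nR|exact: nR]; rewrite eq_sym Am // XA //.
  by apply: contraTF r; apply: mid_R; apply/midP; apply: XA.
have one y : y \in nb m -> dg X y <= 1.
  move=> my; rewrite leqNgt; apply/negP=> /two_nbs[x [x' [xX x'X yx yx' xx']]].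
  have yA := subsetP sub y my.
  have un : uniq [:: m; y; x; x'].
    rewrite /= !inE !negb_or (adj_neq yx) (adj_neq yx') xx' !(eq_sym m) (Am y yA).
    by rewrite (Am x) ?(Am x') // XA.
  have := left_out_fourth un (nR x xX) (nR x' x'X) (mid_R (midP _ yA) (midP _ (XA x xX)) yx).
  by rewrite (negbTE (mid_R (midP _ yA) (midP _ (XA x' x'X)) yx')).
have edges : a * #|X| <= a.+1.
  rewrite mulnC -sum_nat_const -dm1 dgT -[#|nb m|]sum1_card.
  have -> : \sum_(x in X) a = \sum_(x in X) dg (nb m) x.
    apply: eq_bigr => x xX; rewrite -(midP _ (XA x xX)) -(dg_compl (nb m) x).
    have -> : dg (~: nb m) x = 0; last by rewrite addn0.
    rewrite /dg big1 // => y; rewrite inE => my; apply/eqP; rewrite eqb0; apply/negP=> xy.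
    have [ym|ym] := eqVneq y m.
      by move: xX; rewrite !inE -ym adjC xy.
    have yA : y \in mid by rewrite -(setCK mid) not_mid hm !inE.
    by rewrite Xind // in xy; rewrite in_setD my.
  rewrite /dg exchange_big /=; apply: leq_sum => y ym.
  rewrite (eq_bigr (fun x => adj y x : nat)); last by move=> x _; rewrite adjC.
  exact: one.
have odda : odd a by have := dg_total; rewrite h1 oddD oddM oddn /= andbT; case: (odd a).
have a3 : 3 <= a.
  rewrite leqNgt; apply/negP=> a3; have a1 : a = 1 by move: odda a3; case: (a) => [|[|[|]]].
  by move: edges; rewrite a1 mul1n; slia.
have X1 : #|X| <= 1.
  rewrite leqNgt; apply/negP=> X2; have : a * 2 <= a * #|X| by rewrite leq_mul2l X2 orbT.
  slia.
have na : #|G| <= a + 3 by slia.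
have na2 : #|G| <= a + 2.
  move: na; rewrite leq_eqVlt => /predU1P[e|]; last by slia.
  by move: oddn; rewrite e oddD odda.
have dgm v : v \in mid -> a <= dg mid v + 1.
  move=> vA; rewrite -(midP _ vA) -(dg_compl mid v) leq_add2l not_mid hm.
  by rewrite (leq_trans (dg_card _ _)) // cards1.
have [y [_ [/midP yA _ _]]] := two_mid.
have [u [v [uA vA yu yv uv]]] := @two_nbs mid y ltac:(have := dgm y yA; slia).
by have := mid_cherry yA uA vA yu yv uv; have := dgm u uA; have := dgm v vA; slia.
Qed.

Lemma dg2 x y v : x != y -> dg [set x; y] v = adj v x + adj v y.
Proof.
move=> xy; rewrite dg_U1 ?inE //; congr (_ + _).
by have := dg_U1 v (negbT (in_set0 y)); rewrite dg_set0 addn0 setU0.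
Qed.

Lemma left_out_dgK x y v : R x y -> dg (~: [set x; y]) v + adj v x + adj v y = d v.
Proof. by case/left_outP=> xy _; rewrite -(dg_compl [set x; y] v) dg2 //; slia. Qed.

Section TwoHigh.
Variables m m' : G.
Hypothesis mm : m != m'.
Hypothesis dm : d m = a.+1.
Hypothesis dm' : d m' = a.+1.
Let X := mid :\: nb m.
Let X' := mid :\: nb m'.

Let highm : a < d m. Proof. by rewrite dm. Qed.
Let highm' : a < d m'. Proof. by rewrite dm'. Qed.

Lemma mid_neq p v : a < d p -> v \in mid -> v != p.
Proof. by move=> dp /midP dv; apply: contraTneq dp => <-; rewrite dv ltnn. Qed.

Lemma far_R p x : a < d p -> x \in mid :\: nb p -> ~~ R p x.
Proof.
move=> dp; rewrite in_setD => /andP[px /midP dx]; rewrite left_outC.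
by apply/negP=> /(mid_high_R dx dp)[_]; rewrite inE in px; rewrite adjC (negbTE px).
Qed.

Lemma far_adj x : x \in X -> adj m' x.
Proof.
move=> xX; apply: contraT => nx; have xA : x \in mid by move: xX; rewrite in_setD => /andP[].
have xX' : x \in X' by rewrite in_setD xA inE nx.
have r : R m' x.
  apply: (@left_out_third m) => //; [|rewrite eq_sym|exact: high_R|exact: far_R]; last exact: mid_neq.
  by rewrite eq_sym; apply: mid_neq.
by rewrite (negbTE (far_R highm' xX')) in r.
Qed.

Lemma far_indep x y : x \in X -> y \in X -> adj x y = false.
Proof.
move=> xX yX; have [->|xy] := eqVneq x y; first exact: adjxx.
have xA : x \in mid by move: xX; rewrite in_setD => /andP[].
have yA : y \in mid by move: yX; rewrite in_setD => /andP[].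
have r : R x y.
  by apply: (@left_out_third m) => //; [rewrite eq_sym; apply: mid_neq|rewrite eq_sym; apply: mid_neq|apply: far_R|apply: far_R].
by apply: contraTF r; apply: mid_R; apply/midP.
Qed.

Lemma far_dg y : y \in mid -> dg X y <= 1.
Proof.
move=> yA; rewrite leqNgt; apply/negP=> /two_nbs[x [x' [xX x'X yx yx' xx']]].
have xA : x \in mid by move: xX; rewrite in_setD => /andP[].
have x'A : x' \in mid by move: x'X; rewrite in_setD => /andP[].
have un : uniq [:: m; y; x; x'].
  by rewrite /= !inE !negb_or (adj_neq yx) (adj_neq yx') xx' !(eq_sym m) !mid_neq.
have := left_out_fourth un (far_R highm xX) (far_R highm x'X) (mid_R (midP _ yA) (midP _ xA) yx).
by rewrite (negbTE (mid_R (midP _ yA) (midP _ x'A) yx')).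
Qed.

Lemma far_far x x' : x \in X -> x' \in X' -> adj x x' = false.
Proof.
move=> xX x'X; apply/negP=> xx'.
have xA : x \in mid by move: xX; rewrite in_setD => /andP[].
have x'A : x' \in mid by move: x'X; rewrite in_setD => /andP[].
have un : uniq [:: m; x'; x; m'].
  rewrite /= !inE !negb_or mm !(eq_sym m) (mid_neq highm xA) (mid_neq highm x'A).
  by rewrite (mid_neq highm' xA) (mid_neq highm' x'A) eq_sym (adj_neq xx').
have r : ~~ R x' x by apply: mid_R; [apply/midP|apply/midP|rewrite adjC].
have := left_out_fourth un (far_R highm xX) (high_R highm highm') r.
by rewrite left_outC (negbTE (far_R highm' x'X)).
Qed.

(** Counts the edges between [X] and the other vertices of degree [a]: an element
    of [X] has [a - 1] of them because it is adjacent to [m'] but not to [m]. *)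
Lemma far_count : high = [set m; m'] -> #|X| * a.-1 + #|X| + #|X'| <= #|mid|.
Proof.
move=> hE.
have dgX x : x \in X -> dg mid x = a.-1.
  move=> xX; have := dg_compl mid x; rewrite not_mid hE dg2 //.
  rewrite (adjC x m') (far_adj xX); move: xX; rewrite in_setD inE => /andP[mx /midP->].
  by rewrite adjC (negbTE mx); slia.
have dXX : [disjoint X & X'].
  rewrite -setI_eq0; apply/eqP/setP=> x; rewrite in_setI in_set0; apply/negP=> /andP[xX].
  by rewrite in_setD inE (far_adj xX).
rewrite -sum_nat_const -(eq_bigr _ dgX) /dg exchange_big /=.
have cU : #|X :|: X'| = #|X| + #|X'| by rewrite cardsU (eqP (_ : X :&: X' == set0)) ?setI_eq0 // cards0 subn0.
rewrite (big_setID (X :|: X')) /= big1; last first.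
  move=> y; rewrite in_setI => /andP[_ yX]; rewrite big1 // => x xX.
  case/setUP: yX => yX; first by rewrite far_indep.
  by rewrite far_far.
rewrite add0n -addnA -cU -(cardsID (X :|: X') mid) addnC.
have -> : mid :&: (X :|: X') = X :|: X'.
  by apply/setIidPr; rewrite subUset !subsetDl.
rewrite leq_add2l -sum1_card; apply: leq_sum => y; rewrite in_setD => /andP[_ yA].
rewrite (eq_bigr (fun x => adj y x : nat)); last by move=> x _; rewrite adjC.
exact: far_dg.
Qed.

Lemma far_card : high = [set m; m'] -> #|X| + a.+1 = #|mid| + adj m m'.
Proof.
move=> hE; have := cardsID (nb m) mid; have := dg_compl mid m.
by rewrite not_mid hE dg2 // adjxx dm dg_nb -/X; slia.
Qed.
End TwoHigh.

(** The counts of [far_count] and [far_card], together with parity, leave only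
    [a = 4] and [n = 7], with the two vertices of degree 5 nonadjacent and joined to
    all others. The other five vertices form a cycle. Then [m'] has degree 4 in a
    copy that leaves out [m] and a vertex of the cycle, while no vertex has degree
    4 in a copy that leaves out [x] and [z]. *)
Lemma high_neq2 : #|high| != 2.
Proof.
apply/eqP=> h2; have /cards2P[m [m' [mm hE]]] : #|high| == 2 by rewrite h2.
have hE' : high = [set m'; m] by rewrite hE setUC.
have highm : a < d m by have := set21 m m'; rewrite -hE inE.
have highm' : a < d m' by have := set22 m m'; rewrite -hE inE.
have dm := high_eq highm; have dm' := high_eq highm'.
have mm' : m' != m by rewrite eq_sym.
have c1 := far_card mm dm dm' hE; have c2 := far_card mm' dm' dm hE'.
have le := far_count mm dm dm' hE.
rewrite (adjC m') in c2.
have cA : #|mid| + 2 = #|G| by have := card_compl mid; rewrite not_mid h2.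
have eva : ~~ odd a.
  by have := dg_total; rewrite h2 oddD oddM oddn /= andbT addbF.
have [x0 [_ [/midP x0A _ _]]] := two_mid.
have a0 : 0 < a.
  rewrite lt0n; apply/eqP=> a0; have [mx|nmx] := boolP (adj m x0).
    have := midP _ x0A; rewrite a0 => /dg0 -/(_ m); rewrite inE adjC mx.
    by move/(_ isT).
  have x0X : x0 \in mid :\: nb m by rewrite in_setD x0A inE nmx.
  have := midP _ x0A; rewrite a0 => /dg0 -/(_ m'); rewrite inE adjC.
  by rewrite (far_adj mm dm dm' x0X) => /(_ isT).
have a2 : 2 <= a by move: eva a0; case: (a) => [|[|]].
set t := #|mid :\: nb m| in c1 le; set t' := #|mid :\: nb m'| in c2 le.
have tt : t' = t by slia.
have t1 : t <= 1.
  rewrite leqNgt; apply/negP=> t2; have : 2 * a.-1 <= t * a.-1 by rewrite leq_mul2r t2 orbT.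
  by have := leq_b1 (adj m m'); slia.
have te : t = adj m m'.
  have : odd (t + adj m m') = false.
    have : #|G| + adj m m' = t + a + 3 by slia.
    move/(congr1 odd); rewrite !oddD oddn (negbTE eva) /= addbF.
    by case: (adj m m'); case: (odd t).
  by move: t1; case: (t) => [|[|]] //; case: (adj m m').
have na : #|mid| = a.+1 by slia.
have dgm v : v \in mid -> dg mid v + adj v m + adj v m' = a.
  by move=> vA; rewrite -(midP _ vA) -(dg_compl mid v) not_mid hE dg2 // addnA.
have dge v : v \in mid -> a <= dg mid v + 2.
  by move=> /dgm; have := leq_b1 (adj v m); have := leq_b1 (adj v m'); slia.
have a4 : 4 <= a by slia.
have [x [z [xA zA x0x x0z xz]]] := @two_nbs mid x0 ltac:(have := dge x0 x0A; slia).
have a4' : a = 4.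
  have := mid_cherry x0A xA zA x0x x0z xz; have := dge x xA; have := dge z zA => e1 e2 e3.
  have : a <= 5 by slia.
  by move: eva a4; case: (a) => [|[|[|[|[|[|]]]]]].
have [t0|tp] := posnP t; last first.
  have [p pX] : exists p, p \in mid :\: nb m by apply/card_gt0P.
  have [q qX] : exists q, q \in mid :\: nb m' by apply/card_gt0P; rewrite -/t' tt.
  have pA : p \in mid by move: pX; rewrite in_setD => /andP[].
  have qA : q \in mid by move: qX; rewrite in_setD => /andP[].
  have mq := far_adj mm' dm' dm qX; have mp := far_adj mm dm dm' pX.
  have pq : p != q.
    by apply: contraTneq qX => <-; rewrite in_setD inE mp.
  have := dense_bound (subxx mid) pA qA pq; rewrite (far_far mm dm dm' pX qX).
  have := cardsD1 p mid; have := cardsD1 q (mid :\ p); rewrite pA in_setD1 qA (eq_sym q) pq.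
  have := dgm p pA; have := dgm q qA.
  move: pX qX; rewrite !in_setD ![_ \in nb _]inE => /andP[/negbTE mp0 _] /andP[/negbTE mq0 _].
  by rewrite !(adjC p) !(adjC q) mp mq mp0 mq0 na a4'; slia.
have alladj v : v \in mid -> adj v m /\ adj v m'.
  move=> vA; split; apply: contraT => nv.
    by have /card0_eq/(_ v) := t0; rewrite in_setD vA inE adjC nv.
  have /card0_eq/(_ v) : t' = 0 by rewrite tt.
  by rewrite in_setD vA inE adjC nv.
have dm2 v : v \in mid -> dg mid v = 2.
  by move=> vA; have := dgm v vA; have [-> ->] := alladj v vA; rewrite a4'; slia.
have nmm : adj m m' = false by move: te; rewrite t0; case: (adj m m').
have nx : ~~ R x0 x by apply: mid_R => //; apply/midP.
have nz : ~~ R x0 z by apply: mid_R => //; apply/midP.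
have xzR : R x z by apply: (@left_out_third x0); rewrite ?(adj_neq x0x) ?(adj_neq x0z).
have [u [uA uR]] : exists u, u \in mid /\ R u m.
  have [r|nr] := boolP (R x0 m); first by exists x0.
  by exists x; split=> //; apply: (@left_out_third x0); rewrite ?(adj_neq x0x) //; apply: mid_neq.
have /left_outP[_ gum] := uR; have /left_outP[_ gxz] := xzR.
have um' : m' \in ~: [set u; m].
  by rewrite !inE negb_or mm' andbT eq_sym; apply: mid_neq.
have [i di] := good_dg gum um'.
have d4 : dg [set: H] i = 4.
  rewrite -di; have := left_out_dgK m' uR; rewrite dm' (adjC m' u) (alladj u uA).2 (adjC m') nmm a4'.
  by slia.
have [v vK dv] := good_dg' gxz i; rewrite d4 in dv.
have := left_out_dgK v xzR; rewrite dv.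
have [vA|nvA] := boolP (v \in mid); last first.
  have : v \in high by rewrite -not_mid inE.
  have [hx hx'] := alladj x xA; have [hz hz'] := alladj z zA.
  by rewrite hE !inE => /orP[]/eqP->; rewrite !(adjC _ x) !(adjC _ z) ?hx ?hz ?hx' ?hz' ?dm ?dm' a4'.
rewrite (midP _ vA) a4'; case vx: (adj v x); case vz: (adj v z) => //= _.
have bnd := @dense_bound (mid :\ v) x z (subD1set _ _) xA zA xz.
have nxz : adj x z = false by apply/negP=> h; apply: (mid_triangle x0A xA zA).
have := dg_D1 x vA; have := dg_D1 z vA; rewrite !dm2 // (adjC x v) (adjC z v) vx vz => e1 e2.
move: vK; rewrite !inE negb_or => /andP[vnx vnz].
have := cardsD1 v mid; have := cardsD1 x (mid :\ v); have := cardsD1 z (mid :\ v :\ x).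
rewrite vA !in_setD1 xA zA (eq_sym x v) vnx (eq_sym z v) vnz (eq_sym z x) xz na a4' /=.
by move: bnd; rewrite nxz; slia.
Qed.

Lemma regular v : d v = a.
Proof.
apply/midP; have : v \in ~: high.
  suff -> : high = set0 by rewrite setC0 inE.
  apply/eqP; rewrite -cards_eq0.
  by have := card_high; have := high_neq1; have := high_neq2; case: #|high| => [|[|[|]]].
by rewrite -not_mid setCK.
Qed.

Lemma degree_even : ~~ odd a.
Proof.
have := dg_total; have -> : #|high| = 0.
  by apply: eq_card0 => v; rewrite inE regular ltnn.
by rewrite addn0 oddM oddn andbT.
Qed.

Lemma degree_ge2 : 1 < a.
Proof.
have := degree_even; case ea: a => [|[|]] //= _; exfalso.
apply: nexc; apply: (nomatching_exc arr k1); first by slia.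
move=> x y z w xy; have := regular x; rewrite ea => /dg0 -/(_ y).
by rewrite inE xy => /(_ isT).
Qed.

Lemma all_mid x : x \in mid. Proof. by apply/midP; apply: regular. Qed.

Lemma adj_R x y : adj x y -> ~~ R x y.
Proof. by apply: mid_R; apply: regular. Qed.

Lemma at_most_one_common x y : x != y -> #|nb x :&: nb y| <= ~~ adj x y.
Proof.
move=> xy; case xy': (adj x y) => /=.
  rewrite leqn0 cards_eq0; apply/eqP/setP=> z; rewrite !inE; apply/negP=> /andP[xz yz].
  by apply: (mid_triangle (all_mid x) (all_mid y) (all_mid z)).
have := mid_common (all_mid x) (all_mid y) xy (subxx mid).
by rewrite (setIidPr _) //; apply/subsetP=> z _; exact: all_mid.
Qed.

(** Two neighbours of a vertex are left out together, so [H] has a vertex of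
    degree [a - 2]. In the copy that leaves out [x] and [y], a vertex of this degree
    is adjacent to both. *)
Lemma left_out_common x y : R x y -> exists2 z, adj x z & adj y z.
Proof.
move=> xyR; have /card_gt0P[y0 _] : 0 < #|G| by slia.
have [u [v [_ _ yu yv uv]]] := @two_nbs setT y0 ltac:(rewrite regular; exact: degree_ge2).
have uvR : R u v.
  by apply: (@left_out_third y0); rewrite ?(adj_neq yu) ?(adj_neq yv) //; apply: adj_R.
have /left_outP[_ guv] := uvR; have /left_outP[_ gxy] := xyR.
have y0K : y0 \in ~: [set u; v] by rewrite !inE negb_or (adj_neq yu) (adj_neq yv).
have [i di] := good_dg guv y0K; have [z zK dz] := good_dg' gxy i.
have := left_out_dgK z xyR; have := left_out_dgK y0 uvR.
rewrite !regular yu yv di dz => e1 e2; exists z; rewrite adjC.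
  by move: e1 e2; case: (adj z x); case: (adj z y); slia.
by move: e1 e2; case: (adj z x); case: (adj z y); slia.
Qed.

(** If [x] and [y] were at distance at least three, take a neighbour [z] of [x] and
    a common neighbour [w] of [y] and [z]. None of the pairs [x z], [z w], [w y] and
    [y x] is left out: a forbidden 4-cycle. *)
Lemma common_nb x y : x != y -> ~~ adj x y -> exists2 z, adj x z & adj y z.
Proof.
move=> xy nxy; have [r|nr] := boolP (R x y); first exact: left_out_common.
have [z _ xz] := @dg_pos _ setT x ltac:(rewrite regular; have := degree_ge2; slia).
have [yz|nyz] := boolP (adj y z); first by exists z.
have yNz : y != z by apply: contraNneq nxy => ->.
have yzR : R y z by apply: (@left_out_third x); rewrite ?(adj_neq xz) //; apply: adj_R.
have [w yw zw] := left_out_common yzR.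
have un : uniq [:: x; w; z; y].
  have xw : x != w by apply: contraNneq nxy => ->; rewrite adjC.
  by rewrite /= !inE !negb_or xw (adj_neq xz) xy (eq_sym w) (adj_neq zw) (eq_sym w) (adj_neq yw) (eq_sym z) yNz.
have r := left_out_fourth un (adj_R xz) nr (adj_R (_ : adj w z)).
by have := adj_R yw; rewrite left_outC r // adjC.
Qed.

Lemma moore x y : x != y -> #|nb x :&: nb y| = ~~ adj x y.
Proof.
move=> xy; have := at_most_one_common xy; case xy': (adj x y) => /=.
  by rewrite leqn0 => /eqP.
move=> le; apply/eqP; rewrite eqn_leq le card_gt0.
have [z xz yz] := common_nb xy (negbT xy').
by apply/set0Pn; exists z; rewrite !inE xz.
Qed.
End EvenSum.

(** Counts the walks of length two that start at a vertex. *)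
Lemma moore_order (G : sgraph) a : 0 < #|G| -> (forall v : G, dg setT v = a) ->
  (forall x y : G, x != y -> #|nb x :&: nb y| = ~~ adj x y) -> #|G| = a * a + 1.
Proof.
move=> /card_gt0P[v _] reg moore.
have : \sum_(z in [set: G]) #|nb v :&: nb z| = a * a.
  have -> : a * a = \sum_(y in nb v) dg setT y.
    by rewrite (eq_bigr (fun _ => a)) ?sum_nat_const -?dgT ?reg // => y _.
  rewrite /dg exchange_big /=; apply: eq_bigr => z _.
  rewrite -sum1_card big_mkcond /= [RHS]big_mkcond /=; apply: eq_bigr => y _.
  by rewrite !inE (adjC z y); case: (adj v y); case: (adj y z).
rewrite (bigD1 v) ?inE //= setIid -dgT reg.
rewrite (eq_bigr (fun z => ~~ adj v z : nat)) => [|z /andP[_ zv]]; last by rewrite moore // eq_sym.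
have -> : \sum_(z in [set: G] | z != v) (~~ adj v z : nat) = #|mb v|.
  rewrite -sum1_card big_mkcond /= [RHS]big_mkcond /=; apply: eq_bigr => z _.
  by rewrite !inE /=; case: (z != v); case: (adj v z).
by have := card_mb v; rewrite reg; slia.
Qed.

(** * Moore graphs of even degree *)

Lemma odd_sqr_mod8 x : odd x -> x * x %% 8 = 1.
Proof.
move=> ox; rewrite -modnMml -modnMmr.
have : odd (x %% 8) by rewrite odd_mod.
by have := ltn_pmod x (isT : 0 < 8); case: (x %% 8) => [|[|[|[|[|[|[|[|]]]]]]]].
Qed.

(** Odd squares are 1 modulo 8; common factors 2 are removed by descent. *)
Lemma nonsquare_5mod8 D z w : D %% 8 = 5 -> D * (z * z) = w * w -> z = 0.
Proof.
move=> D5; have [m] := ubnP z; elim: m z w => // m IH z w zm e.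
have oD : odd D by rewrite -(odd_mod D (erefl : odd 8 = false)) D5.
have ow : odd w = odd z by move/(congr1 odd): e; rewrite !oddM oD; case: (odd z); case: (odd w).
case oz: (odd z).
  move/(congr1 (modn^~ 8)): e; rewrite /= -modnMm D5 (odd_sqr_mod8 oz) odd_sqr_mod8 //.
  by rewrite ow.
have [z' ez] : exists z', z = z' * 2.
  by exists z./2; rewrite -[LHS]odd_double_half oz muln2.
have [w' ew] : exists w', w = w' * 2.
  by exists w./2; rewrite -[LHS]odd_double_half ow oz muln2.
have [->//|z0] := posnP z; have z'0 : z' = 0.
  apply: (IH z' w'); [move: zm z0; rewrite ez; lia|].
  by move: e; rewrite ez ew; nia.
by move: z0; rewrite ez z'0.
Qed.

Section Spectral.
Import all_order all_algebra all_field ring.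
Import GRing.Theory Num.Theory.
Local Open Scope ring_scope.

(** A full-rank factorization [P = C R] has [R C = 1]. *)
Lemma idempotent_trace (F : fieldType) n (P : 'M[F]_n) : P *m P = P -> \tr P = (\rank P)%:R.
Proof.
move=> PP; have [C [R [CR [[L LC] [S RS]]]]] : exists (C : 'M_(n, \rank P)) (R : 'M_(\rank P, n)),
    C *m R = P /\ (exists L, L *m C = 1%:M) /\ (exists S, R *m S = 1%:M).
  exists (col_base P), (row_base P); split; first exact: mulmx_base.
  by split; [apply/row_fullP/col_base_full|apply/row_freeP/row_base_free].
have e : R *m C = 1%:M.
  have : L *m ((C *m R) *m (C *m R)) *m S = L *m (C *m R) *m S by rewrite CR PP.
  by rewrite !mulmxA LC !mul1mx -!mulmxA RS mulmx1.
by rewrite -{1}CR mxtrace_mulC e mxtrace1.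
Qed.

Section Spectrum.
Variables (G : sgraph) (a : nat).
Hypothesis reg : forall v : G, dg setT v = a.
Hypothesis moore : forall x y : G, x != y -> #|nb x :&: nb y| = ~~ adj x y.
Hypothesis order : #|G| = (a * a + 1)%N.
Hypothesis a3 : (2 < a)%N.
Let n := #|G|.

Let A : 'M[algC]_n := \matrix_(i, j) (adj (enum_val i) (enum_val j))%:R.
Let J : 'M[algC]_n := const_mx 1.

Lemma sum_enum (p : G -> nat) : \sum_(i < n) (p (enum_val i))%:R = (\sum_(x : G) p x)%N%:R :> algC.
Proof.
rewrite natr_sum [RHS](reindex (@enum_val G G)) /=; first by [].
by apply: onW_bij; apply: enum_val_bij.
Qed.

Lemma adj_square : A *m A = J - A + (a%:R - 1)%:M.
Proof.
apply/matrixP=> i j; rewrite !mxE.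
under eq_bigr => l _ do rewrite !mxE -natrM.
rewrite (sum_enum (fun x => (adj (enum_val i) x * adj x (enum_val j))%N)).
have -> : (\sum_(x : G) adj (enum_val i) x * adj x (enum_val j))%N = #|nb (enum_val i) :&: nb (enum_val j)|.
  rewrite -sum1_card [RHS]big_mkcond /=; apply: eq_bigr => x _.
  by rewrite !inE (adjC x); case: (adj _ _); case: (adj _ _).
have [->|ij] := eqVneq i j.
  by rewrite setIid -dgT reg adjxx ?eqxx /= mulr1n mulr0n; ring.
rewrite moore ?(inj_eq enum_val_inj) // mulr0n addr0.
by case: (adj _ _) => /=; ring.
Qed.

Lemma adj_ones : A *m J = a%:R *: J.
Proof.
apply/matrixP=> i j; rewrite !mxE.
under eq_bigr => l _ do rewrite !mxE mulr1.
rewrite (sum_enum (fun x => adj (enum_val i) x)) mulr1 -(reg (enum_val i)).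
by congr (_%:R); rewrite /dg; apply: eq_bigl => x; rewrite inE.
Qed.

Lemma ones_adj : J *m A = a%:R *: J.
Proof.
apply/matrixP=> i j; rewrite !mxE.
under eq_bigr => l _ do rewrite !mxE mul1r adjC.
rewrite (sum_enum (fun x => adj (enum_val j) x)) mulr1 -(reg (enum_val j)).
by congr (_%:R); rewrite /dg; apply: eq_bigl => x; rewrite inE.
Qed.

Lemma ones_square : J *m J = n%:R *: J.
Proof.
apply/matrixP=> i j; rewrite !mxE.
under eq_bigr => l _ do rewrite !mxE mulr1.
by rewrite sumr_const card_ord mulr1.
Qed.

(** On the vectors of sum zero, [A] satisfies [A ^ 2 + A = a - 1], so its
    eigenvalues there are [(-1 + theta) / 2] and [(-1 - theta) / 2]. The projection
    onto the first eigenspace is a combination of [A], [1] and [J], and its trace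
    is the dimension [r]. *)
Lemma eigenspace_dim : exists r : nat, exists2 theta : algC, theta ^+ 2 = 4%:R * a%:R - 3%:R &
  theta * (2%:R * r%:R - a%:R ^+ 2) = a%:R ^+ 2 - 2%:R * a%:R.
Proof.
pose theta : algC := sqrtC (4%:R * a%:R - 3%:R).
have th2 : theta ^+ 2 = 4%:R * a%:R - 3%:R by rewrite sqrtCK.
have th0 : theta != 0.
  apply/eqP=> e; move: th2; rewrite e expr0n /= => /eqP; rewrite eq_sym subr_eq0 -natrM eqr_nat.
  by move=> /eqP; lia.
have n0 : n%:R != 0 :> algC by rewrite pnatr_eq0 /n order; lia.
have nE : n%:R = a%:R ^+ 2 + 1 :> algC by rewrite /n order natrD natrM expr2.
(* B squares to theta^2 on the vectors of sum zero, so (B + theta) / (2 theta) is a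
   projection there; the multiple w of J makes P vanish on the all-ones vector *)
pose B : 'M[algC]_n := 2%:R *: A + 1%:M.
pose u : algC := (2%:R * theta)^-1.
pose w : algC := - (2%:R * a%:R + 1 + theta) / (2%:R * theta * n%:R).
pose P := u *: B + 2%:R^-1 *: 1%:M + w *: J.
have PP : P *m P = P.
  have BB : B *m B = 4%:R *: J + (4%:R * a%:R - 3%:R) *: 1%:M.
    rewrite /B !mulmxDl !mulmxDr -!scalemxAl -!scalemxAr !mulmx1 !mul1mx adj_square.
    by apply/matrixP=> i j; rewrite !mxE; case: (i == j) => /=; ring.
  have BJ : B *m J = (2%:R * a%:R + 1) *: J.
    by rewrite /B mulmxDl -scalemxAl adj_ones mul1mx; apply/matrixP=> i j; rewrite !mxE; ring.
  have JB : J *m B = (2%:R * a%:R + 1) *: J.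
    by rewrite /B mulmxDr -scalemxAr ones_adj mulmx1; apply/matrixP=> i j; rewrite !mxE; ring.
  have eu : u * u * (4%:R * a%:R - 3%:R) = 4%:R^-1 by rewrite -th2 /u; field.
  have ew : 4%:R * u * u + w * w * n%:R + 2%:R * u * w * (2%:R * a%:R + 1) = 0.
    have -> : 4%:R * u * u + w * w * n%:R + 2%:R * u * w * (2%:R * a%:R + 1) =
       (4%:R * n%:R + theta ^+ 2 - (2%:R * a%:R + 1) ^+ 2) / (4%:R * theta ^+ 2 * n%:R).
      by rewrite /u /w; field; rewrite th0 n0.
    by rewrite th2 nE; apply/eqP; rewrite mulf_eq0; apply/orP; left; apply/eqP; ring.
  rewrite /P; clearbody B u w; rewrite !mulmxDl !mulmxDr -!scalemxAl -!scalemxAr !mulmx1 !mul1mx.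
  rewrite BB BJ JB ones_square; apply/matrixP=> i j; rewrite !mxE.
  set b := B i j; set e := (i == j)%:R : algC.
  have -> : u * b + 2^-1 * e + w * 1 = u * b + 2^-1 * e + w * 1 +
     e * (u * u * (4%:R * a%:R - 3%:R) - 4%:R^-1) +
     (4%:R * u * u + w * w * n%:R + 2%:R * u * w * (2%:R * a%:R + 1)).
    by rewrite eu ew; ring.
  by field.
have trA : \tr A = 0.
  by rewrite /mxtrace big1 // => i _; rewrite mxE adjxx.
have trJ : \tr J = n%:R.
  rewrite /mxtrace (eq_bigr (fun _ => 1)) ?sumr_const ?card_ord // => i _; by rewrite mxE.
have := idempotent_trace PP; set r := \rank P => trP; exists r, theta => //.
have : (2%:R * theta * n%:R) * \tr P = theta * n%:R ^+ 2 + n%:R ^+ 2 - n%:R * (2%:R * a%:R + 1 + theta).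
  rewrite /P /B !(mxtraceD, mxtraceZ) trA trJ mxtrace1 /u /w.
  by field; rewrite th0 n0.
rewrite trP => e; apply: (mulfI n0); rewrite -[RHS]addr0.
have e' : n%:R * (theta * (2%:R * r%:R)) = n%:R * (theta * n%:R + n%:R - (2%:R * a%:R + 1 + theta)).
  by move: e => e; transitivity (2%:R * theta * n%:R * r%:R); [ring|rewrite e; ring].
rewrite mulrBr mulrBr e' nE; ring.
Qed.

(** For even [a] the number [4 * a - 3] is 5 modulo 8, so [theta] is irrational
    and both sides of the identity of [eigenspace_dim] vanish: [a = 2]. *)
Lemma moore_degree_odd : odd a.
Proof.
apply/negPn/negP=> eva; have [r [theta th2 e]] := eigenspace_dim.
have natB x y : (x <= y)%N -> (y - x)%N%:R = y%:R - x%:R :> algC by move=> ?; rewrite natrB.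
have [z ez] : exists z : nat, (2%:R * r%:R - a%:R ^+ 2 : algC) ^+ 2 = (z * z)%N%:R.
  have [le|/ltnW le] := leqP (a * a)%N (2 * r)%N.
    by exists (2 * r - a * a)%N; rewrite natrM natB // !natrM; ring.
  by exists (a * a - 2 * r)%N; rewrite natrM natB // !natrM; ring.
have : ((4 * a - 3) * (z * z))%N = ((a * a - 2 * a) * (a * a - 2 * a))%N.
  apply/eqP; rewrite -(eqr_nat algC) !natrM -natrM -ez !natB; try nia.
  by rewrite !natrM -th2 -exprMn e; apply/eqP; ring.
have D5 : (4 * a - 3 = 5 %[mod 8])%N.
  have [b eb] : exists b, a = (b * 2)%N by exists a./2; rewrite muln2 -[LHS]odd_double_half (negbTE eva).
  have -> : (4 * a - 3 = (b - 1) * 8 + 5)%N by rewrite eb; move: a3; rewrite eb; lia.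
  by rewrite modnMDl.
move=> E; have z0 := nonsquare_5mod8 D5 E; move: E; rewrite z0 => E; move: a3; nia.
Qed.
End Spectrum.
End Spectral.

(** * The bound for odd order *)

Lemma even_sum_false (G H : sgraph) a : arrows G H -> ~ exc H -> 4 < #|H| -> #|G| = #|H| + 2 ->
  odd #|G| ->
  (forall x y : G, left_out H x y -> dg setT x + dg setT y = 2 * a + adj x y) -> False.
Proof.
move=> arr nexc k5 n2 on sum2a.
have reg := regular arr nexc k5 n2 on sum2a.
have mo := moore arr nexc k5 n2 on sum2a.
have ev := degree_even arr nexc k5 n2 on sum2a.
have n0 : 0 < #|G| by slia.
have nE := moore_order n0 reg mo.
have a3 : 2 < a.
  by rewrite ltnNge; apply/negP=> a2; have := leq_mul a2 a2; slia.
by have := moore_degree_odd reg mo nE a3; rewrite (negbTE ev).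
Qed.

Lemma left_out_compl (G H : sgraph) (x y : G) :
  @left_out (compl G) (compl H) x y -> @left_out G H x y.
Proof. by case/left_outP=> xy gd; apply/left_outP; split=> //; apply: compl_good. Qed.

Lemma adj_le_dg (G : sgraph) (x y : G) : adj x y <= dg setT x.
Proof.
case xy: (adj x y) => //=; rewrite dgT card_gt0; apply/set0Pn; exists y.
by rewrite inE.
Qed.

(** In the complement the constant [c] of the degree sums becomes
    [2 * n - 3 - c], which has the other parity. *)
Lemma order_odd (G H : sgraph) : arrows G H -> ~ exc H -> odd #|H| -> #|G| <= #|H| + 1.
Proof.
move=> arr nexc ok; rewrite leqNgt; apply/negP=> lt.
have n2 : #|G| = #|H| + 2 by have := order_bound arr nexc; slia.
have k5 : 4 < #|H|.
  have [k3|k3] := leqP #|H| 3; first by case: nexc; apply: order_le3_exc.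
  by move: ok k3; case: #|H| => [|[|[|[|[|]]]]].
have on : odd #|G| by rewrite n2 oddD ok.
have [c sc] := left_out_dg arr ltac:(slia) n2.
have [oc|ec] := boolP (odd c); last first.
  apply: (even_sum_false (a := c./2) arr nexc k5 n2 on) => x y /sc->.
  by rewrite mul2n -{1}(odd_double_half c) (negbTE ec).
have nexc' : ~ exc (compl H) by move/exc_compl.
apply: (@even_sum_false _ _ (2 * #|G| - 3 - c)./2 (arrows_compl arr) nexc' k5 n2 on) => x y r.
have xy : x != y by case/left_outP: r.
have E : @adj (compl G) x y = ~~ @adj G x y :> bool by rewrite /= /compl_rel xy.
have := sc x y (left_out_compl r); have := @codeg G x; have := @codeg G y; rewrite E.
have le : c <= 2 * #|G| - 3.
  have := sc x y (left_out_compl r); have := @codeg G x; have := @codeg G y.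
  have := @adj_le_dg (compl G) x y.
  by rewrite E; case: (@adj G x y) => /=; cosimp; slia.
have e : 2 * (2 * #|G| - 3 - c)./2 = 2 * #|G| - 3 - c.
  have o : odd (2 * #|G| - 3 - c) = false by rewrite oddB // oddB ?oddM ?oc //; slia.
  by rewrite mul2n -[RHS]odd_double_half o.
by rewrite e; cosimp; case: (@adj G x y) => /=; slia.
Qed.

(** * Exceptional graphs are arrowed by arbitrarily large graphs *)

Definition large (H : sgraph) := forall N, exists2 G : sgraph, N <= #|G| & arrows G H.

Lemma large_f H : large H -> f H = None.
Proof.
move=> lH; rewrite /f; case: boolp.pselect => // e; exfalso; case: e => n [_ mx].
by have [G nG /mx] := lH n.+1; rewrite leqNgt nG.
Qed.

Lemma arrows_iso G H H' : sg_iso H H' -> arrows G H' -> arrows G H.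
Proof.
move=> iHH' [le arr]; have e := sg_iso_card iHH'; split; first by rewrite e.
move=> c cS; have [i|S [iS cI]] := arr (fun v => cast_ord e (c v)).
  by have [v cv] := cS (cast_ord (esym e) i); exists v; rewrite cv cast_ordKV.
exists S; split; first exact: sg_iso_trans iS (sg_iso_sym iHH').
by move=> x y xS yS cxy; apply: cI => //; rewrite cxy.
Qed.

Lemma large_iso H H' : sg_iso H H' -> large H' -> large H.
Proof. by move=> i lH N; have [G nG a] := lH N; exists G => //; apply: arrows_iso i a. Qed.

Lemma large_compl H : large (compl H) -> large H.
Proof.
move=> lH N; have [G nG /arrows_compl a] := lH N; exists (compl G) => //.
by apply: arrows_iso a; apply/sg_iso_sym/compl_complK.
Qed.

Lemma arrows_reps (G H : sgraph) : #|H| <= #|G| ->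
  (forall (c : G -> 'I_#|H|) (s : 'I_#|H| -> G), cancel s c ->
     exists g : H -> G, injective (c \o g) /\ forall i j, adj (g i) (g j) = adj i j) ->
  arrows G H.
Proof.
move=> le h; split=> // c cS; have [s sK] := fin_all_exists cS.
have [g [gI ga]] := h c s sK; exists [set g i | i in [set: H]]; split.
  by apply/goodP; exists g; split=> // i j e; apply: gI; rewrite /= e.
by move=> _ _ /imsetP[i _ ->] /imsetP[j _ ->] e; rewrite (gI i j).
Qed.

Lemma complete_large m : large (complete_graph m).
Proof.
move=> N; exists (complete_graph (N + m)); first by rewrite card_ord leq_addr.
apply: arrows_reps => [|c s sK]; first by rewrite !card_ord leq_addl.
exists (fun i => s (enum_rank i)); split=> [i j /=|i j].
  by rewrite !sK => /enum_rank_inj.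
by rewrite /= /complete_rel (can_eq sK) (inj_eq enum_rank_inj).
Qed.

Lemma star_large m : large (star_graph m).
Proof.
move=> N; exists (star_graph (N + m)); first by rewrite card_option card_ord ltnW // ltnS leq_addr.
apply: arrows_reps => [|c s sK]; first by rewrite !card_option !card_ord ltnS leq_addl.
pose None' : star_graph (N + m) := None; pose none : star_graph m := None.
(* the copy has to contain the centre, so the centre represents its colour *)
pose s' i := if i == c None' then None' else s i.
have s'K : cancel s' c by move=> i; rewrite /s'; case: eqP => [->|].
pose g (x : star_graph m) := s' (tperm (enum_rank none) (c None') (enum_rank x)).
have gI : injective (c \o g) by move=> x y /=; rewrite !s'K => /perm_inj/enum_rank_inj.
have gN : g None = None by rewrite /g tpermL /s' eqxx.
exists g; split=> // x y; rewrite /= /star_rel.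
have gS z : isSome (g z) = isSome z.
  case: z => [z|]; last by rewrite gN.
  case e: (g (Some z)) => //; have : (c \o g) (Some z) = (c \o g) None by rewrite /= e gN.
  by move/gI.
by rewrite !gS.
Qed.

(** * A family of graphs that arrow P3 + K1 *)

(** A block consists of an edge between 0 and 1 and an isolated vertex 2, and
    vertex [t] of a block is joined to vertex [t + 1] modulo 3 of every later block.
    Only the order of the blocks matters, so any four blocks induce the same graph
    on 12 vertices. *)
Definition gadget (x t y s : nat) : bool :=
  if x == y then (t != s) && (t < 2) && (s < 2)
  else if x < y then s == t.+1 %% 3 else t == s.+1 %% 3.

Lemma gadgetC x t y s : gadget x t y s = gadget y s x t.
Proof. by rewrite /gadget (eq_sym s t) -!andbA (andbC (s < 2)); case: (ltngtP x y). Qed.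

Lemma gadgetxx x t : gadget x t x t = false.
Proof. by rewrite /gadget !eqxx. Qed.

Section Gadgets.
Variable m : nat.
Definition gadget_rel : rel ('I_m * 'I_3) := fun u v => gadget u.1 u.2 v.1 v.2.
Lemma gadget_sym : symmetric gadget_rel. Proof. by move=> u v; apply: gadgetC. Qed.
Lemma gadget_irr : irreflexive gadget_rel. Proof. by move=> u; apply: gadgetxx. Qed.
Definition gadget_graph := SGraph gadget_sym gadget_irr.
End Gadgets.

(** The graph induced by four blocks, on the numbers [3 * x + t] below 12. *)
Definition gadj q r := gadget (q %/ 3) (q %% 3) (r %/ 3) (r %% 3).

Definition cherry a b c d := [&& gadj a b, gadj b c, ~~ gadj a c, ~~ gadj a d, ~~ gadj b d & ~~ gadj c d].

(** Only 12 arrangements, because the ends of the path are interchangeable. *)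
Definition tests (a b c d : nat) : seq (nat * nat * nat * nat) :=
  [:: (b, a, c, d); (b, a, d, c); (c, a, d, b); (a, b, c, d); (a, b, d, c); (c, b, d, a);
      (a, c, b, d); (a, c, d, b); (b, c, d, a); (a, d, b, c); (a, d, c, b); (b, d, c, a)].

Definition hit a b c d := lhas (fun u : nat * nat * nat * nat => let: (a, b, c, d) := u in
  if gadj a b then cherry a b c d else false) (tests a b c d).

Definition hits v L1 L2 L3 := lhas (fun a => lhas (fun b => lhas (fun d => hit v a b d) L3) L2) L1.

(** Tries all extensions of a partial colouring, given by its four classes, and
    closes a branch as soon as the new vertex completes a rainbow copy. *)
Fixpoint dfs todo L0 L1 L2 L3 : bool :=
  if todo is v :: todo' then
    if (if hits v L1 L2 L3 then true else dfs todo' (v :: L0) L1 L2 L3) then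
    if (if hits v L0 L2 L3 then true else dfs todo' L0 (v :: L1) L2 L3) then
    if (if hits v L0 L1 L3 then true else dfs todo' L0 L1 (v :: L2) L3) then
       (if hits v L0 L1 L2 then true else dfs todo' L0 L1 L2 (v :: L3))
    else false else false else false
  else false.

(** The vertices [a], [b], [c], [d] represent the four colours. Up to renaming the
    colours they are increasing. *)
Definition root a b c d := if hit a b c d then true else
  dfs [seq v <- iota 0 12 | v \notin [:: a; b; c; d]] [:: a] [:: b] [:: c] [:: d].

Lemma root_true : lall (fun a => lall (fun b => lall (fun c => lall (root a b c)
   (iota c.+1 (11 - c))) (iota b.+1 (11 - b))) (iota a.+1 (11 - a))) (iota 0 12).
Proof. by vm_compute. Qed.

Lemma hit_sound a b c d : hit a b c d ->
  exists p q r s, cherry p q r s /\ perm_eq [:: p; q; r; s] [:: a; b; c; d].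
Proof.
rewrite /hit lhasE => /hasP[[[[p q] r] s] pqrs h]; exists p, q, r, s; split.
  by move: h; case: ifP.
apply/seq.permP => P; move: pqrs; rewrite /tests !inE.
by do 11![case/orP; first by (case/eqP=> -> -> -> ->; rewrite /=; lia)]; case/eqP=> -> -> -> ->; rewrite /=; lia.
Qed.

Lemma hits_sound v L1 L2 L3 : hits v L1 L2 L3 ->
  exists a b d, [/\ a \in L1, b \in L2, d \in L3 & hit v a b d].
Proof.
rewrite /hits lhasE => /hasP[a aL]; rewrite lhasE => /hasP[b bL]; rewrite lhasE => /hasP[d dL h].
by exists a, b, d.
Qed.

Section Search.
Variable col : nat -> nat.
Hypothesis col4 : forall v, v < 12 -> col v < 4.

Definition rainbow_cherry := exists p q r s,
  [/\ cherry p q r s, all (fun v => v < 12) [:: p; q; r; s] & uniq [seq col v | v <- [:: p; q; r; s]]].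

Lemma hit_rainbow a b c d : all (fun v => v < 12) [:: a; b; c; d] ->
  uniq [seq col v | v <- [:: a; b; c; d]] -> hit a b c d -> rainbow_cherry.
Proof.
move=> lt un /hit_sound[p [q [r [s [ch pe]]]]]; exists p, q, r, s; split=> //.
  by rewrite (perm_all _ pe).
by rewrite (perm_uniq (perm_map col pe)).
Qed.

Definition coloured i L := all (fun v => (v < 12) && (col v == i)) L.

Lemma hits_rainbow v i j k l L1 L2 L3 : v < 12 -> col v = i -> coloured j L1 -> coloured k L2 ->
  coloured l L3 -> uniq [:: i; j; k; l] -> hits v L1 L2 L3 -> rainbow_cherry.
Proof.
move=> v12 cv /allP c1 /allP c2 /allP c3 un /hits_sound[a [b [d [aL bL dL]]]].
have /andP[a12 /eqP ca] := c1 a aL; have /andP[b12 /eqP cb] := c2 b bL.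
have /andP[d12 /eqP cd] := c3 d dL.
by apply: hit_rainbow; rewrite /= ?v12 ?a12 ?b12 ?d12 ?cv ?ca ?cb ?cd.
Qed.

Lemma dfs_sound todo L0 L1 L2 L3 : all (fun v => v < 12) todo ->
  coloured 0 L0 -> coloured 1 L1 -> coloured 2 L2 -> coloured 3 L3 ->
  dfs todo L0 L1 L2 L3 -> rainbow_cherry.
Proof.
elim: todo L0 L1 L2 L3 => // v todo IH L0 L1 L2 L3 /andP[v12 t12] c0 c1 c2 c3.
have := col4 v12 => cv; have [e|[e|[e|e]]] : col v = 0 \/ col v = 1 \/ col v = 2 \/ col v = 3.
- by move: cv; case: (col v) => [|[|[|[|]]]] // _; tauto.
all: rewrite [dfs _ _ _ _ _]/=.
- case: ifP => // + _; case: ifP => [h _|_]; first exact: (hits_rainbow v12 e c1 c2 c3).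
  by apply: IH; rewrite // /coloured /= v12 e.
- case: ifP => // _; case: ifP => // + _; case: ifP => [h _|_]; first exact: (hits_rainbow v12 e c0 c2 c3).
  by apply: IH; rewrite // /coloured /= v12 e.
- case: ifP => // _; case: ifP => // _; case: ifP => // + _.
  case: ifP => [h _|_]; first exact: (hits_rainbow v12 e c0 c1 c3).
  by apply: IH; rewrite // /coloured /= v12 e.
case: ifP => // _; case: ifP => // _; case: ifP => // _.
case: ifP => [h _|_]; first exact: (hits_rainbow v12 e c0 c1 c2).
by apply: IH; rewrite // /coloured /= v12 e.
Qed.

Lemma root_sound a b c d : a < b -> b < c -> c < d -> d < 12 ->
  col a = 0 -> col b = 1 -> col c = 2 -> col d = 3 -> rainbow_cherry.
Proof.
move=> ab bc cd d12 ca cb cc cd'.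
have c12 := ltn_trans cd d12; have b12 := ltn_trans bc c12; have a12 := ltn_trans ab b12.
have := root_true; rewrite lallE => /allP/(_ a); rewrite mem_iota a12 => /(_ isT).
rewrite lallE => /allP/(_ b); rewrite mem_iota ab => h; have {h} := h ltac:(lia).
rewrite lallE => /allP/(_ c); rewrite mem_iota bc => h; have {h} := h ltac:(lia).
rewrite lallE => /allP/(_ d); rewrite mem_iota cd => h; have {h} := h ltac:(lia).
rewrite /root; case: ifP => [h _|_].
  by apply: hit_rainbow h; rewrite /= ?a12 ?b12 ?c12 ?d12 ?ca ?cb ?cc ?cd'.
have t12 : all (fun v => v < 12) [seq v <- iota 0 12 | v \notin [:: a; b; c; d]].
  by apply/allP=> v; rewrite mem_filter mem_iota => /andP[_ /andP[]].
by apply: (dfs_sound t12); rewrite /coloured /= ?a12 ?b12 ?c12 ?d12 ?ca ?cb ?cc ?cd'.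
Qed.
End Search.

(** Four representatives of the colours meet at most four blocks. *)
Lemma P3K1_large : large (disjoint_union (path_graph 3) (complete_graph 1)).
Proof.
set H := disjoint_union _ _ => N; have h4 : #|H| = 4 by rewrite card_sum !card_ord.
pose m := N + 4; exists (gadget_graph m).
  by rewrite card_prod !card_ord /m; lia.
apply: arrows_reps => [|c s sK]; first by rewrite h4 card_prod !card_ord /m; lia.
have [||B sB cB] := @superset _ [set (s i).1 | i in [set: 'I_#|H|]] 4.
- by rewrite (leq_trans (leq_imset_card _ _)) // cardsT card_ord h4.
- by rewrite card_ord /m; lia.
pose l := enum B; have sl : size l = 4 by rewrite -cardE.
have ltr : transitive (fun x y : 'I_m => x < y) by move=> x y z; apply: ltn_trans.
have srt : sorted (fun x y : 'I_m => x < y) l.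
  have : sorted (fun x y : 'I_m => x < y) (enum 'I_m).
    by rewrite -(@sorted_map _ _ val ltn) val_enum_ord iota_ltn_sorted.
  by move=> s1; rewrite /l /enum_mem; apply: sorted_filter => //; rewrite -enumT.
have x0 : 'I_m by apply: (@Ordinal m 0); rewrite /m; lia.
pose emb q : gadget_graph m := (nth x0 l (q %/ 3), inord (q %% 3)).
have lt_l p q : p < 4 -> q < 4 -> p < q -> nth x0 l p < nth x0 l q.
  by move=> p4 q4; apply: (sorted_ltn_nth ltr x0 srt); rewrite inE sl.
have embadj p q : p < 12 -> q < 12 -> adj (emb p) (emb q) = gadj p q.
  move=> p12 q12; rewrite /= /gadget_rel /gadj /= !inordK ?ltn_pmod //.
  have p4 : p %/ 3 < 4 by rewrite ltn_divLR.
  have q4 : q %/ 3 < 4 by rewrite ltn_divLR.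
  rewrite /gadget; case: (ltngtP (p %/ 3) (q %/ 3)) => [h|h|->].
  - have := lt_l _ _ p4 q4 h; case: ltngtP => //.
  - have := lt_l _ _ q4 p4 h; case: ltngtP => //.
  - by rewrite eqxx.
pose code_of i : nat := 3 * index (s i).1 l + (s i).2.
have emb_code i : emb (code_of i) = s i.
  have t3 : (s i).2 < 3 by [].
  rewrite /emb /code_of mulnC divnMDl // divn_small // addn0 modnMDl modn_small //.
  rewrite nth_index ?mem_enum; last by apply: (subsetP sB); apply: imset_f; rewrite inE.
  by rewrite inord_val -surjective_pairing.
have code12 i : code_of i < 12.
  have : index (s i).1 l < 4.
    by rewrite -sl index_mem mem_enum; apply: (subsetP sB); apply: imset_f; rewrite inE.
  by have : (s i).2 < 3 by []; rewrite /code_of; lia.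
have codeI : injective code_of.
  by move=> i j e; rewrite -(sK i) -(sK j) -!emb_code e.
pose qs := sort leq [seq code_of i | i <- enum 'I_#|H|].
have qsp : perm_eq qs [seq code_of i | i <- enum 'I_#|H|] by rewrite /qs; apply/permPl; apply: perm_sort.
have szq : size qs = 4 by rewrite (perm_size qsp) size_map size_enum_ord.
have uq : uniq qs by rewrite (perm_uniq qsp) map_inj_uniq ?enum_uniq.
have lq : all (fun v => v < 12) qs.
  by rewrite (perm_all _ qsp); apply/allP=> _ /mapP[i _ ->].
have stq : sorted ltn qs.
  by rewrite ltn_sorted_uniq_leq uq; apply: sort_sorted; apply: leq_total.
pose cs := [seq c (emb q) | q <- qs].
have ucs : uniq cs.
  rewrite (perm_uniq (perm_map _ qsp)) -map_comp map_inj_uniq ?enum_uniq // => i j /=.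
  by rewrite !emb_code !sK.
have allc i : i \in cs.
  apply/mapP; exists (code_of i); last by rewrite emb_code sK.
  by rewrite (perm_mem qsp) map_f // mem_enum.
have scs : size cs = 4 by rewrite size_map.
pose col v := index (c (emb v)) cs.
have col4 v : v < 12 -> col v < 4 by move=> _; rewrite /col -scs index_mem.
have colq j : j < 4 -> col (nth 0 qs j) = j.
  move=> j4; rewrite /col -(nth_map 0 (c (emb 0)) (fun q => c (emb q))) ?szq //.
  by rewrite index_uniq // scs.
have nq j : j < 4 -> nth 0 qs j < 12 by move=> j4; apply: (allP lq); apply: mem_nth; rewrite szq.
have oq i j : i < j -> j < 4 -> nth 0 qs i < nth 0 qs j.
  by move=> ij j4; apply: (sorted_ltn_nth ltn_trans 0 stq); rewrite ?inE ?szq // (ltn_trans ij).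
have [p [q [r [t [ch lt un]]]]] := root_sound col4 (oq 0 1 isT isT) (oq 1 2 isT isT) (oq 2 3 isT isT)
  (nq 3 isT) (colq 0 isT) (colq 1 isT) (colq 2 isT) (colq 3 isT).
case/and5P: lt => p12 q12 r12 t12 _.
pose g (x : H) := emb (match x with inl i => nth t [:: p; q; r] i | inr _ => t end).
have gcol (x : H) : col (match x with inl i => nth t [:: p; q; r] i | inr _ => t end) = index (c (g x)) cs by [].
exists g; split.
  move=> x y /= e; have e2 : index (c (g x)) cs = index (c (g y)) cs by rewrite e.
  move: un e2; rewrite -!gcol /= !inE !negb_or !andbT.
  case/and3P=> [/and3P[/eqP pq /eqP pr /eqP pt] /andP[/eqP qr /eqP qt] /eqP rt].
  case: x e => [[[|[|[|x]]] hx]|x] _; case: y => [[[|[|[|y]]] hy]|y] //= e2;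
   try (by exfalso; auto); try (by congr inl; apply: val_inj); by rewrite (ord1 x) (ord1 y).
case/and5P: ch => pq qr npr npt /andP[nqt nrt].
have sym a b : gadj a b = gadj b a by apply: gadgetC.
have self a : gadj a a = false by apply: gadgetxx.
move: npr npt nqt nrt => /negbTE npr /negbTE npt /negbTE nqt /negbTE nrt.
by case=> [[[|[|[|x]]] hx]|x]; case=> [[[|[|[|y]]] hy]|y] //;
  rewrite /g embadj //= /path_rel /complete_rel /= ?(ord1 x) ?(ord1 y) ?self //
    ?pq ?qr ?npr ?npt ?nqt ?nrt // sym ?pq ?qr ?npr ?npt ?nqt ?nrt.
Qed.

Lemma exceptional_large H : exceptional H -> large H.
Proof.
case=> [[n i]|[n i]|i]; apply: (large_iso i).
- exact: complete_large.
- exact: star_large.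
- exact: P3K1_large.
Qed.

Lemma exc_large H : exc H -> large H.
Proof. by case=> e; [apply: exceptional_large|apply/large_compl/exceptional_large]. Qed.

(** * The value of f *)

Lemma arrows_refl H : arrows H H.
Proof.
apply: arrows_reps => // c s sK; exists id; split=> //.
have bs : bijective s by apply: inj_card_bij (can_inj sK) _; rewrite card_ord.
exact: can_inj ((bij_can_sym bs c).2 sK).
Qed.

(** Since [H] arrows itself, a bound on the orders makes the maximum exist. *)
Lemma f_le (H : sgraph) b : (forall G : sgraph, arrows G H -> #|G| <= b) -> le_enat (f H) b.
Proof.
move=> bd; pose p n := boolp.asbool (exists2 G : sgraph, #|G| = n & arrows G H).
have pe : exists n, p n by exists #|H|; apply/boolp.asboolP; exists H => //; apply: arrows_refl.
have pb n : p n -> n <= b by move/boolp.asboolP=> [G <- /bd].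
case: (ex_maxnP pe pb) => m /boolp.asboolP[G Gm aG] mx.
rewrite /f; case: boolp.pselect => [e|[]]; last first.
  by exists m; split; [exists G|move=> G' aG'; apply: mx; apply/boolp.asboolP; exists G'].
by rewrite /=; case: (boolp.cid e) => /= n [[G' <- /bd]].
Qed.

Theorem theorem4 (k : nat) (H : sgraph) (hk : #|H| = k) :
  (exceptional H \/ exceptional (compl H) -> f H = None) /\
  (~ (exceptional H \/ exceptional (compl H)) ->
     (~~ odd k -> le_enat (f H) (k + 2)) /\
     (odd k -> le_enat (f H) (k + 1))).
Proof.
split=> [e|nexc]; first exact/large_f/exc_large.
rewrite -hk; split=> ok; apply: f_le => G arr; first exact: order_bound arr nexc.
exact: order_odd arr nexc ok.
Qed.
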